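(* Let $F(x,y)=f_y^*(x)$ for $0\le x,y\le1$. For each $n$ let $M_n$ be a random ASM of order $n$ chosen according to the domino measure $\mathbb{P}^n_{\mathrm{Dom}}$, and let $H_n=H(M_n)=(h_{i,j}^n)_{i,j=0}^n$ be its height matrix. Then as $n\to\infty$ we have the convergence in probability $$\max_{0\le i,j\le n}\left|\frac{h_{i,j}^n}{n}-F(i/n,j/n)\right|\longrightarrow0.$$
   Context: An alternating sign matrix (ASM) of order $n$ is an $n\times n$ matrix with entries in $\{0,-1,1\}$ such that in every row and every column the sum of the entries is $1$ and the nonzero entries alternate in sign. $\mathcal{A}_n$ is the set of ASMs of order $n$; $N_+(M)$ is the number of entries of $M$ equal to $1$. The domino measure is the probability measure on $\mathcal{A}_n$ given by $\mathbb{P}^n_{\mathrm{Dom}}(M)=2^{N_+(M)-\binom{n+1}{2}}$. The height matrix of $M=(m_{i,j})_{i,j=1}^n$ is $H(M)=(h_{i,j})_{i,j=0}^n$ with $h_{i,j}=\sum_{p\le i}\sum_{q\le j}m_{p,q}$. The functions $f_y^*:[0,1]\to[0,1]$ are defined as follows. Let $$\begin{aligned}Z(x,y)=\frac{2}{\pi}\biggl[&(x-\tfrac12)\arctan\biggl(\frac{\sqrt{\frac14-(x-\frac12)^2-(y-\frac12)^2}}{\frac12-y}\biggr)+\frac12\arctan\biggl(\frac{2(x-\frac12)(\frac12-y)}{\sqrt{\frac14-(x-\frac12)^2-(y-\frac12)^2}}\biggr)\\&-(\tfrac12-y)\arctan\biggl(\frac{x-\frac12}{\sqrt{\frac14-(x-\frac12)^2-(y-\frac12)^2}}\biggr)\biggr].\end{aligned}$$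 For $0<y<1/2$: $f_y^*(x)=0$ if $0\le x\le\frac{1-2\sqrt{y(1-y)}}{2}$; $f_y^*(x)=\frac y2+\frac12Z(x,y)$ if $\frac{1-2\sqrt{y(1-y)}}{2}<x<\frac{1+2\sqrt{y(1-y)}}{2}$; $f_y^*(x)=y$ if $\frac{1+2\sqrt{y(1-y)}}{2}\le x\le1$. For $y=1/2$: $f_{1/2}^*(x)=x/2$. For $1/2<y<1$: $f_y^*(x)=x-f_{1-y}^*(x)$. At the endpoints, $f_0^*(x)=0$ and $f_1^*(x)=x$. *)

(* Defs.v *)
From HB Require Import structures.
From mathcomp Require Import all_boot all_order all_algebra.
From mathcomp Require Import all_classical all_reals all_analysis.

Set Implicit Arguments.
Unset Strict Implicit.
Unset Printing Implicit Defensive.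

Import Order.TTheory GRing.Theory Num.Theory.

Local Open Scope ring_scope.

(* The nonzero entries of v, listed in order, change sign at each step. *)
Definition alternating n (v : 'I_n -> int) : bool :=
  sorted (fun a b => a * b < 0) [seq a <- [seq v k | k <- enum 'I_n] | a != 0].

Definition is_asm n (M : 'M[int]_n) : bool :=
  [&& [forall i, forall j, M i j \in [:: 0; -1; 1]],
      [forall i, (\sum_j M i j == 1) && alternating (fun j => M i j)] &
      [forall j, (\sum_i M i j == 1) && alternating (fun i => M i j)]].

Record asm n := ASM { asm_mx :> 'M[int]_n; asmP : is_asm asm_mx }.

HB.instance Definition _ n := [isSub for @asm_mx n].
HB.instance Definition _ n := [Countable of asm n by <:].

(* Coding the entries by a finite type makes asm n a finType. *)
Definition asm_code n (M : asm n) : 'M[bool * bool]_n :=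
  map_mx (fun a : int => (a == 0, a == 1)) M.

Definition asm_decode n (C : 'M[bool * bool]_n) : option (asm n) :=
  insub (map_mx (fun c : bool * bool => if c.1 then 0 else if c.2 then 1 else -1 : int) C).

Lemma asm_codeK n : pcancel (@asm_code n) (@asm_decode n).
Proof.
move=> M; rewrite /asm_decode; set N := map_mx _ _.
suff -> : N = val M by rewrite valK.
apply/matrixP => i j; rewrite !mxE /=.
have /and3P[/forallP/(_ i)/forallP/(_ j) + _ _] := asmP M.
by rewrite !inE => /or3P[] /eqP ->.
Qed.

HB.instance Definition _ n := fintype.isFinite.Build (asm n) (pcan_enumP (@asm_codeK n)).

Definition Nplus n (M : 'M[int]_n) : nat := #|[pred ij : 'I_n * 'I_n | M ij.1 ij.2 == 1]|.

(* Rows and columns of M are numbered from 0, hence the strict inequalities. *)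
Definition height n (M : 'M[int]_n) : 'M[int]_n.+1 :=
  \matrix_(i, j) \sum_(p < n | (p < i)%N) \sum_(q < n | (q < j)%N) M p q.

Section Real.
Variable R : realType.

(* The exponent is an integer, in general negative. *)
Definition domino_weight n (M : asm n) : R :=
  2 ^ ((Nplus M)%:Z - 'C(n.+1, 2)%:Z).

Definition domino_prob n (E : pred (asm n)) : R := \sum_(M | E M) domino_weight M.

Definition Zshape (x y : R) : R :=
  let s := Num.sqrt (1/4 - (x - 1/2) ^+ 2 - (y - 1/2) ^+ 2) in
  2 / pi * ((x - 1/2) * atan (s / (1/2 - y))
            + 1/2 * atan (2 * (x - 1/2) * (1/2 - y) / s)
            - (1/2 - y) * atan ((x - 1/2) / s)).

(* f^*_y(x) for 0 < y < 1/2 *)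
Definition fstar_low (y x : R) : R :=
  let r := 2 * Num.sqrt (y * (1 - y)) in
  if x <= (1 - r) / 2 then 0
  else if x < (1 + r) / 2 then y / 2 + 1/2 * Zshape x y
  else y.

(* f^*_y(x), meant for x and y in [0, 1] *)
Definition fstar (y x : R) : R :=
  if y == 0 then 0
  else if y < 1/2 then fstar_low y x
  else if y == 1/2 then x / 2
  else if y < 1 then x - fstar_low (1 - y) x
  else x.

Definition F (x y : R) : R := fstar y x.

(* The maximum is over nonnegative numbers, so the default value 0 is harmless. *)
Definition height_deviation n (M : 'M[int]_n) : R :=
  \big[Num.max/0]_(i < n.+1) \big[Num.max/0]_(j < n.+1)
    `|(height M i j)%:~R / n%:R - F (i%:R / n%:R) (j%:R / n%:R)|.

End Real.

(* Main.v *)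
Require Import Defs.
From mathcomp Require Import all_boot all_order all_algebra.
From mathcomp Require Import all_classical all_reals all_analysis.
From mathcomp Require Import zify ring lra.

Set Implicit Arguments.
Unset Strict Implicit.
Unset Printing Implicit Defensive.

Import Order.TTheory GRing.Theory Num.Theory.
Import numFieldNormedType.Exports.

Local Open Scope classical_set_scope.
Local Open Scope ring_scope.

(** The proof follows a Markov chain on alternating sign matrices, and computes
    mean heights by an exactly solvable linear recurrence.

    Dynamics. Call A of order n and B of order n + 1 compatible when their
    corner-sum arrays interlace; such pairs are the domino tilings of the Aztec
    diamond. A has 2^(N_+(A)) compatible successors and B has 2^(N_-(B))
    compatible predecessors, so a uniform compatible pair has domino-distributed
    marginals ([Ex_pairs]). A uniform successor of A is obtained from
    independent coins, one per entry of A: at each interior point the new height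
    is one of two bounds given by the four heights of A around it, and the
    bounds differ exactly at the entries 1 ([step]). The predecessors of B have
    the same description, with the entries -1 ([back]).

    Concentration. For fixed coins the new heights are minima and maxima of old
    ones, so the step does not expand the sup norm, and other coins move the
    heights by at most 1. Hence every layer adds at most 1 to the variance of a
    Lipschitz observable ([variance_le]), and a height divided by n has variance
    at most 1/n. Chebyshev's inequality on a fixed grid is then enough
    ([height_concentration]), since heights are Lipschitz.

    Mean heights. The forward and the backward rule are nonlinear, but the sum of
    their conditional means is half the sum of the four surrounding heights
    ([plaquette_sum]). So the mean heights of three consecutive orders satisfy a
    discrete wave equation ([mean_height_wave]). Its solution is explicit, row by
    row: the generating polynomial of the mean entries of a row is a diagonal
    entry of a symmetric power of a 2 by 2 matrix ([row_polyE]). Its binomial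
    moments converge, after scaling, to the moments of the arcsine law on the
    chord that the height y of the row cuts out of the inscribed disc
    ([row_moment_close], [mean_moment_close]).

    From moments to heights. The increments of the mean height along a line are
    the masses of a measure with density at most 1. It is compared, through
    Bernstein polynomials ([cdf_compare]), with a discrete measure that has
    exactly the arcsine moments: points 1/2 + L cos(angle) with equally spaced
    angles ([arcsine_quadrature]), whose distribution function is known by
    counting angles ([node_fraction]). Thus the scaled mean height at (x, y) tends
    to the integral over y' in [0, y] of the arcsine distribution function at x of
    the chord at height y'. That integral is F, because F(x, .) vanishes at 0 and
    its derivative is that distribution function, also across the arctic circle
    ([F_shape], [shape_slope], [F_riemann]). *)

(** * Alternating sign matrices as corner-sum arrays *)

(** Corner sums with natural number indices. Beyond the order n they are
    constant in the index, which makes the recurrences below hold at all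
    indices, without boundary terms. *)
Definition hgt n (M : 'M[int]_n) (i j : nat) : int :=
  \sum_(p < n | (p < i)%N) \sum_(q < n | (q < j)%N) M p q.

Definition prefix_sum n (v : 'I_n -> int) (k : nat) : int :=
  \sum_(q < n | (q < k)%N) v q.

Lemma prefix_sum0 n (v : 'I_n -> int) : prefix_sum v 0 = 0.
Proof. by rewrite /prefix_sum big_pred0. Qed.

Lemma prefix_sum_ge n (v : 'I_n -> int) k : (n <= k)%N ->
  prefix_sum v k = \sum_q v q.
Proof.
move=> nk; rewrite /prefix_sum; apply: eq_bigl => q.
by rewrite (leq_trans (ltn_ord q) nk).
Qed.

Lemma prefix_sumS n (v : 'I_n -> int) (k : 'I_n) :
  prefix_sum v k.+1 = prefix_sum v k + v k.
Proof.
rewrite /prefix_sum (bigD1 k) /= ?ltnSn // addrC; congr (_ + _).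
apply: eq_bigl => q; rewrite ltnS.
by rewrite [RHS]ltn_neqAle andbC.
Qed.

Definition list_prefix (s : seq int) (k : nat) : int := \sum_(a <- take k s) a.

Lemma list_prefix_codom n (v : 'I_n -> int) k : (k <= n)%N ->
  list_prefix [seq v q | q <- enum 'I_n] k = prefix_sum v k.
Proof.
elim: k => [|k IHk] kn.
  by rewrite /list_prefix take0 big_nil prefix_sum0.
have -> : prefix_sum v k.+1 = prefix_sum v (Ordinal kn).+1 by [].
rewrite prefix_sumS -IHk ?(ltnW kn) // /list_prefix.
have sk : (k < size [seq v q | q <- enum 'I_n])%N.
  by rewrite size_map -cardE card_ord.
rewrite (take_nth 0) // -cats1 big_cat big_seq1 /=; congr (_ + _).
have sk' : (k < size (enum 'I_n))%N by rewrite -cardE card_ord.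
rewrite (nth_map (Ordinal kn)) //; congr v.
by apply: val_inj => /=; rewrite nth_enum_ord.
Qed.

Definition opposite_signs (a b : int) : bool := a * b < 0.

(** A state machine reads the entries: after a prefix of sum c (0 or 1), the
    last nonzero entry read, or a virtual -1 in front of the list, is 2c - 1.
    Thus alternation is the same as all prefix sums being 0 or 1. *)
Lemma alternating_of_prefix (s : seq int) (c : int) :
    all (fun a => a \in [:: 0; -1; 1]) s -> (c == 0) || (c == 1) ->
  (forall k, 0 <= c + list_prefix s k <= 1) ->
  path opposite_signs (2 * c - 1) [seq a <- s | a != 0].
Proof.
elim: s c => [//|a s IHs] c /= /andP[ha hs] hc H.
have H1 := H 1%N; rewrite /list_prefix /= take0 big_seq1 in H1.
have Hs k : 0 <= (c + a) + list_prefix s k <= 1.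
  by have := H k.+1; rewrite /list_prefix /= big_cons addrA.
move: ha; rewrite !inE => ha.
have hca : (c + a == 0) || (c + a == 1) by lia.
have := IHs _ hs hca Hs.
case: ifP => [an0|/negbFE/eqP a0]; last by rewrite a0 addr0.
have -> : 2 * (c + a) - 1 = a by lia.
move=> /= ->; rewrite andbT /opposite_signs.
by case/or3P: ha an0 hca => /eqP ->; case/orP: hc => /eqP ->.
Qed.

Lemma prefix_of_alternating (s : seq int) (c : int) :
    all (fun a => a \in [:: 0; -1; 1]) s -> (c == 0) || (c == 1) ->
  path opposite_signs (2 * c - 1) [seq a <- s | a != 0] ->
  forall k, 0 <= c + list_prefix s k <= 1.
Proof.
elim: s c => [|a s IHs] c /=.
  by move=> _ hc _ k; rewrite /list_prefix take_oversize // big_nil addr0; lia.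
move=> /andP[ha hs] hc.
have nil0 : 0 <= c + list_prefix (a :: s) 0 <= 1.
  by rewrite /list_prefix take0 big_nil; lia.
move: ha; rewrite !inE => ha.
case: ifP => [an0|/negbFE/eqP a0] /=; last first.
  move=> pth [//|k]; rewrite /list_prefix /= big_cons a0 add0r.
  exact: IHs.
move=> /andP[sg pth] [//|k]; rewrite /list_prefix /= big_cons addrA.
have hca : (c + a == 0) || (c + a == 1).
  case/orP: hc sg => /eqP ->; case/or3P: ha an0 => /eqP -> //.
apply: IHs => //.
suff -> : 2 * (c + a) - 1 = a by [].
case/orP: hc sg => /eqP ->; case/or3P: ha an0 => /eqP -> //.
Qed.

(** The total 1 forces the first nonzero entry to be 1: after a first entry -1
    all prefix sums, hence the total, would be at most 0. *)
Lemma prefix_of_sorted_alternating (s : seq int) :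
    all (fun a => a \in [:: 0; -1; 1]) s ->
    sorted opposite_signs [seq a <- s | a != 0] ->
    \sum_(a <- s) a = 1 ->
  forall k, 0 <= list_prefix s k <= 1.
Proof.
move=> hs srt s1 k.
have full c : c + \sum_(a <- s) a = c + list_prefix s (size s).
  by rewrite /list_prefix take_size.
suff pth : path opposite_signs (2 * 0 - 1) [seq a <- s | a != 0].
  by have := @prefix_of_alternating s 0 hs isT pth k; rewrite add0r.
case E : [seq a <- s | a != 0] srt => [//|a t] /= srt.
have /andP[an0 ain] : (a != 0) && (a \in s).
  by rewrite -(mem_filter (fun x => x != 0)) E mem_head.
have := allP hs _ ain; rewrite !inE (negbTE an0) /= => /orP[] /eqP aE; last first.
  by rewrite aE in srt *; rewrite /= srt.
have pth : path opposite_signs (2 * 1 - 1) [seq a <- s | a != 0].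
  by rewrite E aE /=; rewrite aE in srt.
have := @prefix_of_alternating s 1 hs isT pth (size s).
by rewrite -full s1.
Qed.

Lemma asm_entry n (M : asm n) i j : M i j \in [:: 0; -1; 1].
Proof. by have /and3P[/forallP/(_ i)/forallP/(_ j)] := asmP M. Qed.

Lemma asm_row_sum n (M : asm n) i : \sum_j M i j = 1.
Proof. by have /and3P[_ /forallP/(_ i)/andP[/eqP]] := asmP M. Qed.

Lemma is_asm_tr n (M : asm n) : is_asm (asm_mx M)^T.
Proof.
have /and3P[/forallP h1 /forallP h2 /forallP h3] := asmP M.
apply/and3P; split.
- by apply/forallP => i; apply/forallP => j; rewrite mxE; exact: asm_entry.
- apply/forallP => i; have /andP[/eqP s a] := h3 i.
  apply/andP; split; first by rewrite -s; apply/eqP/eq_bigr => j _; rewrite mxE.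
  suff -> : (fun j => (asm_mx M)^T i j) = (fun j => M j i) by [].
  by apply/funext => j; rewrite mxE.
- apply/forallP => i; have /andP[/eqP s a] := h2 i.
  apply/andP; split; first by rewrite -s; apply/eqP/eq_bigr => j _; rewrite mxE.
  suff -> : (fun j => (asm_mx M)^T j i) = (fun j => M i j) by [].
  by apply/funext => j; rewrite mxE.
Qed.

Definition asm_tr n (M : asm n) : asm n := ASM (is_asm_tr M).

Lemma asm_row_prefix n (M : asm n) i k : 0 <= prefix_sum (fun q => M i q) k <= 1.
Proof.
have [kn|/ltnW nk] := leqP k n; last first.
  by rewrite prefix_sum_ge // asm_row_sum.
have /and3P[_ /forallP/(_ i)/andP[_ srt] _] := asmP M.
rewrite -list_prefix_codom //; apply: prefix_of_sorted_alternating => //.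
  by apply/allP => _ /mapP[q _ ->]; exact: asm_entry.
by rewrite big_map big_enum /= asm_row_sum.
Qed.

Lemma hgt0l n (M : 'M[int]_n) j : hgt M 0 j = 0.
Proof. by rewrite /hgt big_pred0. Qed.

Lemma hgt_tr n (M : 'M[int]_n) i j : hgt M^T i j = hgt M j i.
Proof.
rewrite /hgt (exchange_big_dep (fun q : 'I_n => (q < j)%N)) //=.
apply: eq_bigr => q hq; apply: eq_big => [p|p _]; last by rewrite mxE.
by rewrite hq andbT.
Qed.

Lemma hgt0r n (M : 'M[int]_n) i : hgt M i 0 = 0.
Proof. by rewrite -hgt_tr hgt0l. Qed.

Lemma hgt_succl n (M : 'M[int]_n) (i : 'I_n) j :
  hgt M i.+1 j = hgt M i j + prefix_sum (fun q => M i q) j.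
Proof. exact: (prefix_sumS (fun p => \sum_(q < n | (q < j)%N) M p q) i). Qed.

Lemma hgt_clampl n (M : 'M[int]_n) i j : (n <= i)%N -> hgt M i j = hgt M n j.
Proof.
move=> ni; apply: eq_bigl => p.
by rewrite ltn_ord (leq_trans (ltn_ord p) ni).
Qed.

Lemma prefix_sum_tel n (f : nat -> int) k : (k <= n)%N ->
  prefix_sum (fun q : 'I_n => f q.+1 - f q) k = f k - f 0%N.
Proof.
elim: k => [|k IHk] kn; first by rewrite prefix_sum0 subrr.
rewrite (prefix_sumS _ (Ordinal kn)) /= IHk ?(ltnW kn) //; ring.
Qed.

Lemma hgt_fullr n (M : asm n) i j : (n <= j)%N -> hgt M i j = (minn i n)%:Z.
Proof.
move=> nj; wlog lin : i / (i <= n)%N => [H|].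
  have [lin|/ltnW ni] := leqP i n; first by rewrite H //; lia.
  by rewrite hgt_clampl // H //; lia.
rewrite (minn_idPl lin) -[RHS]subr0 -(prefix_sum_tel Posz lin).
apply: eq_bigr => p _; transitivity (prefix_sum (M p) j) => //.
by rewrite prefix_sum_ge // asm_row_sum; lia.
Qed.

Lemma hgt_fulll n (M : asm n) i j : (n <= i)%N -> hgt M i j = (minn j n)%:Z.
Proof. by move=> ni; rewrite -hgt_tr (hgt_fullr (asm_tr M)). Qed.

Lemma hgt_incl n (M : asm n) i j : hgt M i j <= hgt M i.+1 j <= hgt M i j + 1.
Proof.
have [ni|lin] := leqP n i.
  by rewrite !hgt_fulll ?(leq_trans ni) //; lia.
rewrite (hgt_succl M (Ordinal lin)) /=.
have := asm_row_prefix M (Ordinal lin) j; lia.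
Qed.

Lemma hgt_incr n (M : asm n) i j : hgt M i j <= hgt M i j.+1 <= hgt M i j + 1.
Proof. by rewrite -!(hgt_tr _ j) -(hgt_tr _ j.+1) (hgt_incl (asm_tr M)). Qed.

Lemma entry_hgt n (M : 'M[int]_n) (i j : 'I_n) :
  M i j = hgt M i.+1 j.+1 + hgt M i j - hgt M i.+1 j - hgt M i j.+1.
Proof.
by rewrite !hgt_succl prefix_sumS; ring.
Qed.

Lemma asm_hgt_inj n (M M' : asm n) :
  (forall i j, (i <= n)%N -> (j <= n)%N -> hgt M i j = hgt M' i j) -> M = M'.
Proof.
move=> H; apply: val_inj; apply/matrixP => i j /=.
by rewrite !entry_hgt !H // ltnW.
Qed.

(** Height matrices characterised by boundary values and increments alone. *)
Definition corner_sum_array n (h : nat -> nat -> int) :=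
  let rows h := [/\ forall j, (j <= n)%N -> h 0%N j = 0,
      forall j, (j <= n)%N -> h n j = j%:Z &
      forall i j, (i < n)%N -> (j <= n)%N -> h i j <= h i.+1 j <= h i j + 1]
  in rows h /\ rows (fun i j => h j i).

Definition diff_mx n (h : nat -> nat -> int) : 'M[int]_n :=
  \matrix_(i, j) (h i.+1 j.+1 + h i j - h i.+1 j - h i j.+1).

Lemma diff_mx_row n h (i : 'I_n) j : corner_sum_array n h -> (j <= n)%N ->
  prefix_sum (fun q => diff_mx n h i q) j = h i.+1 j - h i j.
Proof.
case=> [_ [h0 _ _]] jn.
have -> : (fun q => diff_mx n h i q) =
  (fun q : 'I_n => (h i.+1 q.+1 - h i q.+1) - (h i.+1 q - h i q)).
  by apply/funext => q; rewrite mxE; ring.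
rewrite (prefix_sum_tel (fun q => h i.+1 q - h i q)) //.
by rewrite !h0 // ?subr0 // ltnW.
Qed.

Lemma hgt_diff_mx n h i j : corner_sum_array n h -> (i <= n)%N -> (j <= n)%N ->
  hgt (diff_mx n h) i j = h i j.
Proof.
move=> hh; have [[h0 _ _] _] := hh; elim: i => [|i IHi] lin ljn.
  by rewrite hgt0l h0.
by rewrite (hgt_succl _ (Ordinal lin)) diff_mx_row //= IHi ?(ltnW lin) //; ring.
Qed.

Lemma diff_mx_row_asm n h (i : 'I_n) : corner_sum_array n h ->
  (\sum_(j < n) diff_mx n h i j == 1) && Defs.alternating (fun j => diff_mx n h i j).
Proof.
move=> hh; have [[_ _ hi] [_ hn hj]] := hh.
have in_ := ltnW (ltn_ord i).
apply/andP; split.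
  by rewrite -(prefix_sum_ge _ (leqnn n)) diff_mx_row // !hn //; lia.
rewrite /Defs.alternating; apply: (@path_sorted _ _ (2 * 0 - 1)).
apply: alternating_of_prefix => //.
  apply/allP => _ /mapP[q _ ->]; rewrite mxE !inE.
  have := hi i q.+1 (ltn_ord i) (ltn_ord q).
  have := hi i q (ltn_ord i) (ltnW (ltn_ord q)).
  have := hj q i (ltn_ord q) in_.
  have := hj q i.+1 (ltn_ord q) (ltn_ord i); lia.
move=> k; rewrite add0r.
have [kn|nk] := leqP k n.
  rewrite list_prefix_codom // diff_mx_row //.
  have := hi i k (ltn_ord i) kn; lia.
rewrite /list_prefix take_oversize; last by rewrite size_map -cardE card_ord ltnW.
by rewrite big_map big_enum /= -(prefix_sum_ge _ (leqnn n)) diff_mx_row // !hn //; lia.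
Qed.

Lemma corner_sum_array_tr n h :
  corner_sum_array n h -> corner_sum_array n (fun i j => h j i).
Proof. by case. Qed.

Lemma diff_mx_asm n h : corner_sum_array n h -> is_asm (diff_mx n h).
Proof.
move=> hh; have [[_ _ hi] [_ hn hj]] := hh; apply/and3P; split.
- apply/forallP => i; apply/forallP => q; rewrite mxE !inE.
  have := hi i q.+1 (ltn_ord i) (ltn_ord q).
  have := hi i q (ltn_ord i) (ltnW (ltn_ord q)).
  have := hj q i (ltn_ord q) (ltnW (ltn_ord i)).
  have := hj q i.+1 (ltn_ord q) (ltn_ord i); lia.
- by apply/forallP => i; exact: diff_mx_row_asm.
- apply/forallP => j; have := diff_mx_row_asm j (corner_sum_array_tr hh).
  have E i : diff_mx n (fun i j => h j i) j i = diff_mx n h i j by rewrite !mxE; ring.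
  have -> : (fun i => diff_mx n (fun i j => h j i) j i) = (fun i => diff_mx n h i j).
    exact/funext.
  by under eq_bigr => i _ do rewrite E.
Qed.

Lemma asm_of_corner_sums n h : corner_sum_array n h ->
  exists M : asm n, forall i j, (i <= n)%N -> (j <= n)%N -> hgt M i j = h i j.
Proof.
by move=> hh; exists (ASM (diff_mx_asm hh)) => i j; exact: hgt_diff_mx.
Qed.

(** * Forward and backward moves between consecutive orders *)

(** The bounds that the four heights h i j, h i j.+1, h i.+1 j, h i.+1 j.+1 of
    an array put on the height between them: [lo_up] and [hi_up] for an array of
    the next order, [lo_dn] and [hi_dn] for one of the previous order. *)
Definition lo_up (h : nat -> nat -> int) i j := Num.max (h i.+1 j) (h i j.+1).
Definition hi_up (h : nat -> nat -> int) i j := Num.min (h i j + 1) (h i.+1 j.+1).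
Definition lo_dn (h : nat -> nat -> int) i j := Num.max (h i j) (h i.+1 j.+1 - 1).
Definition hi_dn (h : nat -> nat -> int) i j := Num.min (h i.+1 j) (h i j.+1).

Definition coins n := {ffun 'I_n * 'I_n -> bool}.

Definition coin n (x : coins n) (i j : nat) : bool :=
  [exists t : 'I_n * 'I_n, [&& t.1 == i :> nat, t.2 == j :> nat & x t]].

Lemma coinE n (x : coins n) (i j : 'I_n) : coin x i j = x (i, j).
Proof.
apply/existsP/idP => [[[a b] /= /and3P[/eqP ai /eqP bj]]|xij].
  by rewrite (val_inj ai) (val_inj bj).
by exists (i, j); rewrite /= !eqxx.
Qed.

(** The coin of an entry chooses between the two bounds of the height in the
    middle of its four corners; the boundary values are forced. *)
Definition step_array n (h : nat -> nat -> int) (x : coins n) (i j : nat) : int :=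
  match i, j with
  | i'.+1, j'.+1 =>
    if (n <= i')%N then (minn j n.+1)%:Z
    else if (n <= j')%N then (minn i n.+1)%:Z
    else if coin x i' j' then hi_up h i' j' else lo_up h i' j'
  | _, _ => 0
  end.

(** Going down one order the boundary values need no separate clause: there the
    two bounds agree. *)
Definition back_array n (h : nat -> nat -> int) (x : coins n.+1) (i j : nat) : int :=
  if coin x i j then hi_dn h i j else lo_dn h i j.

Section Plaquette.
Variables (n : nat) (M : asm n).

Lemma plaquette i j :
  [/\ hgt M i j <= hgt M i.+1 j <= hgt M i j + 1,
      hgt M i j <= hgt M i j.+1 <= hgt M i j + 1,
      hgt M i.+1 j <= hgt M i.+1 j.+1 <= hgt M i.+1 j + 1 &
      hgt M i j.+1 <= hgt M i.+1 j.+1 <= hgt M i j.+1 + 1].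
Proof. by split; rewrite ?hgt_incl ?hgt_incr. Qed.

Lemma gap_up i j : lo_up (hgt M) i j <= hi_up (hgt M) i j <= lo_up (hgt M) i j + 1.
Proof. by case: (plaquette i j); rewrite /hi_up /lo_up; lia. Qed.

Lemma gap_upE (i j : 'I_n) :
  hi_up (hgt M) i j - lo_up (hgt M) i j = (M i j == 1)%:R.
Proof.
by case: (plaquette i j); rewrite entry_hgt /hi_up /lo_up; lia.
Qed.

Lemma gap_dnE (i j : 'I_n) :
  hi_dn (hgt M) i j - lo_dn (hgt M) i j = (M i j == -1)%:R.
Proof.
by case: (plaquette i j); rewrite entry_hgt /hi_dn /lo_dn; lia.
Qed.

(** The two extremes of the forward move and the two extremes of the backward
    move at a plaquette together have the same sum as its four corners: this
    makes the expected heights solve a linear equation, although each of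
    the moves is nonlinear. *)
Lemma plaquette_sum i j :
  lo_up (hgt M) i j + hi_up (hgt M) i j + (lo_dn (hgt M) i j + hi_dn (hgt M) i j)
  = hgt M i j + hgt M i j.+1 + hgt M i.+1 j + hgt M i.+1 j.+1.
Proof.
by case: (plaquette i j); rewrite /hi_dn /lo_dn /hi_up /lo_up; lia.
Qed.

Lemma step_array_rows (x : coins n) :
  [/\ forall j, (j <= n.+1)%N -> step_array (hgt M) x 0 j = 0,
      forall j, (j <= n.+1)%N -> step_array (hgt M) x n.+1 j = j%:Z &
      forall i j, (i < n.+1)%N -> (j <= n.+1)%N ->
        step_array (hgt M) x i j <= step_array (hgt M) x i.+1 j
          <= step_array (hgt M) x i j + 1].
Proof.
split=> [//|[|j] jn|i [|j] lin ljn].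
- by [].
- by rewrite /= leqnn (minn_idPl jn).
- by case: i lin => //.
- case: i lin => [|i] lin /=.
  + case: leqP => n0; first lia.
    case: leqP => nj; first lia.
    have := gap_up 0 j; have := hgt_incl M 0 j; rewrite /lo_up /hi_up !hgt0l.
    case: ifP; lia.
  + have ni : (n <= i)%N = false by lia.
    rewrite ni; case: (leqP n i.+1) => ni1; case: (leqP n j) => nj; try lia.
    * have := gap_up i j; rewrite /lo_up /hi_up.
      rewrite !(hgt_fulll M (i := i.+1)) //.
      have := hgt_incl M i j; rewrite !(hgt_fulll M (i := i.+1)) //.
      case: ifP; lia.
    * have [] := plaquette i j; have [] := plaquette i.+1 j.
      rewrite /lo_up /hi_up; case: ifP => _; case: ifP => _; lia.
Qed.

Lemma back_array_rows (x : coins n.-1.+1) : (0 < n)%N ->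
  let h := back_array (hgt M) x in
  [/\ forall j, (j <= n.-1)%N -> h 0%N j = 0,
      forall j, (j <= n.-1)%N -> h n.-1 j = j%:Z &
      forall i j, (i < n.-1)%N -> (j <= n.-1)%N -> h i j <= h i.+1 j <= h i j + 1].
Proof.
move=> n0 h; rewrite /h /back_array; split=> [j jn|j jn|i j lin ljn].
- have [] := plaquette 0 j; rewrite /lo_dn /hi_dn !hgt0l.
  case: ifP; lia.
- have [] := plaquette n.-1 j; rewrite /lo_dn /hi_dn.
  rewrite !(hgt_fulll M (i := n.-1.+1)); try lia.
  case: ifP; lia.
- have [] := plaquette i j; have [] := plaquette i.+1 j; rewrite /lo_dn /hi_dn.
  case: ifP => _; case: ifP => _; lia.
Qed.

End Plaquette.

Definition coins_tr n (x : coins n) : coins n := [ffun t => x (t.2, t.1)].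

Lemma coin_tr n (x : coins n) i j : coin (coins_tr x) i j = coin x j i.
Proof.
by apply/existsP/existsP => -[[a b] /= /and3P[ai bj xab]]; exists (b, a);
  rewrite ai bj /= ?ffunE // -?[x _]/(x ((a, b).1, (a, b).2)) in xab *;
  rewrite ?ffunE in xab *.
Qed.

Lemma step_array_tr n (M : asm n) (x : coins n) i j :
  step_array (hgt (asm_tr M)) (coins_tr x) i j = step_array (hgt M) x j i.
Proof.
case: i j => [|i] [|j] //=; rewrite coin_tr /hi_up /lo_up !hgt_tr maxC.
by case: (leqP n i) => ni; case: (leqP n j) => nj //; lia.
Qed.

Lemma back_array_tr n (M : asm n.+1) (x : coins n.+1) i j :
  back_array (hgt (asm_tr M)) (coins_tr x) i j = back_array (hgt M) x j i.
Proof. by rewrite /back_array coin_tr /hi_dn /lo_dn !hgt_tr minC. Qed.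

Lemma step_array_valid n (M : asm n) (x : coins n) :
  corner_sum_array n.+1 (step_array (hgt M) x).
Proof.
split; first by case: (step_array_rows M x).
have [h1 h2 h3] := step_array_rows (asm_tr M) (coins_tr x).
split=> [j jn|j jn|i j lin ljn].
- by have := h1 j jn; rewrite step_array_tr.
- by have := h2 j jn; rewrite step_array_tr.
- by have := h3 i j lin ljn; rewrite !step_array_tr.
Qed.

Lemma back_array_valid n (M : asm n.+1) (x : coins n.+1) :
  corner_sum_array n (back_array (hgt M) x).
Proof.
split; first by case: (@back_array_rows n.+1 M x isT).
have [h1 h2 h3] := @back_array_rows n.+1 (asm_tr M) (coins_tr x) isT.
split=> [j jn|j jn|i j lin ljn].
- by have := h1 j jn; rewrite back_array_tr.
- by have := h2 j jn; rewrite back_array_tr.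
- by have := h3 i j lin ljn; rewrite !back_array_tr.
Qed.

Definition step n (M : asm n) (x : coins n) : asm n.+1 :=
  projT1 (cid (asm_of_corner_sums (step_array_valid M x))).

Definition back n (M : asm n.+1) (x : coins n.+1) : asm n :=
  projT1 (cid (asm_of_corner_sums (back_array_valid M x))).

Lemma hgt_step n (M : asm n) (x : coins n) i j :
  hgt (step M x) i j = step_array (hgt M) x i j.
Proof.
have H := projT2 (cid (asm_of_corner_sums (step_array_valid M x))).
have [jn|nj] := leqP j n.+1; last first.
  rewrite hgt_fullr 1?ltnW //; case: i => [|i] //=.
  case: j nj => // j nj /=; have -> : (n <= j)%N by lia.
  by case: leqP => //; lia.
have [lin|ni] := leqP i n.+1; first exact: H.
rewrite hgt_fulll 1?ltnW //; case: i ni => [//|i] ni.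
case: j jn => //= j nj; have -> // : (n <= i)%N by lia.
Qed.

Lemma hgt_back n (M : asm n.+1) (x : coins n.+1) i j :
  (i <= n)%N -> (j <= n)%N -> hgt (back M x) i j = back_array (hgt M) x i j.
Proof. exact: (projT2 (cid (asm_of_corner_sums (back_array_valid M x)))). Qed.

(** Interlacing height arrays; such pairs correspond to the domino tilings of
    the Aztec diamond of order n + 1. *)
Definition compat n (A : asm n) (B : asm n.+1) : bool :=
  [forall i : 'I_n.+1, forall j : 'I_n.+1,
    [&& hgt A i j <= hgt B i.+1 j, hgt A i j <= hgt B i j.+1,
        hgt B i j <= hgt A i j & hgt B i.+1 j.+1 <= hgt A i j + 1]].

Lemma compatP n (A : asm n) (B : asm n.+1) :
  reflect (forall i j, (i <= n)%N -> (j <= n)%N ->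
    [&& hgt A i j <= hgt B i.+1 j, hgt A i j <= hgt B i j.+1,
        hgt B i j <= hgt A i j & hgt B i.+1 j.+1 <= hgt A i j + 1])
  (compat A B).
Proof.
apply: (iffP forallP) => [H i j lin ljn|H i].
  by have /forallP/(_ (Ordinal (ljn : j < n.+1)%N)) := H (Ordinal (lin : i < n.+1)%N).
by apply/forallP => j; apply: H; rewrite -ltnS.
Qed.

(** The interlacing inequalities, grouped around the points of A or, in
    [compat_upE], around the interior points of B: the successors of A and the
    predecessors of B are exactly the outcomes of the coins. *)
Lemma compat_dnE n (A : asm n) (B : asm n.+1) :
  compat A B =
  [forall t : 'I_n.+1 * 'I_n.+1,
    lo_dn (hgt B) t.1 t.2 <= hgt A t.1 t.2 <= hi_dn (hgt B) t.1 t.2].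
Proof.
apply/compatP/forallP => [H [i j] /=|H i j lin ljn].
  have := H i j (ltn_ord i) (ltn_ord j); rewrite /lo_dn /hi_dn; lia.
have /= := H (Ordinal (lin : i < n.+1)%N, Ordinal (ljn : j < n.+1)%N).
rewrite /lo_dn /hi_dn; lia.
Qed.

Lemma compat_upE n (A : asm n) (B : asm n.+1) :
  compat A B =
  [forall t : 'I_n * 'I_n,
    lo_up (hgt A) t.1 t.2 <= hgt B t.1.+1 t.2.+1 <= hi_up (hgt A) t.1 t.2].
Proof.
apply/compatP/forallP => [H [i j] /=|H i j lin ljn].
  have i0 := ltn_ord i; have j0 := ltn_ord j.
  have := H i j (ltnW i0) (ltnW j0); have := H i.+1 j.+1 i0 j0.
  have := H i.+1 j i0 (ltnW j0); have := H i j.+1 (ltnW i0) j0.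
  rewrite /lo_up /hi_up; lia.
have {}H a b (an : (a < n)%N) (bn : (b < n)%N) :
    lo_up (hgt A) a b <= hgt B a.+1 b.+1 <= hi_up (hgt A) a b.
  exact: (H (Ordinal an, Ordinal bn)).
have full (k : nat) : (k <= n)%N -> [/\ hgt A k n = k%:Z, hgt A n k = k%:Z,
    hgt B k n.+1 = k%:Z & hgt B n.+1 k = k%:Z].
  move=> kn; split; [rewrite hgt_fullr|rewrite hgt_fulll|rewrite hgt_fullr|rewrite hgt_fulll]; lia.
apply/and4P; split.
- case: j ljn => [|j] ljn; first by rewrite !hgt0r.
  have [ni|ni] := ltnP i n; first by have := H i j ni ljn; rewrite /lo_up; lia.
  have -> : i = n by lia.
  by have [_ -> _ ->] := full _ ljn.
- case: i lin => [|i] lin; first by rewrite !hgt0l.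
  have [nj|nj] := ltnP j n; first by have := H i j lin nj; rewrite /lo_up; lia.
  have -> : j = n by lia.
  by have [-> _ -> _] := full _ lin.
- case: i lin => [|i] lin; first by rewrite !hgt0l.
  case: j ljn => [|j] ljn; first by rewrite !hgt0r.
  by have := H i j lin ljn; rewrite /hi_up; lia.
- have [ni|ni] := ltnP i n; last first.
    have -> : i = n by lia.
    by have [_ -> _ _] := full _ ljn; rewrite hgt_fulll //; lia.
  have [nj|nj] := ltnP j n; last first.
    have -> : j = n by lia.
    by have [-> _ _ _] := full _ lin; rewrite hgt_fullr //; lia.
  by have := H i j ni nj; rewrite /hi_up; lia.
Qed.

Lemma step_eq n (A : asm n) (x : coins n) (B : asm n.+1) :
  (step A x == B) = [forall t : 'I_n * 'I_n,
     (if x t then hi_up (hgt A) t.1 t.2 else lo_up (hgt A) t.1 t.2)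
       == hgt B t.1.+1 t.2.+1].
Proof.
apply/eqP/forallP => [<- [i j]|H].
  by rewrite hgt_step /= [(n <= i)%N]leqNgt [(n <= j)%N]leqNgt !ltn_ord /= coinE.
apply: asm_hgt_inj => -[|i] [|j] lin ljn; rewrite ?hgt0l ?hgt0r //.
rewrite hgt_step /=; case: leqP => ni; first by rewrite hgt_fulll //; lia.
case: leqP => nj; first by rewrite hgt_fullr //; lia.
by have /= /eqP <- := H (Ordinal ni, Ordinal nj); rewrite -coinE.
Qed.

Lemma back_eq n (B : asm n.+1) (x : coins n.+1) (A : asm n) :
  (back B x == A) = [forall t : 'I_n.+1 * 'I_n.+1,
     (if x t then hi_dn (hgt B) t.1 t.2 else lo_dn (hgt B) t.1 t.2)
       == hgt A t.1 t.2].
Proof.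
apply/eqP/forallP => [<- [i j]|H].
  by rewrite (hgt_back B x (ltn_ord i) (ltn_ord j)) /back_array coinE.
apply: asm_hgt_inj => i j lin ljn; rewrite hgt_back // /back_array.
have /= /eqP <- := H (Ordinal (lin : i < n.+1)%N, Ordinal (ljn : j < n.+1)%N).
by rewrite -coinE.
Qed.

(** A coin matters only where the two options differ; elsewhere it is free. *)
Lemma card_choices (T : finType) (lo hi b : T -> int) (D : pred T) :
    (forall t, hi t - lo t = (D t)%:R) ->
  #|[pred x : {ffun T -> bool} | [forall t, (if x t then hi t else lo t) == b t]]|
  = (if [forall t, (lo t <= b t <= hi t)%R]
     then 2 ^ (#|T| - #|[pred t | D t]|) else 0)%N.
Proof.
move=> hD.
pose Fm t := [pred c : bool | (if c then hi t else lo t) == b t].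
have -> : #|[pred x : {ffun T -> bool} |
    [forall t, (if x t then hi t else lo t) == b t]]| = (\prod_t #|Fm t|)%N.
  rewrite -[RHS]big_enum /= -(big_map (fun t => #|Fm t|) xpredT id) /= -foldrE.
  by rewrite -card_family; apply: eq_card => x; rewrite !inE.
have cF t : #|Fm t| = ((lo t == b t) + (hi t == b t))%N.
  rewrite -sum1_card big_mkcond /= (bigD1 true) //= (bigD1 false) //= big_pred0.
    by rewrite !inE; case: eqP; case: eqP.
  by case.
case: ifPn => [/forallP H|/forallPn[t Ht]]; last first.
  rewrite (bigD1 t) //= cF; suff -> : ((lo t == b t) + (hi t == b t) = 0)%N by [].
  by move: Ht (hD t); case: (D t) => /=; lia.
have -> : (#|T| - #|[pred t | D t]|)%N = #|[pred t | ~~ D t]|.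
  have := cardC [pred t | D t]; rewrite -[RHS]/(#|T|) => <-.
  by rewrite addKn; apply: eq_card => t; rewrite !inE.
rewrite -sum1_card expn_sum [RHS]big_mkcond /=; apply: eq_bigr => t _.
rewrite cF; have := hD t; have := H t; rewrite inE.
case: (D t) => /=; case: eqP; case: eqP => //; lia.
Qed.

(** * Stationarity, the wave equation for mean heights, and the variance bound *)

Definition Nminus n (M : 'M[int]_n) : nat :=
  #|[pred ij : 'I_n * 'I_n | M ij.1 ij.2 == -1]|.

Lemma card_pred_int (T : finType) (P : pred T) :
  #|[pred t | P t]|%:Z = \sum_t (P t)%:R.
Proof.
rewrite -sum1_card big_mkcond /= -natz natr_sum; apply: eq_bigr => t _.
by rewrite inE; case: (P t).
Qed.

Lemma Nplus_Nminus n (M : asm n) : Nplus M = (Nminus M + n)%N.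
Proof.
have : \sum_(t : 'I_n * 'I_n) M t.1 t.2 = n%:Z.
  rewrite -(pair_big xpredT xpredT (fun i j => M i j)) /=.
  under eq_bigr => i _ do rewrite asm_row_sum.
  by rewrite sumr_const card_ord natz.
have -> : \sum_(t : 'I_n * 'I_n) M t.1 t.2 = (Nplus M)%:Z - (Nminus M)%:Z.
  rewrite /Nplus /Nminus !card_pred_int -sumrB; apply: eq_bigr => t _ /=.
  by have := asm_entry M t.1 t.2; rewrite !inE => /or3P[] /eqP ->.
lia.
Qed.

Lemma Nplus_le n (M : asm n) : (Nplus M <= n * n)%N.
Proof. by rewrite (leq_trans (max_card _)) // card_prod card_ord. Qed.

Lemma Nminus_le n (M : asm n) : (Nminus M <= n * n)%N.
Proof. by rewrite (leq_trans (max_card _)) // card_prod card_ord. Qed.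

Section Expectation.
Variable R : realType.

Definition Ex n (f : asm n -> R) : R := \sum_M domino_weight R M * f M.

Definition coin_mean n (f : coins n -> R) : R := (\sum_x f x) / 2 ^+ (n * n).

Lemma card_coins n : #|{: coins n}| = (2 ^ (n * n))%N.
Proof. by rewrite card_ffun card_bool card_prod card_ord. Qed.

Lemma pow2_gt0 n : 0 < 2 ^+ n :> R.
Proof. by rewrite exprn_gt0. Qed.

Lemma pow2_neq0 n : 2 ^+ n != 0 :> R.
Proof. by rewrite gt_eqF ?pow2_gt0. Qed.

(** Averaging over the coins is averaging over the outcomes, because each outcome
    in K comes from the same number of coin configurations. *)
Lemma coin_mean_fibers n (T : finType) (F : coins n -> T) (K : pred T) (d : nat)
    (g : T -> R) : (d <= n * n)%N ->
    (forall B, #|[pred x | F x == B]| = if K B then (2 ^ (n * n - d))%N else 0%N) ->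
  coin_mean (fun x => g (F x)) = (\sum_(B | K B) g B) / 2 ^+ d.
Proof.
move=> dn hF; rewrite /coin_mean (partition_big F xpredT) //= !mulr_suml.
rewrite [RHS]big_mkcond /=; apply: eq_bigr => B _.
under eq_bigr => x /eqP -> do over.
rewrite sumr_const -[#|_|]/#|[pred x | F x == B]| hF.
case: ifP => _; last by rewrite mulr0n mul0r.
rewrite -[g B *+ _]mulr_natr -mulrA; congr (_ * _).
rewrite natrX exprB ?unitfE ?pnatr_eq0 // mulrAC mulfV ?pow2_neq0 //.
by rewrite mul1r.
Qed.

Lemma step_mean n (A : asm n) (g : asm n.+1 -> R) :
  coin_mean (fun x => g (step A x)) = (\sum_(B | compat A B) g B) / 2 ^+ Nplus A.
Proof.
apply: coin_mean_fibers => [|B]; first exact: Nplus_le.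
rewrite (eq_card (fun x => step_eq A x B)).
rewrite (@card_choices _ _ _ _ (fun t => A t.1 t.2 == 1)); last first.
  by case=> i j; exact: gap_upE.
by rewrite -compat_upE card_prod card_ord.
Qed.

Lemma back_mean n (B : asm n.+1) (f : asm n -> R) :
  coin_mean (fun x => f (back B x)) = (\sum_(A | compat A B) f A) / 2 ^+ Nminus B.
Proof.
apply: coin_mean_fibers => [|A]; first exact: Nminus_le.
rewrite (eq_card (fun x => back_eq B x A)).
rewrite (@card_choices _ _ _ _ (fun t => B t.1 t.2 == -1)); last first.
  by case=> i j; exact: gap_dnE.
by rewrite -compat_dnE card_prod card_ord.
Qed.

Lemma coin_mean_cst n (c : R) : coin_mean (fun _ : coins n => c) = c.
Proof.
rewrite /coin_mean sumr_const card_coins -[c *+ _]mulr_natr natrX mulfK //.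
Qed.

Lemma card_compat_up n (A : asm n) : \sum_(B | compat A B) 1 = 2 ^+ Nplus A :> R.
Proof.
have := step_mean A (fun=> 1); rewrite coin_mean_cst => E.
by rewrite -[LHS](divfK (pow2_neq0 (Nplus A))) -E mul1r.
Qed.

Lemma card_compat_dn n (B : asm n.+1) : \sum_(A | compat A B) 1 = 2 ^+ Nminus B :> R.
Proof.
have := back_mean B (fun=> 1); rewrite coin_mean_cst => E.
by rewrite -[LHS](divfK (pow2_neq0 (Nminus B))) -E mul1r.
Qed.

Lemma domino_weightE n (M : asm n) :
  domino_weight R M = 2 ^+ Nplus M / 2 ^+ 'C(n.+1, 2).
Proof. by rewrite /domino_weight expfzDr ?pnatr_eq0 // -exprnP exprnN. Qed.

Lemma domino_weightSE n (M : asm n.+1) :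
  domino_weight R M = 2 ^+ Nminus M / 2 ^+ 'C(n.+1, 2).
Proof.
rewrite domino_weightE Nplus_Nminus binS bin1 !exprD invfM mulrACA.
by rewrite mulfV ?pow2_neq0 // mulr1.
Qed.

(** Both marginals of the uniform measure on compatible pairs are domino
    measures, because A has 2^(N_+(A)) successors and B has 2^(N_-(B))
    predecessors. *)
Lemma Ex_pairs n (g : asm n.+1 -> R) :
  Ex g = (\sum_(A : asm n) \sum_(B | compat A B) g B) / 2 ^+ 'C(n.+1, 2).
Proof.
rewrite (exchange_big_dep xpredT) //= mulr_suml; apply: eq_bigr => B _.
rewrite domino_weightSE -card_compat_dn mulrAC; congr (_ / _).
by rewrite mulr_suml; apply: eq_bigr => A _; rewrite mul1r.
Qed.

Lemma Ex_step n (g : asm n.+1 -> R) :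
  Ex g = Ex (fun A => coin_mean (fun x => g (step A x))).
Proof.
rewrite Ex_pairs mulr_suml; apply: eq_bigr => A _.
rewrite step_mean domino_weightE; field.
by rewrite !pow2_neq0.
Qed.

Lemma Ex_back n (f : asm n -> R) :
  Ex f = Ex (fun B => coin_mean (fun x => f (back B x))).
Proof.
transitivity ((\sum_(A : asm n) \sum_(B | compat A B) f A) / 2 ^+ 'C(n.+1, 2)).
  rewrite mulr_suml; apply: eq_bigr => A _.
  rewrite domino_weightE -card_compat_up mulrAC !mulr_suml.
  by apply: eq_bigr => B _; rewrite mul1r.
rewrite (exchange_big_dep xpredT) //= mulr_suml; apply: eq_bigr => B _.
rewrite back_mean domino_weightSE; field.
by rewrite !pow2_neq0.
Qed.

Lemma Ex_lin n (f g : asm n -> R) a b :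
  Ex (fun M => a * f M + b * g M) = a * Ex f + b * Ex g.
Proof.
rewrite /Ex !mulr_sumr -big_split /=; apply: eq_bigr => M _; ring.
Qed.

Lemma ExD n (f g : asm n -> R) : Ex (fun M => f M + g M) = Ex f + Ex g.
Proof.
rewrite -[Ex f]mul1r -[Ex g]mul1r -Ex_lin.
by congr Ex; apply/funext => M; rewrite !mul1r.
Qed.

Lemma ExZr n (f : asm n -> R) a : Ex (fun M => f M * a) = Ex f * a.
Proof. by rewrite /Ex mulr_suml; apply: eq_bigr => M _; rewrite mulrA. Qed.

Lemma domino_weight_ge0 n (M : asm n) : 0 <= domino_weight R M.
Proof. by rewrite /domino_weight exprz_ge0. Qed.

Lemma le_Ex n (f g : asm n -> R) : (forall M, f M <= g M) -> Ex f <= Ex g.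
Proof.
by move=> fg; apply: ler_sum => M _; rewrite ler_wpM2l ?domino_weight_ge0.
Qed.

Lemma le_coin_mean n (f g : coins n -> R) :
  (forall x, f x <= g x) -> coin_mean f <= coin_mean g.
Proof. by move=> fg; rewrite ler_pM2r ?invr_gt0 ?pow2_gt0 // ler_sum. Qed.

Lemma coin_mean_lin n (f g : coins n -> R) a b :
  coin_mean (fun x => a * f x + b * g x) = a * coin_mean f + b * coin_mean g.
Proof. by rewrite /coin_mean big_split /= -!mulr_sumr; ring. Qed.

Lemma asm0_uniq (M M' : asm 0) : M = M'.
Proof. by apply: asm_hgt_inj => -[|i] j //; rewrite !hgt0l. Qed.

Lemma asm0_exists : exists M : asm 0, True.
Proof.
have hh : corner_sum_array 0 (fun _ _ => 0) by split; split => // -[|j].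
by have [M _] := asm_of_corner_sums hh; exists M.
Qed.

Lemma Ex0 (f : asm 0 -> R) (M : asm 0) : Ex f = f M.
Proof.
rewrite /Ex (bigD1 M) //= big_pred0 ?addr0; last first.
  by move=> M'; rewrite (asm0_uniq M' M) eqxx.
have -> : domino_weight R M = 1.
  rewrite domino_weightE bin_small // expr0 divr1.
  suff -> : Nplus M = 0%N by rewrite expr0.
  by apply/eqP; rewrite -leqn0 (leq_trans (Nplus_le M)).
by rewrite mul1r.
Qed.

Lemma Ex_cst n (c : R) : Ex (fun _ : asm n => c) = c.
Proof.
elim: n => [|n IHn]; first by have [M _] := asm0_exists; rewrite (Ex0 _ M).
rewrite Ex_step -[RHS]IHn; congr Ex.
by apply/funext => A; exact: coin_mean_cst.
Qed.

Definition mean_height n i j : R := Ex (fun M : asm n => (hgt M i j)%:~R).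

Lemma coin_mean_select n (i j : 'I_n) (a b : R) :
  coin_mean (fun x : coins n => if coin x i j then a else b) = (a + b) / 2.
Proof.
(* Flipping the coin (i, j) is an involution that exchanges a and b. *)
pose flip (x : coins n) : coins n :=
  [ffun t => if t == (i, j) then ~~ x t else x t].
have flipK : involutive flip.
  by move=> x; apply/ffunP => t; rewrite !ffunE; case: eqP => // ->; rewrite negbK.
set S := coin_mean _.
have S2 : S = coin_mean (fun x : coins n => if coin x i j then b else a).
  rewrite /S /coin_mean (reindex_inj (inv_inj flipK)) /=; congr (_ / _).
  by apply: eq_bigr => x _; rewrite !coinE ffunE eqxx; case: (x _).
have : S + S = a + b.
  rewrite {2}S2 /S -[LHS]/(coin_mean _ + coin_mean _).
  rewrite -[X in X + _]mul1r -[X in _ + X]mul1r -coin_mean_lin.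
  rewrite -[RHS](@coin_mean_cst n); congr coin_mean.
  by apply/funext => x; rewrite !mul1r; case: ifP => _ //; rewrite addrC.
lra.
Qed.

Lemma half_int (u v : int) : u * 2 = v -> u%:~R = v%:~R / 2 :> R.
Proof. by move=> <-; rewrite intrM mulfK. Qed.

(** A discrete wave equation with propagation in a cone: B of order n + 1 is the
    middle layer, with a random successor above and a random predecessor
    below. *)
Lemma mean_height_wave n i j :
  mean_height n.+2 i.+1 j.+1 + mean_height n i j =
  (mean_height n.+1 i j + mean_height n.+1 i j.+1 +
   mean_height n.+1 i.+1 j + mean_height n.+1 i.+1 j.+1) / 2.
Proof.
transitivity (
  Ex (fun B : asm n.+1 => coin_mean (fun x => (hgt (step B x) i.+1 j.+1)%:~R)) +
  Ex (fun B : asm n.+1 => coin_mean (fun x => (hgt (back B x) i j)%:~R))).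
  by congr (_ + _); [exact: Ex_step|exact: Ex_back].
rewrite /mean_height -!ExD -ExZr.
congr Ex; apply/funext => B.
(* On the boundary all heights are deterministic. *)
have [nl|ln] := leqP n.+1 (maxn i j).
  have -> : (fun x => (hgt (step B x) i.+1 j.+1)%:~R) =
      (fun _ : coins n.+1 => ((minn (minn i j).+1 n.+2)%:Z)%:~R : R).
    apply/funext => x; have [ni|ni] := leqP n.+1 i.
      by rewrite hgt_fulll //; congr (_%:~R); lia.
    by rewrite hgt_fullr; [congr (_%:~R); lia|lia].
  have -> : (fun x => (hgt (back B x) i j)%:~R) =
      (fun _ : coins n.+1 => ((minn (minn i j) n)%:Z)%:~R : R).
    apply/funext => x; have [ni|ni] := leqP n i.
      by rewrite hgt_fulll //; congr (_%:~R); lia.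
    by rewrite hgt_fullr; [congr (_%:~R); lia|lia].
  rewrite !coin_mean_cst -!intrD.
  have [ni|ni] := leqP n.+1 i.
    rewrite !hgt_fulll //; try lia.
    by apply: half_int; lia.
  rewrite !hgt_fullr //; try lia.
  by apply: half_int; lia.
have [li lj] : (i < n.+1)%N /\ (j < n.+1)%N by lia.
have -> : (fun x => (hgt (step B x) i.+1 j.+1)%:~R) = (fun x =>
    if coin x (Ordinal li) (Ordinal lj) then (hi_up (hgt B) i j)%:~R
    else (lo_up (hgt B) i j)%:~R : R).
  apply/funext => x; rewrite hgt_step /=.
  by rewrite [(n < i)%N]leqNgt [(n < j)%N]leqNgt li lj /=; case: ifP.
have -> : (fun x => (hgt (back B x) i j)%:~R) = (fun x =>
    if coin x (Ordinal li) (Ordinal lj) then (hi_dn (hgt B) i j)%:~R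
    else (lo_dn (hgt B) i j)%:~R : R).
  by apply/funext => x; rewrite hgt_back // /back_array; case: ifP.
rewrite !coin_mean_select -mulrDl -!intrD; congr (_ / _).
by rewrite -plaquette_sum; congr (_%:~R); ring.
Qed.

Lemma mean_height1 i j : mean_height 1 i j = ((0 < i) && (0 < j))%N%:R.
Proof.
rewrite /mean_height -[RHS](@Ex_cst 1); congr Ex; apply/funext => M.
case: i => [|i]; first by rewrite hgt0l.
case: j => [|j]; first by rewrite hgt0r.
by rewrite hgt_fullr // (_ : minn _ _ = 1%N) //; lia.
Qed.

Definition lipschitz n (f : asm n -> R) := forall (A A' : asm n) (c : nat),
  (forall i j, `|hgt A i j - hgt A' i j| <= c%:Z) -> `|f A - f A'| <= c%:R.

(** The forward move with frozen coins is built from minima and maxima, hence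
    does not expand the sup norm. *)
Lemma step_nonexpansive n (A A' : asm n) (c : nat) (x : coins n) :
    (forall i j, `|hgt A i j - hgt A' i j| <= c%:Z) ->
  forall i j, `|hgt (step A x) i j - hgt (step A' x) i j| <= c%:Z.
Proof.
move=> H i j; rewrite !hgt_step; case: i j => [|i] [|j] //=.
case: leqP => _; first by rewrite subrr normr0.
case: leqP => _; first by rewrite subrr normr0.
have := H i j; have := H i.+1 j; have := H i j.+1; have := H i.+1 j.+1.
by rewrite /hi_up /lo_up; case: ifP => _; lia.
Qed.

Lemma step_osc n (A : asm n) (x y : coins n) i j :
  `|hgt (step A x) i j - hgt (step A y) i j| <= 1.
Proof.
rewrite !hgt_step; case: i j => [|i] [|j] //=.
case: leqP => _; first by rewrite subrr normr0.
case: leqP => _; first by rewrite subrr normr0.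
by have := gap_up A i j; case: ifP => _; case: ifP => _; lia.
Qed.

Lemma lipschitz_coin_mean n (f : asm n.+1 -> R) : lipschitz f ->
  lipschitz (fun A => coin_mean (fun x => f (step A x))).
Proof.
move=> lf A A' c H.
rewrite -[X in X - _]mul1r -mulN1r -coin_mean_lin.
have B x : `|1 * f (step A x) + -1 * f (step A' x)| <= c%:R.
  by rewrite mul1r mulN1r; apply: lf; exact: step_nonexpansive.
rewrite ler_norml; apply/andP; split.
  rewrite -(@coin_mean_cst n (- c%:R)); apply: le_coin_mean => x.
  by have := B x; rewrite ler_norml => /andP[].
rewrite -[leRHS](@coin_mean_cst n); apply: le_coin_mean => x.
by have := B x; rewrite ler_norml => /andP[].
Qed.

(** Each layer of coins moves a Lipschitz observable by at most 1, and
    averaging over the last layer preserves the Lipschitz property. So the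
    variances of the n layers add up to at most n. *)
Lemma variance_le n (f : asm n -> R) : lipschitz f ->
  Ex (fun M => (f M - Ex f) ^+ 2) <= n%:R.
Proof.
elim: n f => [|n IHn] f lf.
  have [M _] := asm0_exists.
  by rewrite (Ex0 _ M) (Ex0 _ M) subrr expr0n.
pose q A := coin_mean (fun x => f (step A x)).
have := IHn q (lipschitz_coin_mean lf); rewrite -[Ex q]Ex_step -/(Ex f).
set m := Ex f => Hq; rewrite Ex_step.
have pw A : coin_mean (fun x => (f (step A x) - m) ^+ 2) <= 1 + (q A - m) ^+ 2.
  have osc x : (f (step A x) - q A) ^+ 2 <= 1.
    have B y : `|f (step A x) - f (step A y)| <= 1.
      by apply: (lf _ _ 1%N) => i j; exact: step_osc.
    have lo : f (step A x) - 1 <= q A.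
      rewrite -(@coin_mean_cst n (_ - 1)); apply: le_coin_mean => y.
      by have := B y; rewrite ler_norml => /andP[]; lra.
    have hi : q A <= f (step A x) + 1.
      rewrite -(@coin_mean_cst n (_ + 1)); apply: le_coin_mean => y.
      by have := B y; rewrite ler_norml => /andP[]; lra.
    have -> : (f (step A x) - q A) ^+ 2 =
      1 - (1 - (f (step A x) - q A)) * (1 + (f (step A x) - q A)) by ring.
    by rewrite gerBl mulr_ge0 //; lra.
  have -> : (fun x => (f (step A x) - m) ^+ 2) = (fun x =>
      1 * (f (step A x) - q A) ^+ 2 +
      1 * (2 * (q A - m) * f (step A x) + 1 * ((q A - m) ^+ 2 - 2 * (q A - m) * q A))).
    by apply/funext => x; ring.
  rewrite !coin_mean_lin coin_mean_cst.
  have : coin_mean (fun x => (f (step A x) - q A) ^+ 2) <= 1.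
    by rewrite -[leRHS](@coin_mean_cst n); apply: le_coin_mean.
  rewrite -/(q A); lra.
apply: le_trans (le_Ex pw) _.
rewrite ExD Ex_cst -[n.+1]add1n natrD; lra.
Qed.

End Expectation.

(** * Exact solution of the wave equation, row by row *)

Section Moments.
Variable R : realType.

Lemma mean_height_0l n j : mean_height R n 0 j = 0.
Proof.
rewrite /mean_height -[RHS](@Ex_cst R n); congr Ex.
by apply/funext => M; rewrite hgt0l.
Qed.

Lemma mean_height_0r n i : mean_height R n i 0 = 0.
Proof.
rewrite /mean_height -[RHS](@Ex_cst R n); congr Ex.
by apply/funext => M; rewrite hgt0r.
Qed.

Lemma mean_height_fulll n i j : (n <= i)%N -> mean_height R n i j = (minn j n)%:R.
Proof.
move=> ni; rewrite /mean_height -[RHS](@Ex_cst R n); congr Ex.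
by apply/funext => M; rewrite hgt_fulll.
Qed.

Lemma mean_height_incl n i j :
  mean_height R n i j <= mean_height R n i.+1 j <= mean_height R n i j + 1.
Proof.
apply/andP; split; first by apply: le_Ex => M; rewrite ler_int; case/andP: (hgt_incl M i j).
rewrite -[X in _ + X](@Ex_cst R n) -ExD; apply: le_Ex => M.
rewrite -[1]/(1%:~R) -intrD ler_int; by case/andP: (hgt_incl M i j).
Qed.

Lemma mean_height_incr n i j :
  mean_height R n i j <= mean_height R n i j.+1 <= mean_height R n i j + 1.
Proof.
apply/andP; split; first by apply: le_Ex => M; rewrite ler_int; case/andP: (hgt_incr M i j).
rewrite -[X in _ + X](@Ex_cst R n) -ExD; apply: le_Ex => M.
rewrite -[1]/(1%:~R) -intrD ler_int; by case/andP: (hgt_incr M i j).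
Qed.

Definition mean_incr n j i : R := mean_height R n i.+1 j - mean_height R n i j.

Lemma mean_incr_bounds n j i : 0 <= mean_incr n j i <= 1.
Proof. by have := mean_height_incl n i j; rewrite /mean_incr; lra. Qed.

Lemma mean_incr_out n j i : (n <= i)%N -> mean_incr n j i = 0.
Proof.
by move=> ni; rewrite /mean_incr !mean_height_fulll ?subrr // ltnW.
Qed.

Lemma mean_incr_wave n i j : mean_incr n.+2 j.+1 i.+1 + mean_incr n j i =
  (mean_incr n.+1 j i + mean_incr n.+1 j.+1 i +
   mean_incr n.+1 j i.+1 + mean_incr n.+1 j.+1 i.+1) / 2.
Proof.
rewrite /mean_incr.
have := mean_height_wave R n i j; have := mean_height_wave R n i.+1 j; lra.
Qed.

Lemma mean_incr_wave0 n j : mean_incr n.+2 j.+1 0 =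
  (mean_incr n.+1 j 0 + mean_incr n.+1 j.+1 0) / 2.
Proof.
rewrite /mean_incr; have := mean_height_wave R n 0 j.
rewrite !mean_height_0l; lra.
Qed.

(** Generating polynomial of the increments at level j, in the variable
    X = x - 1: its coefficients are binomial moments. *)
Definition incr_poly n j : {poly R} := \sum_(i < n) mean_incr n j i *: ('X + 1) ^+ i.

Lemma incr_poly_widen n j N : (n <= N)%N ->
  incr_poly n j = \sum_(i < N) mean_incr n j i *: ('X + 1) ^+ i.
Proof.
move=> nN; rewrite /incr_poly (big_ord_widen _ (fun i => mean_incr n j i *: ('X + 1) ^+ i) nN).
rewrite big_mkcond /=; apply: eq_bigr => i _.
by case: ltnP => // ni; rewrite mean_incr_out // scale0r.
Qed.

Lemma incr_poly_wave n j :
  incr_poly n.+2 j.+1 + ('X + 1) * incr_poly n j =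
  (1 + 2^-1 *: 'X) * (incr_poly n.+1 j + incr_poly n.+1 j.+1).
Proof.
set x : {poly R} := 'X + 1.
have shift k l N : (k < N)%N ->
    \sum_(i < N) mean_incr k l i.+1 *: x ^+ i.+1 = incr_poly k l - (mean_incr k l 0)%:P.
  move=> kN; rewrite (@incr_poly_widen k l N.+1); last lia.
  rewrite big_ord_recl /= expr0.
  by rewrite alg_polyC [X in _ = X - _]addrC addrK.
have shift0 k l N : (k <= N)%N ->
    \sum_(i < N) mean_incr k l i *: x ^+ i.+1 = x * incr_poly k l.
  move=> kN; rewrite (@incr_poly_widen k l N) // mulr_sumr.
  by apply: eq_bigr => i _; rewrite exprS scalerAr.
have nn : (n <= n.+3)%N by lia.
have nn1 : (n.+1 < n.+3)%N by lia.
have nn2 : (n.+1 <= n.+3)%N by lia.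
have E : incr_poly n.+2 j.+1 - (mean_incr n.+2 j.+1 0)%:P + x * incr_poly n j =
   2^-1 *: (x * (incr_poly n.+1 j + incr_poly n.+1 j.+1) +
     (incr_poly n.+1 j - (mean_incr n.+1 j 0)%:P) +
     (incr_poly n.+1 j.+1 - (mean_incr n.+1 j.+1 0)%:P)).
  rewrite -(@shift n.+2 j.+1 n.+3) // -(@shift0 n j n.+3); last by lia.
  rewrite mulrDr -(@shift0 n.+1 j n.+3) // -(@shift0 n.+1 j.+1 n.+3) //.
  rewrite -(@shift n.+1 j n.+3) // -(@shift n.+1 j.+1 n.+3) //.
  rewrite -!big_split /= scaler_sumr; apply: eq_bigr => i _.
  rewrite -!scalerDl scalerA; congr (_ *: _).
  rewrite mean_incr_wave; ring.
have c0 : (mean_incr n.+2 j.+1 0)%:P =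
   2^-1 *: ((mean_incr n.+1 j 0)%:P + (mean_incr n.+1 j.+1 0)%:P) :> {poly R}.
  by rewrite mean_incr_wave0 -polyCD scale_polyC mulrC.
have -> : incr_poly n.+2 j.+1 + x * incr_poly n j =
  2^-1 *: (x * (incr_poly n.+1 j + incr_poly n.+1 j.+1) +
     incr_poly n.+1 j + incr_poly n.+1 j.+1).
  have -> : incr_poly n.+2 j.+1 + x * incr_poly n j =
    (incr_poly n.+2 j.+1 - (mean_incr n.+2 j.+1 0)%:P + x * incr_poly n j)
     + (mean_incr n.+2 j.+1 0)%:P by ring.
  by rewrite E c0 -scalerDr; congr (_ *: _); ring.
have -> : 1 + 2^-1 *: 'X = 2^-1 *: (x + 1) :> {poly R}.
  have half2 : 2^-1 *: (1 + 1) = 1 :> {poly R}.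
    by rewrite -[1 + 1](scaler_nat 2 1) scalerA mulVf ?scale1r ?pnatr_eq0.
  by rewrite /x -addrA scalerDr half2 addrC.
by rewrite -scalerAl; congr (_ *: _); ring.
Qed.

Definition row_poly n j : {poly R} := incr_poly n j.+1 - incr_poly n j.

Lemma incr_poly0 n : incr_poly n 0 = 0.
Proof.
rewrite /incr_poly big1 // => i _.
by rewrite /mean_incr !mean_height_0r subrr scale0r.
Qed.

Lemma incr_poly_rows n j : incr_poly n j = \sum_(l < j) row_poly n l.
Proof.
elim: j => [|j IHj]; first by rewrite incr_poly0 big_ord0.
by rewrite big_ord_recr /= -IHj /row_poly addrC subrK.
Qed.

Lemma row_poly_wave n j : row_poly n.+2 j.+1 =
  (1 + 2^-1 *: 'X) * (row_poly n.+1 j + row_poly n.+1 j.+1) - ('X + 1) * row_poly n j.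
Proof.
rewrite /row_poly.
have E k : incr_poly n.+2 k.+1 =
    (1 + 2^-1 *: 'X) * (incr_poly n.+1 k + incr_poly n.+1 k.+1) - ('X + 1) * incr_poly n k.
  by rewrite -incr_poly_wave addrK.
rewrite !E; ring.
Qed.

Lemma row_poly_wave0 n : row_poly n.+2 0 = (1 + 2^-1 *: 'X) * row_poly n.+1 0.
Proof.
rewrite /row_poly; have := incr_poly_wave n 0.
by rewrite !incr_poly0 !subr0 mulr0 addr0 add0r.
Qed.

Lemma row_poly_0 j : row_poly 0 j = 0.
Proof. by rewrite /row_poly /incr_poly !big_ord0 subrr. Qed.

Lemma row_poly_1 j : row_poly 1 j = (j == 0)%:R%:P.
Proof.
rewrite /row_poly /incr_poly !big_ord1 /mean_incr !mean_height1 /= expr0.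
by case: j => [|j]; rewrite !subr0 ?subrr ?scale1r ?scale0r ?subr0.
Qed.

(** With a = (1 + x)/2 and b = (1 - x)/2, where x = 1 + X, the sum over m of
    these terms is the coefficient of w^j in (a + b w)^(n - j) (b + a w)^j, that
    is, the j-th diagonal entry of the n-th symmetric power of the symmetric
    matrix with rows (a, b) and (b, a). Multiplied by diag(1, y), this matrix has
    trace (1 + y) a and determinant x y, and the wave equation is the recurrence
    c(n+1) = trace * c(n) - determinant * c(n-1) of the traces of symmetric
    powers. *)
Definition row_term n j m : {poly R} :=
  ('C(n - j, m) * 'C(j, m))%:R *
    ((2^-1 *: 'X) ^+ (m + m) * (1 + 2^-1 *: 'X) ^+ (n - (m + m))).

Definition row_closed K n j : {poly R} := \sum_(m < K) row_term n j m.

Lemma natr_mul_expB (a y : {poly R}) c p q : (c != 0 -> q <= p)%N ->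
  a * (c%:R * (y * a ^+ (p - q))) = c%:R * (y * a ^+ (p.+1 - q)).
Proof.
have [->|c0] := eqVneq c 0%N; first by rewrite !mul0r mulr0.
by move=> /(_ isT) qp; rewrite subSn // exprS; ring.
Qed.

Lemma bin_mul_neq0 d j m : ('C(d, m) * 'C(j, m) != 0 -> (m <= d) && (m <= j))%N.
Proof. by rewrite muln_eq0 negb_or -!lt0n !bin_gt0. Qed.

(** After cancelling powers, this is the product of two Pascal rules: the product
    of the differences C(d+1, m) - C(d, m) and C(j+1, m) - C(j, m) is
    C(d, m-1) C(j, m-1). *)
Lemma row_term_rec n j m : (j < n)%N ->
  row_term n.+1 j.+1 m =
  (1 + 2^-1 *: 'X) * (row_term n j m + row_term n j.+1 m)
  - (1 + 2^-1 *: 'X) ^+ 2 * row_term n.-1 j m +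
  (if m is m'.+1 then (2^-1 *: 'X) ^+ 2 * row_term n.-1 j m' else 0).
Proof.
move=> jn; rewrite /row_term; set a : {poly R} := 1 + _; set b : {poly R} := _ *: 'X.
move: a b => a b.
have [d ->] : exists d, n = (j + d).+1 by exists (n - j.+1)%N; lia.
have -> : ((j + d).+1.-1 - j = d)%N by lia.
have -> : ((j + d).+1 - j = d.+1)%N by lia.
have -> : ((j + d).+2 - j.+1 = d.+1)%N by lia.
have -> : ((j + d).+1 - j.+1 = d)%N by lia.
rewrite mulrDr [a ^+ 2]expr2 -[a * a * _]mulrA.
rewrite !natr_mul_expB; try by move=> /bin_mul_neq0; lia.
case: m => [|m]; first by rewrite !bin0; ring.
have -> : ((j + d).+1.-1 - (m + m) = (j + d).+2 - (m.+1 + m.+1))%N by lia.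
have -> : (m.+1 + m.+1 = 2 + (m + m))%N by lia.
rewrite !binS exprD !natrM !natrD; ring.
Qed.

Lemma row_term_out n j m : (j < m)%N -> row_term n j m = 0.
Proof. by move=> jm; rewrite /row_term [X in (_ * X)%N]bin_small // muln0 mul0r. Qed.

Lemma row_sum_rec K n j : (j < n)%N -> (n < K)%N ->
  row_closed K n.+1 j.+1 =
  (1 + 2^-1 *: 'X) * (row_closed K n j + row_closed K n j.+1)
  - ('X + 1) * row_closed K n.-1 j.
Proof.
move=> jn nK; rewrite /row_closed.
under eq_bigr => m _ do rewrite row_term_rec //.
rewrite big_split /= sumrB -mulr_sumr -mulr_sumr big_split /=.
have -> : \sum_(m < K) (if m : nat is m'.+1
     then (2^-1 *: 'X) ^+ 2 * row_term n.-1 j m' else 0) =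
   (2^-1 *: 'X) ^+ 2 * \sum_(m < K) row_term n.-1 j m.
  case: K nK => [//|K] nK.
  rewrite big_ord_recl add0r big_ord_recr /= row_term_out ?addr0 ?mulr_sumr //; lia.
have -> : 'X + 1 = (1 + 2^-1 *: 'X) ^+ 2 - (2^-1 *: 'X) ^+ 2 :> {poly R}.
  have e : 2^-1 *: 'X + 2^-1 *: 'X = 'X :> {poly R}.
    by rewrite -scalerDl (_ : 2^-1 + 2^-1 = 1) ?scale1r //; lra.
  rewrite -{1}e.
  by move: (2^-1 *: 'X : {poly R}) => b; ring.
move: (\sum_(m < K) row_term n.-1 j m) => A; ring.
Qed.

Lemma row_polyE K n j : (n < K)%N ->
  row_poly n.+1 j = if (j <= n)%N then row_closed K n j else 0.
Proof.
move=> nK0; have [K' KE] : exists K', K = K'.+1 by exists K.-1; lia.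
have [m] := ubnP n; elim: m n j nK0 => [//|m IHm] [|n] j nK nm.
  rewrite row_poly_1; case: j => [|j] //=.
  rewrite /row_closed KE big_ord_recl big1 => [|i _]; last by rewrite row_term_out.
  by rewrite /row_term !expr0 !bin0 addr0 !mul1r.
case: j => [|j].
  have sum0 p : row_closed K p 0 = row_term p 0 0.
    rewrite /row_closed KE big_ord_recl big1 ?addr0 // => i _.
    by rewrite row_term_out.
  rewrite row_poly_wave0 IHm /= ?sum0; try lia.
  by rewrite /row_term !bin0 !subn0 exprS; ring.
rewrite row_poly_wave !IHm //; try lia.
have [jn|nj] := ltnP j n.
  rewrite (ltnW jn) (leqW jn) row_sum_rec //; try lia.
  case: n nm nK jn => [//|n] nm nK jn; rewrite IHm //=; try lia.
  by rewrite -ltnS jn.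
have -> : row_poly n j = 0.
  case: n nm nK nj => [|n] nm nK nj; first by rewrite row_poly_0.
  by rewrite IHm ?ifF //; lia.
rewrite mulr0 subr0; have [->|jn] := eqVneq j n.
  rewrite leqnn ltnSn addr0 /row_closed mulr_sumr; apply: eq_bigr => i _.
  rewrite /row_term !subnn; case: (nat_of_ord i) => [|i'].
    by rewrite !bin0 !subn0 exprS; ring.
  by rewrite bin0n !mul0n !mul0r mulr0.
by rewrite !ifF ?addr0 ?mulr0 //; lia.
Qed.

End Moments.

(** * Limits of the row moments *)

Section MomentLimits.
Variable R : realType.

Lemma coef_1DcX_exp (c : R) q l : ((1 + c *: 'X) ^+ q)`_l = 'C(q, l)%:R * c ^+ l.
Proof.
elim: q l => [|q IHq] l.
  by rewrite expr0 coef1 bin0n; case: l => [|l]; rewrite ?mulr1 ?mul0r.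
rewrite exprS mulrDl mul1r coefD IHq -scalerAl coefZ coefXM.
case: l => [|l] /=; first by rewrite !bin0 mulr0 addr0.
by rewrite IHq binS natrD exprS; ring.
Qed.

Lemma coef_row_term n j m k : (row_term R n j m)`_k =
  if (m + m <= k)%N then
    ('C(n - j, m) * 'C(j, m) * 'C(n - (m + m), k - (m + m)))%:R / 2 ^+ k
  else 0.
Proof.
rewrite /row_term mulr_natl coefMn -[_ *+ _]mulr_natl.
rewrite exprZn -scalerAl coefZ coefXnM coef_1DcX_exp ltnNge.
case: leqP => mk /=; last by rewrite !mulr0.
have -> : (2 ^+ k)^-1 = 2^-1 ^+ (m + m) * 2^-1 ^+ (k - (m + m)) :> R.
  by rewrite -exprD subnKC // exprVn.
rewrite !natrM; ring.
Qed.

Lemma binomial_moment n j k : (j <= n.+1)%N ->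
  \sum_(i < n.+1) mean_incr R n.+1 j i * 'C(i, k)%:R =
  \sum_(l < j) \sum_(m < k.+1 | (m + m <= k)%N)
     ('C(n - l, m) * 'C(l, m) * 'C(n - (m + m), k - (m + m)))%:R / 2 ^+ k.
Proof.
move=> jn.
have -> : \sum_(i < n.+1) mean_incr R n.+1 j i * 'C(i, k)%:R = (incr_poly R n.+1 j)`_k.
  rewrite /incr_poly coef_sum; apply: eq_bigr => i _.
  by rewrite coefZ addrC -['X]scale1r coef_1DcX_exp expr1n mulr1.
rewrite incr_poly_rows coef_sum; apply: eq_bigr => l _.
have ln : (l <= n)%N by have := ltn_ord l; lia.
rewrite (@row_polyE R (n + k).+1) ?ln; last by lia.
rewrite /row_closed coef_sum.
under eq_bigr => m _ do rewrite coef_row_term.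
rewrite -big_mkcond /=.
rewrite [RHS](big_ord_widen_cond (n + k).+1 (fun m => m + m <= k)%N (fun m =>
   ('C(n - l, m) * 'C(l, m) * 'C(n - (m + m), k - (m + m)))%:R / 2 ^+ k)); last lia.
apply: eq_bigl => m; lia.
Qed.

Lemma prod_close (x y z w : R) : 0 <= x <= 1 -> 0 <= w <= 1 ->
  `|x * y - z * w| <= `|x - z| + `|y - w|.
Proof.
move=> hx hw; have -> : x * y - z * w = x * (y - w) + (x - z) * w by ring.
rewrite addrC (le_trans (ler_normD _ _)) // !normrM.
have -> : `|x| = x by rewrite ger0_norm //; lra.
have -> : `|w| = w by rewrite ger0_norm //; lra.
have := normr_ge0 (x - z); have := normr_ge0 (y - w); nra.
Qed.

Lemma ffact_le_exp a m : (a ^_ m <= a ^ m)%N.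
Proof.
elim: m => [|m IHm]; first by rewrite ffactn0.
by rewrite ffactnSr expnSr leq_mul // leq_subr.
Qed.

Lemma ffact_unit a m N : (0 < N)%N -> (a <= N)%N ->
  0 <= ((a ^_ m)%:R / N%:R ^+ m : R) <= 1.
Proof.
move=> N0 aN; rewrite divr_ge0 ?ler0n ?exprn_ge0 //= ler_pdivrMr ?exprn_gt0 ?ltr0n //.
rewrite mul1r -natrX ler_nat (leq_trans (ffact_le_exp _ _)) //.
by case: m => [//|m]; rewrite leq_exp2r.
Qed.

(** Each factor of the falling factorial, divided by N, is within (c + m)/N of
    z, and factors in [0, 1] do not amplify errors. *)
Lemma ffact_close (a N m : nat) (z c : R) : (0 < N)%N -> (a <= N)%N ->
    0 <= z <= 1 -> 0 <= c -> `|a%:R / N%:R - z| <= c / N%:R ->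
  `|(a ^_ m)%:R / N%:R ^+ m - z ^+ m| <= m%:R * (c + m%:R) / N%:R.
Proof.
move=> N0 aN hz c0 H; have N0' : 0 < N%:R :> R by rewrite ltr0n.
elim: m => [|m IHm]; first by rewrite ffactn0 !expr0 divr1 subrr normr0 !mul0r.
rewrite ffactnSr !exprSr natrM invfM mulrACA.
apply: (le_trans (prod_close _ _ _ _)).
- exact: ffact_unit.
- by [].
have sub : `|(a - m)%:R / N%:R - z| <= (c + m%:R) / N%:R.
  have [ma|am] := leqP m a.
    rewrite natrB // mulrBl; have := ler_normB (a%:R / N%:R - z) (m%:R / N%:R).
    have -> : a%:R / N%:R - z - m%:R / N%:R = a%:R / N%:R - m%:R / N%:R - z by ring.
    rewrite (ger0_norm (_ : 0 <= m%:R / N%:R)) ?divr_ge0 ?ler0n // mulrDl.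
    by move: H; lra.
  have -> : (a - m = 0)%N by lia.
  rewrite mul0r sub0r normrN ger0_norm; last lra.
  have : a%:R / N%:R <= m%:R / N%:R :> R by rewrite ler_pM2r ?invr_gt0 // ler_nat ltnW.
  by move: H; rewrite ler_norml mulrDl; lra.
apply: le_trans (lerD IHm sub) _.
rewrite -mulrDl ler_pM2r ?invr_gt0 // -[m.+1]addn1 natrD.
have : 0 <= m%:R :> R by rewrite ler0n.
nra.
Qed.

Definition moment_coef k m : R :=
  (k`!)%:R / ((m`!)%:R ^+ 2 * ((k - (m + m))`!)%:R * 2 ^+ k).

(** The k-th moment of the arcsine law of the chord of the disc at height y. *)
Definition arcsine_moment k (y : R) : R :=
  \sum_(m < k.+1 | (m + m <= k)%N) moment_coef k m * (y ^+ m * (1 - y) ^+ m).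

Lemma moment_coef_ge0 k m : 0 <= moment_coef k m.
Proof. by rewrite /moment_coef divr_ge0 // !mulr_ge0 ?exprn_ge0 ?ler0n. Qed.

Lemma moment_termE n l m k N : (0 < N)%N -> (m + m <= k)%N ->
  (k`!)%:R / N%:R ^+ k *
   (('C(n - l, m) * 'C(l, m) * 'C(n - (m + m), k - (m + m)))%:R / 2 ^+ k) =
  moment_coef k m * (((l ^_ m)%:R / N%:R ^+ m) * (((n - l) ^_ m)%:R / N%:R ^+ m) *
    (((n - (m + m)) ^_ (k - (m + m)))%:R / N%:R ^+ (k - (m + m)))) :> R.
Proof.
move=> N0 mk; rewrite -!bin_ffact !natrM /moment_coef.
have -> : N%:R ^+ k = N%:R ^+ m * N%:R ^+ m * N%:R ^+ (k - (m + m)) :> R.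
  by rewrite -!exprD subnKC.
field; rewrite !expf_neq0 ?pnatr_eq0 -?lt0n ?fact_gt0 //=.
Qed.

Lemma row_moment_close k : exists2 C : R, 0 <= C & forall n l,
  (l <= n)%N ->
  `|(k`!)%:R / n.+1%:R ^+ k * (\sum_(m < k.+1 | (m + m <= k)%N)
     ('C(n - l, m) * 'C(l, m) * 'C(n - (m + m), k - (m + m)))%:R / 2 ^+ k)
   - arcsine_moment k ((l%:R + 1/2) / n.+1%:R)| <= C / n.+1%:R.
Proof.
exists (\sum_(m < k.+1 | (m + m <= k)%N) moment_coef k m * (3 * (k%:R * (3 * k%:R + 1)))).
  apply: sumr_ge0 => m _; rewrite mulr_ge0 ?moment_coef_ge0 //.
move=> n l ln; set N := n.+1; set y := (_ / N%:R).
have N0 : 0 < N%:R :> R by rewrite ltr0n.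
have l0 : 0 <= l%:R :> R by rewrite ler0n.
have n0 : 0 <= n%:R :> R by rewrite ler0n.
have k0 : 0 <= k%:R :> R by rewrite ler0n.
have lnR : l%:R <= n%:R :> R by rewrite ler_nat.
have NE : N%:R = n%:R + 1 :> R by rewrite /N -addn1 natrD.
have hy : 0 <= y <= 1.
  apply/andP; split; first by apply: divr_ge0; lra.
  by rewrite /y ler_pdivrMr // NE; lra.
rewrite /arcsine_moment mulr_sumr -sumrB mulr_suml.
apply: le_trans (ler_norm_sum _ _ _) _; apply: ler_sum => m mk.
rewrite moment_termE // -mulrBr normrM (ger0_norm (moment_coef_ge0 _ _)).
rewrite -[leRHS]mulrA; apply: ler_wpM2l; first exact: moment_coef_ge0.
have unitX (z : R) p : 0 <= z <= 1 -> 0 <= z ^+ p <= 1.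
  by case/andP=> z0 z1; rewrite exprn_ge0 // exprn_ile1.
have hy1 p : 0 <= (1 - y) ^+ p <= 1 by apply: unitX; lra.
have bnd p (c : R) : (p <= k)%N -> 0 <= c <= 2 * k%:R + 1 ->
    p%:R * (c + p%:R) / N%:R <= k%:R * (3 * k%:R + 1) / N%:R.
  move=> pk hc; rewrite ler_pM2r ?invr_gt0 //.
  have p0 : 0 <= p%:R :> R by rewrite ler0n.
  have : p%:R <= k%:R :> R by rewrite ler_nat.
  nra.
have -> : y ^+ m * (1 - y) ^+ m = y ^+ m * (1 - y) ^+ m * 1 ^+ (k - (m + m)).
  by rewrite expr1n mulr1.
have bm : m%:R * (1/2 + m%:R) / N%:R <= k%:R * (3 * k%:R + 1) / N%:R :> R.
  by apply: (bnd m (1/2)); [lia|apply/andP; split; lra].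
have e1 : `|(l ^_ m)%:R / N%:R ^+ m - y ^+ m| <= k%:R * (3 * k%:R + 1) / N%:R.
  apply: (le_trans _ bm).
  apply: ffact_close; rewrite /N //; try lia; try (by apply/andP; split; lra); try lra.
  rewrite /y -mulrBl normrM (gtr0_norm (x := _^-1)) ?invr_gt0 // ler_pM2r ?invr_gt0 //.
  by rewrite ler_norml; lra.
have e2 : `|((n - l) ^_ m)%:R / N%:R ^+ m - (1 - y) ^+ m| <= k%:R * (3 * k%:R + 1) / N%:R.
  apply: (le_trans _ bm).
  apply: ffact_close; rewrite /N //; try lia; try (by apply/andP; split; lra); try lra.
  have -> : 1 - y = (N%:R - l%:R - 1/2) / N%:R by rewrite /y; field; rewrite gt_eqF.
  rewrite -mulrBl normrM (gtr0_norm (x := _^-1)) ?invr_gt0 // ler_pM2r ?invr_gt0 //.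
  by rewrite natrB // NE ler_norml; lra.
have e3 : `|((n - (m + m)) ^_ (k - (m + m)))%:R / N%:R ^+ (k - (m + m))
    - 1 ^+ (k - (m + m))| <= k%:R * (3 * k%:R + 1) / N%:R :> R.
  have km : (m + m)%:R <= k%:R :> R by rewrite ler_nat.
  have mm0 : 0 <= (m + m)%:R :> R by rewrite ler0n.
  have cb : 0 <= ((m + m)%:R + 1 : R) <= 2 * k%:R + 1 by apply/andP; split; lra.
  have nmN : (n - (m + m) <= N)%N := leq_trans (leq_subr _ _) (leqnSn n).
  have u1 : 0 <= (1 : R) <= 1 by rewrite ler01 lexx.
  have c0 : 0 <= (m + m)%:R + 1 :> R by lra.
  have close : `|(n - (m + m))%:R / N%:R - 1| <= ((m + m)%:R + 1) / N%:R :> R.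
    have -> : (n - (m + m))%:R / N%:R - 1 = ((n - (m + m))%:R - N%:R) / N%:R :> R.
      by rewrite mulrBl divff // gt_eqF.
    rewrite normrM (gtr0_norm (x := _^-1)) ?invr_gt0 // ler_pM2r ?invr_gt0 //.
    have : (n - (m + m))%:R <= n%:R :> R by rewrite ler_nat leq_subr.
    have : n%:R <= (n - (m + m))%:R + (m + m)%:R :> R by rewrite -natrD ler_nat addnC -leq_subLR.
    by rewrite NE ler_norml; move: (_%:R) (_%:R) => u v *; apply/andP; split; lra.
  have := ffact_close (k - (m + m)) (ltn0Sn n) nmN u1 c0 close.
  move=> H; apply: (le_trans H); exact: bnd (leq_subr _ _) cb.
apply: le_trans (prod_close _ _ _ _) _.
- have lN : (l <= n.+1)%N := leq_trans ln (leqnSn n).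
  have lN' : (n - l <= n.+1)%N := leq_trans (leq_subr _ _) (leqnSn n).
  have /andP[a0 a1] := ffact_unit m (ltn0Sn n) lN; have /andP[b0 b1] := ffact_unit m (ltn0Sn n) lN'.
  by rewrite mulr_ge0 //= mulr_ile1.
- by rewrite expr1n; lra.
apply: le_trans (lerD (prod_close _ _ _ _) (lexx _)) _.
- exact: (ffact_unit m (ltn0Sn n) (leq_trans ln (leqnSn n))).
- exact: hy1.
move: e1 e2 e3; move: (k%:R * _) => c.
by rewrite -[3 * c / _]mulrA; lra.
Qed.

End MomentLimits.

Section MomentLimit.
Variable R : realType.

Lemma ffact_defect i k N : (0 < N)%N -> (i <= N)%N ->
  `|(i%:R / N%:R) ^+ k - (i ^_ k)%:R / N%:R ^+ k| <= k%:R * k%:R / N%:R :> R.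
Proof.
move=> N0 iN; have N0R : 0 < N%:R :> R by rewrite ltr0n.
rewrite distrC -[X in k%:R * X]add0r; apply: ffact_close => //.
- by rewrite divr_ge0 //= ler_pdivrMr // mul1r ler_nat.
- by rewrite subrr normr0 mul0r.
Qed.

(** The increments at level j are sums over the rows below j, so their moments
    are Riemann sums of arcsine moments. Since the increments lie in [0, 1],
    replacing binomial moments by powers costs O(1/N). *)
Lemma mean_moment_close k : exists2 C : R, 0 <= C & forall N j,
  (0 < N)%N -> (j <= N)%N ->
  `|(\sum_(i < N) mean_incr R N j i * (i%:R / N%:R) ^+ k) / N%:R
    - (\sum_(l < j) arcsine_moment k ((l%:R + 1/2) / N%:R)) / N%:R| <= C / N%:R.
Proof.
have [C C0 HC] := row_moment_close R k.
exists (k%:R * k%:R + C) => [|[//|n] j _ jn]; first by rewrite addr_ge0 // mulr_ge0.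
set N := n.+1; have N0 : 0 < N%:R :> R by rewrite ltr0n.
have avg m (f : nat -> R) c : (m <= N)%N -> 0 <= c ->
    (forall i, (i < m)%N -> `|f i| <= c) -> `|(\sum_(i < m) f i) / N%:R| <= c.
  move=> mN c0 hf; rewrite normrM (gtr0_norm (x := _^-1)) ?invr_gt0 //.
  rewrite ler_pdivrMr // (le_trans (ler_norm_sum _ _ _)) //.
  apply: (@le_trans _ _ (\sum_(i < m) c)).
    by apply: ler_sum => i _; exact: hf.
  by rewrite sumr_const card_ord -[_ *+ _]mulr_natr ler_wpM2l // ler_nat.
set A := _ / N%:R; set B := _ / N%:R.
pose D := (\sum_(i < N) mean_incr R N j i * ((i ^_ k)%:R / N%:R ^+ k)) / N%:R.
have AD : `|A - D| <= k%:R * k%:R / N%:R.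
  rewrite /A /D -mulrBl -sumrB.
  apply: (avg N (fun i => mean_incr R N j i * (i%:R / N%:R) ^+ k -
     mean_incr R N j i * ((i ^_ k)%:R / N%:R ^+ k))) => // i iN.
  rewrite -mulrBr normrM; have /andP[g0 g1] := mean_incr_bounds R N j i.
  rewrite (ger0_norm g0); apply: le_trans (ffact_defect k (ltn0Sn n) (ltnW iN)).
  by rewrite ler_piMl.
have DE : D = (\sum_(l < j) ((k`!)%:R / n.+1%:R ^+ k * (\sum_(m < k.+1 | (m + m <= k)%N)
     ('C(n - l, m) * 'C(l, m) * 'C(n - (m + m), k - (m + m)))%:R / 2 ^+ k))) / N%:R.
  rewrite /D -mulr_sumr -binomial_moment // mulr_sumr; congr (_ / _).
  by apply: eq_bigr => i _; rewrite -bin_ffact natrM -/N; field; rewrite expf_neq0 // gt_eqF.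
have DB : `|D - B| <= C / N%:R.
  have c0 : 0 <= C / N%:R by rewrite divr_ge0 // ltW.
  rewrite DE /B -mulrBl -sumrB.
  apply: (avg j (fun l => (k`!)%:R / n.+1%:R ^+ k * (\sum_(m < k.+1 | (m + m <= k)%N)
     ('C(n - l, m) * 'C(l, m) * 'C(n - (m + m), k - (m + m)))%:R / 2 ^+ k) -
     arcsine_moment k ((l%:R + 1 / 2) / N%:R))) => // l lj.
  by apply: HC; rewrite -ltnS (leq_trans lj).
have -> : A - B = (A - D) + (D - B) by ring.
by rewrite (le_trans (ler_normD _ _)) // mulrDl lerD.
Qed.

End MomentLimit.

(** * A quadrature with the moments of the arcsine law *)

Section Quadrature.
Variable R : realType.

(** Nodes of the Gauss-Chebyshev quadrature for the arcsine law. *)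
Definition angle (Q t : nat) : R := pi * (t%:R + 1/2) / Q%:R.

Lemma sin_natpi m : sin (m%:R * pi) = 0 :> R.
Proof.
elim: m => [|m IHm]; first by rewrite mul0r sin0.
by rewrite -natr1 mulrDl mul1r sinDpi IHm oppr0.
Qed.

(** Multiplied by 2 sin(h), where h is half the angular step times m, the sum
    telescopes. *)
Lemma sum_cos_angle Q m : (0 < m)%N -> (m < Q + Q)%N ->
  \sum_(t < Q) cos (m%:R * angle Q t) = 0.
Proof.
move=> m0 mQ; have Q0 : (0 < Q)%N by lia.
have Q0R : 0 < Q%:R :> R by rewrite ltr0n.
have m0R : 0 < m%:R :> R by rewrite ltr0n.
pose h : R := m%:R * pi / (Q%:R + Q%:R).
have sh : 0 < sin h.
  apply: sin_gt0_pi; rewrite /h divr_gt0 ?mulr_gt0 ?pi_gt0 ?addr_gt0 //=.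
  rewrite ltr_pdivrMr ?addr_gt0 // mulrC ltr_pM2l ?pi_gt0 //.
  by rewrite -natrD ltr_nat.
apply: (mulfI (_ : 2 * sin h != 0)); first by rewrite gt_eqF // mulr_gt0.
rewrite mulr0 mulr_sumr.
pose u (t : nat) : R := sin (t%:R * (m%:R * pi / Q%:R)).
transitivity (\sum_(t < Q) (u t.+1 - u t)).
  apply: eq_bigr => t _; rewrite /u.
  have -> : t.+1%:R * (m%:R * pi / Q%:R) = m%:R * angle Q t + h.
    by rewrite /h /angle -natr1; field; rewrite !gt_eqF ?addr_gt0.
  have -> : t%:R * (m%:R * pi / Q%:R) = m%:R * angle Q t - h.
    by rewrite /h /angle; field; rewrite !gt_eqF ?addr_gt0.
  by rewrite sinD sinB; ring.
rewrite -(big_mkord xpredT (fun t => u t.+1 - u t)) telescope_sumr // /u mul0r sin0 subr0.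
by rewrite mulrC divfK ?gt_eqF // sin_natpi.
Qed.

(** Binomial expansion of (e^(ia) + e^(-ia))^k, in real form. *)
Lemma expn_2cos k (a : R) :
  (2 * cos a) ^+ k = \sum_(i < k.+1) 'C(k, i)%:R * cos ((k%:R - (i + i)%:R) * a).
Proof.
elim: k => [|k IHk].
  by rewrite expr0 big_ord1 /= subrr mul0r cos0 bin0 mulr1.
rewrite exprS IHk mulr_sumr.
have -> : \sum_(i < k.+1) 2 * cos a * ('C(k, i)%:R * cos ((k%:R - (i + i)%:R) * a)) =
  \sum_(i < k.+1) 'C(k, i)%:R * cos ((k.+1%:R - (i + i)%:R) * a) +
  \sum_(i < k.+1) 'C(k, i)%:R * cos ((k.+1%:R - (i.+1 + i.+1)%:R) * a).
  rewrite -big_split /=; apply: eq_bigr => i _.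
  have -> : (k.+1%:R - (i + i)%:R) * a = (k%:R - (i + i)%:R) * a + a.
    by rewrite -natr1; ring.
  have -> : (k.+1%:R - (i.+1 + i.+1)%:R) * a = (k%:R - (i + i)%:R) * a - a.
    by rewrite addnS addSn -[(i + i).+2%:R]natr1 -[(i + i).+1%:R]natr1 -natr1; ring.
  by rewrite cosD cosB; ring.
rewrite [in RHS]big_ord_recl /= bin0.
have -> : \sum_(i < k.+1) 'C(k, i)%:R * cos ((k.+1%:R - (i + i)%:R) * a) =
   1%:R * cos ((k.+1%:R - (0 + 0)%:R) * a) +
   \sum_(i < k.+1) 'C(k, i.+1)%:R * cos ((k.+1%:R - (i.+1 + i.+1)%:R) * a).
  rewrite big_ord_recl /= bin0; congr (_ + _).
  by rewrite [RHS]big_ord_recr /= [X in X%:R * _]bin_small // mul0r addr0.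
rewrite -addrA -big_split /=; congr (_ + _); apply: eq_bigr => i _.
by rewrite (_ : bump 0 i = i.+1) // binS -mulrDl -natrD.
Qed.

Lemma sum_odd_zero K (g : nat -> R) : (forall m, g (m + m).+1 = 0) ->
  \sum_(i < K) g i = \sum_(m < K | (m + m < K)%N) g (m + m)%N.
Proof.
move=> odd0; elim: K => [|K IHK]; first by rewrite !big_ord0.
rewrite big_ord_recr /= IHK [RHS]big_mkcond big_ord_recr /= -big_mkcond /=.
have [e|o] : (exists m, K = m + m)%N \/ (exists m, K = (m + m).+1)%N.
  have := odd_double_half K; rewrite -addnn; case: odd => h; [right|left]; exists K./2; lia.
- case: e => m KE; case: (posnP m) => [m0|m0].
    by rewrite KE m0 /= !big_ord0.
  rewrite (_ : (K + K < K.+1)%N = false) ?addr0; last lia.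
  have mK : (m < K)%N by lia.
  rewrite [RHS](bigD1 (Ordinal mK)) /=; last lia.
  rewrite -KE addrC; congr (_ + _); apply: eq_bigl => i.
  rewrite -val_eqE /=; lia.
- case: o => m KE; rewrite KE odd0 addr0 (_ : ((m + m).+1 + (m + m).+1 < _)%N = false) ?addr0; last lia.
  by apply: eq_bigl => i; lia.
Qed.

(** Averages of powers of the cosine over the nodes are those over the
    whole half circle. *)
Lemma mean_cos_exp Q k : (k < Q + Q)%N ->
  (\sum_(t < Q) cos (angle Q t) ^+ k) / Q%:R =
  if odd k then 0 else 'C(k, k./2)%:R / 2 ^+ k.
Proof.
move=> kQ; have Q0 : (0 < Q)%N by lia.
have Q0R : Q%:R != 0 :> R by rewrite pnatr_eq0; lia.
have p2 : 2 ^+ k != 0 :> R by rewrite expf_neq0.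
have -> : \sum_(t < Q) cos (angle Q t) ^+ k =
   (\sum_(i < k.+1) 'C(k, i)%:R *
      \sum_(t < Q) cos ((k%:R - (i + i)%:R) * angle Q t)) / 2 ^+ k.
  rewrite -[LHS](mulfK p2); congr (_ / _).
  under [RHS]eq_bigr => i _ do rewrite mulr_sumr.
  rewrite exchange_big /= mulr_suml; apply: eq_bigr => t _.
  by rewrite -expn_2cos exprMn mulrC.
have S (i : nat) : (i <= k)%N -> \sum_(t < Q) cos ((k%:R - (i + i)%:R) * angle Q t) =
    if (i + i == k)%N then Q%:R else 0.
  move=> ik; case: eqP => [->|ne].
    under eq_bigr => t _ do rewrite subrr mul0r cos0.
    by rewrite sumr_const card_ord.
  have [lt|gt] := leqP (i + i) k.
    by rewrite -natrB // sum_cos_angle //; lia.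
  rewrite -[RHS](@sum_cos_angle Q (i + i - k)); [|lia|lia].
  apply: eq_bigr => t _; rewrite -cosN natrB 1?ltnW // -mulNr opprB //.
under eq_bigr => i _ do rewrite (S _ (ltn_ord i)).
case: ifPn => [ok|ek].
  rewrite big1 ?mul0r // => i _; case: eqP => [e|_]; last by rewrite mulr0.
  by rewrite -e addnn odd_double in ok.
have hk : (k./2 < k.+1)%N by lia.
rewrite (bigD1 (Ordinal hk)) //= big1 => [|i ne]; last first.
  case: eqP => [e|_]; last by rewrite mulr0.
  by case/eqP: ne; apply: val_inj => /=; lia.
have -> : (k./2 + k./2 == k)%N by have := odd_double_half k; rewrite (negbTE ek) -addnn; lia.
by field; rewrite p2.
Qed.

Definition chord (y : R) : R := Num.sqrt (y * (1 - y)).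

(** Only the even powers of the cosine survive in the binomial expansion. *)
Lemma arcsine_quadrature Q k (y : R) : (k < Q)%N -> 0 <= y <= 1 ->
  (\sum_(t < Q) (1/2 + chord y * cos (angle Q t)) ^+ k) / Q%:R = arcsine_moment k y.
Proof.
move=> kQ hy.
have L2 : chord y ^+ 2 = y * (1 - y) by rewrite sqr_sqrtr //; nra.
have -> : (\sum_(t < Q) (1/2 + chord y * cos (angle Q t)) ^+ k) / Q%:R =
  \sum_(i < k.+1) 'C(k, i)%:R * (1/2) ^+ (k - i) * chord y ^+ i *
     ((\sum_(t < Q) cos (angle Q t) ^+ i) / Q%:R).
  under eq_bigr => t _ do rewrite exprDn.
  rewrite exchange_big /= mulr_suml; apply: eq_bigr => i _.
  rewrite !mulr_suml mulr_sumr; apply: eq_bigr => t _.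
  by rewrite [(chord y * _) ^+ _]exprMn -[X in X / _ = _]mulr_natl; ring.
have lt (i : 'I_k.+1) : (i < Q + Q)%N by have := ltn_ord i; lia.
under eq_bigr => i _ do rewrite (mean_cos_exp (lt i)).
rewrite (@sum_odd_zero _ (fun i => 'C(k, i)%:R * (1/2) ^+ (k - i) * chord y ^+ i *
  (if odd i then 0 else 'C(i, i./2)%:R / 2 ^+ i))); last first.
  by move=> m; rewrite /= addnn odd_double mulr0.
rewrite /arcsine_moment; apply: eq_big => [m|m mk]; first by rewrite ltnS.
rewrite addnn odd_double doubleK -addnn.
have -> : chord y ^+ (m + m) = y ^+ m * (1 - y) ^+ m.
  by rewrite addnn -mul2n exprM L2 exprMn.
rewrite ltnS in mk.
have -> : moment_coef R k m = 'C(k, m + m)%:R * 'C(m + m, m)%:R / 2 ^+ k.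
  rewrite /moment_coef -(bin_fact mk) -(@bin_fact (m + m) m) ?leq_addr // addnK !natrM.
  by field; rewrite !pnatr_eq0 -!lt0n !fact_gt0 expf_neq0.
have -> : (2 ^+ k)^-1 = (1/2) ^+ (k - (m + m)) / 2 ^+ (m + m) :> R.
  by rewrite div1r exprVn -invfM -exprD subnK.
ring.
Qed.

End Quadrature.

(** * The distribution function of the arcsine law *)

Section Counting.
Variable R : realType.

Lemma count_above (Q : nat) (a : R) : -1 <= a -> a <= Q%:R ->
  Q%:R - a - 1 <= \sum_(t < Q) (a <= t%:R)%R%:R <= Q%:R - a.
Proof.
move=> a1 aQ.
(* Both bounds hold for all q, which allows an induction on q. *)
have lo : forall q : nat, q%:R - a - 1 <= \sum_(t < q) (a <= t%:R)%R%:R.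
  elim=> [|q IHq]; first by rewrite big_ord0; lra.
  rewrite big_ord_recr /= -[q.+1%:R]natr1.
  have c0 : 0 <= \sum_(t < q) (a <= t%:R)%R%:R :> R by apply: sumr_ge0.
  by case: (lerP a q%:R) => h /=; lra.
have hi : forall q : nat, \sum_(t < q) (a <= t%:R)%R%:R <= Num.max (q%:R - a) 0.
  elim=> [|q IHq]; first by rewrite big_ord0 le_max lexx orbT.
  rewrite big_ord_recr /= -[q.+1%:R]natr1; move: IHq.
  by rewrite !maxEle; case: (lerP a q%:R) => h /=; case: ifP => h1; case: ifP => h2; lra.
rewrite lo /= (le_trans (hi Q)) // ge_max lexx /=; lra.
Qed.

Lemma sin_atan (z : R) : sin (atan z) = z / Num.sqrt (1 + z ^+ 2).
Proof.
rewrite -cos_atan -{2}[z]atanK /tan mulfVK //.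
by rewrite cos_atan invr_neq0 // gt_eqF // sqrtr_gt0; nra.
Qed.

Lemma chord_gt0 (y : R) : 0 < y < 1 -> 0 < chord y.
Proof. by move=> hy; rewrite sqrtr_gt0; nra. Qed.

Lemma chord_sqr (y : R) : 0 <= y <= 1 -> chord y ^+ 2 = y * (1 - y).
Proof. by move=> hy; rewrite sqr_sqrtr //; nra. Qed.

(** Distribution function of the arcsine law on the chord at height y. *)
Definition arcsine_cdf (x y : R) : R :=
  let X := x - 1/2 in let L := chord y in
  if L <= X then 1 else if X <= - L then 0
  else 1/2 + atan (X / Num.sqrt (L ^+ 2 - X ^+ 2)) / pi.

Lemma atan_ratio_bounds (z : R) : -(1/2) < atan z / pi < 1/2.
Proof.
rewrite ltr_pdivlMr ?ltr_pdivrMr ?pi_gt0 //.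
by have := atan_gtNpi2 z; have := atan_ltpi2 z; lra.
Qed.

Lemma arcsine_cdf_bounds x y : 0 <= arcsine_cdf x y <= 1.
Proof.
rewrite /arcsine_cdf; case: ifP => _; first by rewrite ler01 lexx.
case: ifP => _; first by rewrite ler01 lexx.
have := atan_ratio_bounds ((x - 1/2) / Num.sqrt (chord y ^+ 2 - (x - 1/2) ^+ 2)); lra.
Qed.

(** The cosine decreases on [0, pi], so the nodes below x are those with an angle
    above a threshold, and the angles are equally spaced. *)
Lemma node_fraction (Q : nat) (x y : R) : (0 < Q)%N -> 0 < y < 1 ->
  `|(\sum_(t < Q) (1/2 + chord y * cos (angle R Q t) <= x)%R%:R) / Q%:R
    - arcsine_cdf x y| <= 1 / Q%:R.
Proof.
move=> Q0 hy; have L0 := chord_gt0 hy.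
have Q0R : 0 < Q%:R :> R by rewrite ltr0n.
have pi0 : 0 < pi :> R by exact: pi_gt0.
have ang t : (t < Q)%N -> 0 < angle R Q t < pi.
  move=> tQ; have : t.+1%:R <= Q%:R :> R by rewrite ler_nat.
  rewrite -natr1 => tQ'; have t0 : 0 <= t%:R :> R by rewrite ler0n.
  have p1 : 0 < t%:R + 1/2 :> R by lra.
  rewrite /angle divr_gt0 ?mulr_gt0 //=.
  by rewrite ltr_pdivrMr // ltr_pM2l //; lra.
rewrite /arcsine_cdf; set X := x - 1/2; set L := chord y.
case: ifPn => [LX|XL].
  under eq_bigr => t _.
    have -> : 1/2 + L * cos (angle R Q t) <= x.
      have := cos_le1 (angle R Q t); move: L0 LX; rewrite -/L /X; nra.
    over.
  by rewrite sumr_const card_ord divff ?gt_eqF // subrr normr0 divr_ge0 // ltW.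
case: ifPn => [XL'|LX].
  rewrite big1 ?mul0r ?subrr ?normr0 ?divr_ge0 ?ltW // => t _.
  suff /negbTE -> : ~~ (1/2 + L * cos (angle R Q t) <= x) by [].
  have /andP[a0 api] := ang t (ltn_ord t).
  have : cos pi < cos (angle R Q t).
    by rewrite ltr_cos // in_itv /= ?lexx ?andbT ?ltW.
  rewrite cospi -ltNge; move: L0 XL'; rewrite -/L /X; nra.
rewrite -!ltNge in XL LX.
have S2 : 0 < L ^+ 2 - X ^+ 2.
  have -> : L ^+ 2 - X ^+ 2 = (L - X) * (L + X) by ring.
  by rewrite mulr_gt0 //; lra.
set S := Num.sqrt _; have S0 : 0 < S by rewrite sqrtr_gt0.
set al := atan _; pose psi := pi / 2 - al.
have hpsi : 0 < psi < pi.
  by have := atan_gtNpi2 (X / S); have := atan_ltpi2 (X / S); rewrite /psi -/al; lra.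
have cpsi : L * cos psi = X.
  rewrite /psi -[cos _]cosN opprB cosBpihalf /al sin_atan.
  have -> : 1 + (X / S) ^+ 2 = (L / S) ^+ 2.
    rewrite !expr_div_n sqr_sqrtr 1?ltW //; field; by rewrite gt_eqF.
  rewrite sqrtr_sqr gtr0_norm ?divr_gt0 //; field; by rewrite !gt_eqF.
pose a := Q%:R * psi / pi - 1/2.
have E : \sum_(t < Q) (1/2 + L * cos (angle R Q t) <= x)%R%:R =
         \sum_(t < Q) (a <= t%:R)%R%:R :> R.
  apply: eq_bigr => t _; congr (_%:R); congr (nat_of_bool _).
  have /andP[a0 api] := ang t (ltn_ord t).
  have -> : (1/2 + L * cos (angle R Q t) <= x) = (L * cos (angle R Q t) <= L * cos psi).
    by rewrite cpsi /X; lra.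
  have i1 : psi \in `[0, pi] by rewrite in_itv /=; lra.
  have i2 : angle R Q t \in `[0, pi] by rewrite in_itv /=; lra.
  rewrite ler_pM2l // leNgt (ltr_cos i2 i1) -leNgt /a /angle.
  by rewrite ler_pdivlMr // lerBlDr ler_pdivrMr // [psi * _]mulrC [pi * _]mulrC.
have q1 : psi / pi * Q%:R = Q%:R * psi / pi by ring.
have hr : 0 < psi / pi < 1 by rewrite divr_gt0 /= ?ltr_pdivrMr ?mul1r; lra.
have aQ : a <= Q%:R by rewrite /a -q1; nra.
have a1 : -1 <= a by rewrite /a -q1; nra.
have /andP[lo hi] := count_above a1 aQ; rewrite E.
have -> : 1/2 + al / pi = 1 - psi / pi.
  have half : pi / 2 / pi = 1/2 :> R by rewrite mulrAC divff ?gt_eqF.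
  by rewrite /psi mulrBl half; lra.
set c := \sum_(t < Q) _ in lo hi *.
have -> : c / Q%:R - (1 - psi / pi) = (c - (Q%:R - a - 1/2)) / Q%:R.
  by rewrite /a -q1; move: (psi / pi) => r; field; rewrite gt_eqF.
rewrite normrM (gtr0_norm (x := _^-1)) ?invr_gt0 // ler_pM2r ?invr_gt0 //.
by rewrite ler_norml; lra.
Qed.

End Counting.

(** * Comparison of distribution functions through Bernstein polynomials *)

Section Bernstein.
Variable R : realType.

Definition bern_mean N (z : R) (f : nat -> R) : R :=
  \sum_(s < N.+1) 'C(N, s)%:R * z ^+ s * (1 - z) ^+ (N - s) * f s.

Lemma bern_meanS N z f :
  bern_mean N.+1 z f = z * bern_mean N z (fun s => f s.+1) + (1 - z) * bern_mean N z f.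
Proof.
rewrite /bern_mean big_ord_recl /= bin0 expr0 subn0.
under eq_bigr => s _ do rewrite (_ : bump 0 s = s.+1) // binS natrD subSS.
have -> : \sum_(s < N.+1) ('C(N, s.+1)%:R + 'C(N, s)%:R) * z ^+ s.+1 *
     (1 - z) ^+ (N - s) * f s.+1 =
  \sum_(s < N.+1) 'C(N, s.+1)%:R * z ^+ s.+1 * (1 - z) ^+ (N - s) * f s.+1 +
  z * \sum_(s < N.+1) 'C(N, s)%:R * z ^+ s * (1 - z) ^+ (N - s) * f s.+1.
  rewrite mulr_sumr -big_split /=; apply: eq_bigr => s _; rewrite exprS; ring.
rewrite addrA [RHS]addrC; congr (_ + _).
rewrite [in LHS]big_ord_recr /= (bin_small (ltnSn N)) !mul0r addr0.
rewrite [in RHS]big_ord_recl /= bin0 expr0 subn0 mulrDr; congr (_ + _).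
  by rewrite exprS; ring.
rewrite mulr_sumr; apply: eq_bigr => s _; rewrite (_ : bump 0 s = s.+1) //.
have sN := ltn_ord s; rewrite (_ : N - s = (N - s.+1).+1)%N; last lia.
by rewrite [(1 - z) ^+ _.+1]exprS; ring.
Qed.

Lemma bern_mean_var N z c :
  bern_mean N z (fun s => (s%:R - c) ^+ 2) = (N%:R * z - c) ^+ 2 + N%:R * z * (1 - z).
Proof.
elim: N c => [|N IHN] c; first by rewrite /bern_mean big_ord1 /= bin0; ring.
rewrite bern_meanS IHN.
have -> : (fun s => (s.+1%:R - c) ^+ 2) = (fun s => (s%:R - (c - 1)) ^+ 2).
  by apply/funext => s; rewrite -natr1; ring.
by rewrite IHN -natr1; ring.
Qed.

Lemma bern_mean1 N z : bern_mean N z (fun=> 1) = 1.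
Proof.
elim: N => [|N IHN]; first by rewrite /bern_mean big_ord1 /= bin0; ring.
by rewrite bern_meanS IHN; ring.
Qed.

Lemma le_bern_mean N z f g : 0 <= z <= 1 -> (forall s, f s <= g s) ->
  bern_mean N z f <= bern_mean N z g.
Proof.
move=> /andP[z0 z1] fg; apply: ler_sum => s _; apply: ler_wpM2l => //.
by rewrite !mulr_ge0 ?exprn_ge0 ?subr_ge0.
Qed.

Lemma bern_meanB N z f g :
  bern_mean N z (fun s => f s - g s) = bern_mean N z f - bern_mean N z g.
Proof. by rewrite /bern_mean -sumrB; apply: eq_bigr => s _; rewrite mulrBr. Qed.

Lemma bern_meanZ N z f a : bern_mean N z (fun s => a * f s) = a * bern_mean N z f.
Proof. by rewrite /bern_mean mulr_sumr; apply: eq_bigr => s _; ring. Qed.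

(** Bernstein polynomial of the step function that drops from 1 to 0 at l / N. *)
Definition bern_step N l (z : R) := bern_mean N z (fun s => (s <= l)%N%:R).

Lemma bern_step_bounds N l z : 0 <= z <= 1 -> 0 <= bern_step N l z <= 1.
Proof.
move=> hz; apply/andP; split.
  rewrite -[leLHS](mul0r (bern_mean N z (fun=> 1))) -bern_meanZ.
  by apply: le_bern_mean => // s; rewrite mul0r.
rewrite -[leRHS](bern_mean1 N z); apply: le_bern_mean => // s.
by case: (s <= l)%N.
Qed.

Lemma bern_step_full N z : bern_step N N z = 1.
Proof.
rewrite -(bern_mean1 N z); apply: eq_bigr => s _.
by rewrite -ltnS ltn_ord.
Qed.

(** Chebyshev's inequality for the binomial law. *)
Lemma bern_tail N z d (A : pred nat) : (0 < N)%N -> 0 <= z <= 1 -> 0 < d ->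
    (forall s, A s -> d <= `|s%:R / N%:R - z|) ->
  bern_mean N z (fun s => (A s)%:R) <= 1 / (N%:R * d ^+ 2).
Proof.
move=> N0 hz d0 hA; have N0R : 0 < N%:R :> R by rewrite ltr0n.
pose c := (N%:R * d) ^- 2.
have c0 : 0 < c by rewrite invr_gt0 exprn_gt0 // mulr_gt0.
apply: (@le_trans _ _ (bern_mean N z (fun s => c * (s%:R - N%:R * z) ^+ 2))).
  apply: le_bern_mean => // s; have [As|_] := boolP (A s); last first.
    by rewrite mulr_ge0 ?sqr_ge0 // ltW.
  have := hA s As.
  have -> : s%:R / N%:R - z = (s%:R - N%:R * z) / N%:R by field; rewrite gt_eqF.
  rewrite normrM (gtr0_norm (x := _^-1)) ?invr_gt0 // ler_pdivlMr // => h.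
  rewrite /c mulrC ler_pdivlMr ?exprn_gt0 ?mulr_gt0 // mul1r.
  rewrite -[leRHS]real_normK ?num_real // lerXn2r ?nnegrE //.
    by rewrite mulr_ge0 // ltW.
  by rewrite mulrC.
rewrite bern_meanZ bern_mean_var subrr expr0n /= add0r /c.
have -> : (N%:R * d) ^- 2 * (N%:R * z * (1 - z)) = z * (1 - z) / (N%:R * d ^+ 2).
  by field; rewrite !gt_eqF.
rewrite ler_pM2r ?invr_gt0 ?mulr_gt0 ?exprn_gt0 //; nra.
Qed.

Lemma bern_step_high N l z d : (0 < N)%N -> 0 <= z <= 1 -> 0 < d ->
  l%:R / N%:R + d <= z -> bern_step N l z <= 1 / (N%:R * d ^+ 2).
Proof.
move=> N0 hz d0 lz; have N0R : 0 < N%:R :> R by rewrite ltr0n.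
apply: bern_tail => // s sl; rewrite distrC ler_normr.
have : s%:R / N%:R <= l%:R / N%:R :> R by rewrite ler_pM2r ?invr_gt0 // ler_nat.
by move=> ?; apply/orP; left; lra.
Qed.

Lemma bern_step_low N l z d : (0 < N)%N -> 0 <= z <= 1 -> 0 < d ->
  z + d <= l%:R / N%:R -> 1 - 1 / (N%:R * d ^+ 2) <= bern_step N l z.
Proof.
move=> N0 hz d0 lz; have N0R : 0 < N%:R :> R by rewrite ltr0n.
have -> : bern_step N l z = 1 - bern_mean N z (fun s => (l < s)%N%:R).
  rewrite -[X in X - _](bern_mean1 N z) -bern_meanB; apply: eq_bigr => s _; congr (_ * _).
  by rewrite leqNgt; case: ltnP => _; rewrite /= ?subrr ?subr0.
rewrite lerD2l lerN2; apply: bern_tail => // s sl; rewrite ler_normr.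
have : l%:R / N%:R <= s%:R / N%:R :> R by rewrite ler_pM2r ?invr_gt0 // ler_nat ltnW.
by move=> ?; apply/orP; left; lra.
Qed.

(** Two mass distributions on [0, 1] that almost agree on the Bernstein
    polynomials of the step functions have close distribution functions, up to
    a small shift of the argument. *)
Lemma cdf_compare (I J : finType) (u x : I -> R) (v y : J -> R) N d eta c :
    (forall i, 0 <= u i) -> \sum_i u i <= 1 -> (forall i, 0 <= x i <= 1) ->
    (forall j, 0 <= v j) -> \sum_j v j <= 1 -> (forall j, 0 <= y j <= 1) ->
    (0 < N)%N -> 0 < d -> 0 <= eta ->
    (forall l, (l <= N)%N ->
      \sum_i u i * bern_step N l (x i) <= \sum_j v j * bern_step N l (y j) + eta) ->
  \sum_i u i * (x i <= c)%R%:R <=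
    \sum_j v j * (y j <= c + d + d + 1 / N%:R)%R%:R + 2 / (N%:R * d ^+ 2) + eta.
Proof.
move=> u0 u1 hx v0 v1 hy N0 d0 e0 H.
have N0R : 0 < N%:R :> R by rewrite ltr0n.
have iN : 0 < 1 / N%:R :> R by rewrite divr_gt0.
pose k : R := 1 / (N%:R * d ^+ 2).
have k0 : 0 <= k by rewrite divr_ge0 ?mulr_ge0 ?exprn_ge0 // ltW.
have -> : 2 / (N%:R * d ^+ 2) = k + k by rewrite /k -mulrDl.
set rhs := \sum_j v j * _; have rhs0 : 0 <= rhs by apply: sumr_ge0 => j _; rewrite mulr_ge0.
have [c0|c0] := ltP c 0.
  rewrite big1 ?addr_ge0 // => i _.
  have -> : (x i <= c) = false by have := hx i; lra.
  by rewrite mulr0.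
have [c1|c1] := leP 1 (c + d).
  apply: (@le_trans _ _ (\sum_i u i)).
    by apply: ler_sum => i _; rewrite ler_piMr //; case: (_ <= c).
  have := H N (leqnn N).
  under eq_bigr do rewrite bern_step_full mulr1.
  move=> h; apply: (le_trans h); rewrite lerD2r -[leLHS]addr0 lerD ?addr_ge0 //.
  apply: ler_sum => j _; rewrite bern_step_full mulr1.
  have -> : (y j <= c + d + d + 1 / N%:R) by have := hy j; lra.
  by rewrite mulr1.
have cdN : 0 <= N%:R * (c + d) by rewrite mulr_ge0 //; lra.
pose l := (Num.truncn (N%:R * (c + d))).+1.
have l1 : c + d <= l%:R / N%:R.
  by rewrite ler_pdivlMr // mulrC ltW // /l truncnS_gt.
have l2 : l%:R / N%:R <= c + d + 1 / N%:R.
  rewrite ler_pdivrMr // mulrDl mul1r mulVf ?gt_eqF // mulrC /l -natr1 lerD2r.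
  by rewrite truncn_le.
have lN : (l <= N)%N.
  rewrite -(ltr_nat R) (@le_lt_trans _ _ (N%:R * (c + d))) ?truncn_le //.
  by rewrite -[ltRHS]mulr1 ltr_pM2l.
apply: (@le_trans _ _ (\sum_i u i * bern_step N l (x i) + k)).
  apply: (@le_trans _ _ (\sum_i (u i * bern_step N l (x i) + u i * k))).
    apply: ler_sum => i _; rewrite -mulrDr ler_wpM2l //.
    have /andP[b0 b1] := bern_step_bounds N l (hx i).
    case: (leP (x i) c) => xc; rewrite ?mulr0n ?mulr1n; last by lra.
    have := bern_step_low N0 (hx i) d0 (_ : x i + d <= l%:R / N%:R).
    rewrite -/k => /(_ ltac:(lra)); rewrite /=; lra.
  by rewrite big_split /= lerD2l -mulr_suml ler_piMl.
have := H l lN.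
suff : \sum_j v j * bern_step N l (y j) <= rhs + k by lra.
apply: (@le_trans _ _ (\sum_j (v j * (y j <= c + d + d + 1 / N%:R)%R%:R + v j * k))).
  apply: ler_sum => j _; rewrite -mulrDr ler_wpM2l //.
  have /andP[b0 b1] := bern_step_bounds N l (hy j).
  case: (leP (y j) _) => yc; rewrite ?mulr0n ?mulr1n; first by lra.
  have := bern_step_high N0 (hy j) d0 (_ : l%:R / N%:R + d <= y j).
  rewrite -/k => /(_ ltac:(lra)); lra.
by rewrite big_split /= lerD2l -mulr_suml ler_piMl.
Qed.

End Bernstein.

(** * Mean heights against the quadrature measure *)

Section PolyMean.
Variable R : realType.

Lemma chord_le_half (y : R) : 0 <= y <= 1 -> 0 <= chord y <= 1/2.
Proof.
move=> hy; rewrite sqrtr_ge0 /= -(@ler_sqr _ _ (1/2)) ?nnegrE ?sqrtr_ge0 //.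
rewrite sqr_sqrtr; last by nra.
by have := sqr_ge0 (y - 1/2); rewrite !expr2; nra.
Qed.

Definition node Q (y : R) (t : nat) : R := 1/2 + chord y * cos (angle R Q t).

Lemma node_unit Q y t : 0 <= y <= 1 -> 0 <= node Q y t <= 1.
Proof.
move=> /chord_le_half; have := cos_le1 (angle R Q t).
by have := cos_geN1 (angle R Q t); rewrite /node; nra.
Qed.

Definition level n l : R := (l%:R + 1/2) / n%:R.

Lemma level_unit n l : (l < n)%N -> 0 < level n l < 1.
Proof.
move=> ln; have : l.+1%:R <= n%:R :> R by rewrite ler_nat.
have l0 : 0 <= l%:R :> R by rewrite ler0n.
rewrite -natr1 => h; have n0 : 0 < n%:R :> R by lra.
have p1 : 0 < l%:R + 1/2 :> R by lra.
by rewrite /level divr_gt0 //= ltr_pdivrMr //; lra.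
Qed.

(** With more nodes than the degree of p, the quadrature integrates p exactly
    against the arcsine law. *)
Lemma poly_mean_close (p : {poly R}) : exists2 C : R, 0 <= C & forall Q n j,
  (size p <= Q)%N -> (0 < n)%N -> (j <= n)%N ->
  `|(\sum_(i < n) mean_incr R n j i * p.[i%:R / n%:R]) / n%:R
    - (\sum_(l < j) (\sum_(t < Q) p.[node Q (level n l) t]) / Q%:R) / n%:R| <= C / n%:R.
Proof.
have /choice[C HC] : forall k, exists C : R, 0 <= C /\ forall N j,
  (0 < N)%N -> (j <= N)%N ->
  `|(\sum_(i < N) mean_incr R N j i * (i%:R / N%:R) ^+ k) / N%:R
    - (\sum_(l < j) arcsine_moment k ((l%:R + 1/2) / N%:R)) / N%:R| <= C / N%:R.
  by move=> k; have [C C0 HC] := mean_moment_close R k; exists C.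
exists (\sum_(k < size p) `|p`_k| * C k).
  by apply: sumr_ge0 => k _; rewrite mulr_ge0 //; case: (HC k).
move=> Q n j pQ n0 jn.
have -> : (\sum_(i < n) mean_incr R n j i * p.[i%:R / n%:R]) / n%:R =
  \sum_(k < size p) p`_k * ((\sum_(i < n) mean_incr R n j i * (i%:R / n%:R) ^+ k) / n%:R).
  under eq_bigr => i _ do rewrite horner_coef mulr_sumr.
  rewrite exchange_big /= mulr_suml; apply: eq_bigr => k _.
  by rewrite !mulr_suml mulr_sumr; apply: eq_bigr => i _; ring.
have -> : (\sum_(l < j) (\sum_(t < Q) p.[node Q (level n l) t]) / Q%:R) / n%:R =
  \sum_(k < size p) p`_k * ((\sum_(l < j) arcsine_moment k ((l%:R + 1/2) / n%:R)) / n%:R).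
  under eq_bigr => l _.
    have -> : (\sum_(t < Q) p.[node Q (level n l) t]) / Q%:R =
       \sum_(k < size p) p`_k * arcsine_moment k (level n l).
      under eq_bigr => t _ do rewrite horner_coef.
      rewrite exchange_big /= mulr_suml; apply: eq_bigr => k _.
      rewrite -(@arcsine_quadrature R Q) ?(leq_trans (ltn_ord k)) //.
        by rewrite !mulr_suml mulr_sumr; apply: eq_bigr => t _; rewrite /node; ring.
      by have := level_unit (leq_trans (ltn_ord l) jn); lra.
    over.
  rewrite exchange_big /= mulr_suml; apply: eq_bigr => k _.
  by rewrite !mulr_suml mulr_sumr; apply: eq_bigr => l _; rewrite /level; ring.
rewrite -sumrB mulr_suml; apply: le_trans (ler_norm_sum _ _ _) _.
apply: ler_sum => k _; rewrite -mulrBr normrM -mulrA ler_wpM2l //.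
by case: (HC k) => _; apply.
Qed.

Definition bern_poly N l : {poly R} :=
  \sum_(s < N.+1) ('C(N, s)%:R * (s <= l)%N%:R) *: ('X ^+ s * (1 - 'X) ^+ (N - s)).

Lemma bern_polyE N l z : (bern_poly N l).[z] = bern_step N l z.
Proof.
rewrite /bern_poly horner_sum; apply: eq_bigr => s _.
by rewrite hornerZ hornerM !horner_exp !hornerE /=; ring.
Qed.

Lemma bern_mean_close N : exists2 C : R, 0 <= C & exists Q0 : nat, forall Q n j l,
  (Q0 <= Q)%N -> (0 < n)%N -> (j <= n)%N -> (l <= N)%N ->
  `|(\sum_(i < n) mean_incr R n j i * bern_step N l (i%:R / n%:R)) / n%:R
    - (\sum_(m < j) (\sum_(t < Q) bern_step N l (node Q (level n m) t)) / Q%:R) / n%:R|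
  <= C / n%:R.
Proof.
have /choice[C HC] : forall l, exists C : R, 0 <= C /\ forall Q n j,
  (size (bern_poly N l) <= Q)%N -> (0 < n)%N -> (j <= n)%N ->
  `|(\sum_(i < n) mean_incr R n j i * (bern_poly N l).[i%:R / n%:R]) / n%:R
    - (\sum_(m < j) (\sum_(t < Q) (bern_poly N l).[node Q (level n m) t]) / Q%:R) / n%:R|
  <= C / n%:R.
  by move=> l; have [C C0 HC] := poly_mean_close (bern_poly N l); exists C.
exists (\sum_(l < N.+1) C l); first by apply: sumr_ge0 => l _; case: (HC l).
exists (\sum_(l < N.+1) size (bern_poly N l))%N => Q n j l QQ n0 jn lN.
have lN' : (l < N.+1)%N by [].
have [_ H] := HC l; have := H Q n j.
under eq_bigr do rewrite bern_polyE.
under [in X in (_ -> _ -> _ -> `|_ - X| <= _) -> _]eq_bigr do under eq_bigr do rewrite bern_polyE.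
move=> {}H; apply: le_trans (H _ n0 jn) _.
  by apply: leq_trans QQ; rewrite (bigD1 (Ordinal lN')) //= leq_addr.
rewrite ler_pM2r ?invr_gt0 ?ltr0n // (bigD1 (Ordinal lN')) //= lerDl.
by apply: sumr_ge0 => i _; case: (HC i).
Qed.

End PolyMean.

(** * The limit shape inside the arctic circle *)

Section Shape.
Variable R : realType.

Lemma atan_inv (z : R) : 0 < z -> atan z^-1 = pi / 2 - atan z.
Proof.
move=> z0.
have b1 := atan_ltpi2 z; have pi0 := @pi_gt0 R.
have b0 : 0 < atan z by rewrite -(@atan0 R) lt_atan.
rewrite -[RHS]tanK; last by rewrite in_itv /=; apply/andP; split; lra.
have c0 : cos (atan z) != 0.
  by rewrite gt_eqF // cos_gt0_pihalf //; apply/andP; split; lra.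
have s0 : sin (atan z) != 0 by rewrite gt_eqF // sin_gt0_pihalf // b0.
congr atan; rewrite /tan sinB cosB cos_pihalf sin_pihalf !mul0r !mul1r subr0 add0r.
by rewrite -{1}[z]atanK /tan invfM invrK mulrC.
Qed.

Lemma atan_le_id (z : R) : 0 <= z -> atan z <= z.
Proof.
rewrite le_eqVlt => /predU1P[<-|z0]; first by rewrite atan0.
have datan t : t \in `]0, z[ -> is_derive t 1 (@atan R) (1 + t ^+ 2)^-1.
  by move=> _; exact: is_derive1_atan.
have catan : {within `[0, z], continuous (@atan R)}.
  by apply: derivable_within_continuous => t _; exact: ex_derive.
have [c _] := MVT z0 datan catan.
rewrite atan0 !subr0 => ->; apply: ler_piMl; first exact: ltW.
have h : 1 <= 1 + c ^+ 2 by rewrite lerDl sqr_ge0.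
by rewrite invf_le1 // (lt_le_trans _ h).
Qed.

Lemma atan_near_pihalf (z : R) : z != 0 ->
  `|atan z - Num.sg z * (pi / 2)| <= `|z|^-1.
Proof.
wlog z0 : z / 0 < z => [H zn0|_].
  have [|zle] := ltP 0 z; first by move=> z0; apply: H.
  have zn : 0 < - z by rewrite oppr_gt0 lt_neqAle zn0.
  have := H _ zn; rewrite oppr_eq0 => /(_ zn0).
  by rewrite normrN atanN sgrN mulNr -opprD normrN.
rewrite gtr0_sg // mul1r distrC !gtr0_norm //; last by rewrite subr_gt0 atan_ltpi2.
by rewrite -atan_inv // atan_le_id // invr_ge0 ltW.
Qed.

Lemma is_derive_atan_ratio (f g : R -> R) (y f' g' : R) : 0 < g y ->
    is_derive y 1 f f' -> is_derive y 1 g g' ->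
  is_derive y 1 (fun t => atan (f t / g t))
    ((f' * g y - f y * g') / (g y ^+ 2 + f y ^+ 2)).
Proof.
move=> g0 df dg; have gn0 : g y != 0 by rewrite gt_eqF.
have dV : is_derive y 1 (fun t => (g t)^-1) (- (g y) ^- 2 *: g').
  exact: is_deriveV.
have dM : is_derive y 1 (f * (fun t => (g t)^-1)) _ := is_deriveM df dV.
apply: (is_derive_eq (is_derive1_comp (f := @atan R) (is_derive1_atan _) dM)).
rewrite /GRing.scale /=.
have p : g y ^+ 2 + f y ^+ 2 != 0 by rewrite gt_eqF // ltr_wpDr ?sqr_ge0 // exprn_gt0.
rewrite -[(f * _) y]/(f y / g y).
have -> : (1 + (f y / g y) ^+ 2)^-1 = g y ^+ 2 / (g y ^+ 2 + f y ^+ 2).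
  by rewrite expr_div_n; field; rewrite p gn0.
by field; rewrite p gn0.
Qed.

Definition disc (X Y : R) : R := 1/4 - X ^+ 2 - Y ^+ 2.

(** W = X atan(Y/S) + Y atan(X/S) - atan(2XY/S)/2 solves the wave equation when it
    is extended to be homogeneous of degree 1 in time and space; unlike the
    formula for Z, it is regular at Y = 0 and symmetric in X and Y. *)
Definition wedge (X Y : R) : R :=
  let S := Num.sqrt (disc X Y) in
  X * atan (Y / S) + Y * atan (X / S) - 1/2 * atan (2 * X * Y / S).

Definition frozen (X Y : R) : R :=
  if X <= 0 then (if Y <= 0 then 0 else X + 1/2)
  else if Y <= 0 then Y + 1/2 else X + Y.

(** The limit shape in coordinates centred at the middle of the square. *)
Definition shape (X Y : R) : R :=
  if disc X Y <= 0 then frozen X Y else (X + Y) / 2 + 1/4 + wedge X Y / pi.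

Lemma discC X Y : disc X Y = disc Y X.
Proof. by rewrite /disc; ring. Qed.

Lemma shapeC X Y : shape X Y = shape Y X.
Proof.
rewrite /shape /wedge /frozen discC; case: ifP => _.
  by case: (X <= 0); case: (Y <= 0); rewrite // addrC.
by rewrite (addrC X Y) (mulrAC 2 X Y) (addrC (X * _)).
Qed.

Lemma is_derive_sqrt_disc X Y : 0 < disc X Y ->
  is_derive Y 1 (fun t => Num.sqrt (disc X t)) (- Y / Num.sqrt (disc X Y)).
Proof.
move=> d0.
have dd : is_derive Y 1 (disc X) (- (2 * Y)).
  have -> : disc X = (cst (1/4 - X ^+ 2) - (id ^+ 2)) by apply/funext.
  apply: is_derive_eq; rewrite /GRing.scale /= -mulr_natl; ring.
apply: (is_derive_eq (is_derive1_comp (f := Num.sqrt) (is_derive1_sqrt d0) dd)).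
have s0 : Num.sqrt (disc X Y) != 0 by rewrite gt_eqF // sqrtr_gt0.
by rewrite /GRing.scale /=; field.
Qed.

(** The derivatives of the arctangents cancel. *)
Lemma is_derive_wedge X Y : 0 < disc X Y ->
  is_derive Y 1 (wedge X) (atan (X / Num.sqrt (disc X Y))).
Proof.
move=> d0; have dS := is_derive_sqrt_disc d0.
set S := Num.sqrt (disc X Y) in dS *.
have S0 : 0 < S by rewrite sqrtr_gt0.
have S2 : S ^+ 2 = 1/4 - X ^+ 2 - Y ^+ 2 by rewrite sqr_sqrtr // ltW.
have S2Y : 0 < S ^+ 2 + Y ^+ 2 by rewrite ltr_wpDr ?sqr_ge0 // exprn_gt0.
have S2X : 0 < S ^+ 2 + X ^+ 2 by rewrite ltr_wpDr ?sqr_ge0 // exprn_gt0.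
have d1 : is_derive Y 1 (fun t => atan (t / Num.sqrt (disc X t))) S^-1.
  have dI : is_derive Y 1 (fun t : R => t) 1 := is_derive_id _ _.
  apply: (is_derive_eq (is_derive_atan_ratio (g := fun t => Num.sqrt (disc X t)) S0 dI dS)).
  by rewrite -/S; field; rewrite !gt_eqF.
have d2 : is_derive Y 1 (fun t => atan (X / Num.sqrt (disc X t)))
    (X * Y / (S * (S ^+ 2 + X ^+ 2))).
  have dC : is_derive Y 1 (fun _ : R => X) 0 := is_derive_cst X _ _.
  apply: (is_derive_eq (is_derive_atan_ratio (g := fun t => Num.sqrt (disc X t)) S0 dC dS)).
  by rewrite -/S /cst; field; rewrite !gt_eqF.
have d3 : is_derive Y 1 (fun t => atan (2 * X * t / Num.sqrt (disc X t)))
    (X / (2 * (S * (S ^+ 2 + X ^+ 2)))).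
  have dl : is_derive Y 1 (fun t => 2 * X * t) (2 * X).
    have -> : (fun t => 2 * X * t) = (2 * X) \*: (@id R^o) by apply/funext.
    by apply: is_derive_eq; rewrite /GRing.scale /= mulr1.
  apply: (is_derive_eq (is_derive_atan_ratio (g := fun t => Num.sqrt (disc X t)) S0 dl dS)).
  rewrite -/S.
  have -> : S ^+ 2 + (2 * X * Y) ^+ 2 = 4 * (S ^+ 2 + Y ^+ 2) * (S ^+ 2 + X ^+ 2).
    by rewrite S2; field.
  by field; rewrite !gt_eqF.
have -> : wedge X = cst X * (fun t => atan (t / Num.sqrt (disc X t)))
   + id * (fun t => atan (X / Num.sqrt (disc X t)))
   - cst (1/2) * (fun t => atan (2 * X * t / Num.sqrt (disc X t))).
  by apply/funext.
apply: is_derive_eq; rewrite /GRing.scale /= -/S.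
have E : S ^+ 2 + X ^+ 2 = 1/4 - Y ^+ 2 by rewrite S2; ring.
have H : X / S + Y * (X * Y / (S * (S ^+ 2 + X ^+ 2)))
   - 1/2 * (X / (2 * (S * (S ^+ 2 + X ^+ 2)))) = 0.
  have -> : X / S = X * (S ^+ 2 + X ^+ 2) / (S * (S ^+ 2 + X ^+ 2)).
    by field; rewrite !gt_eqF.
  have -> : 1/2 * (X / (2 * (S * (S ^+ 2 + X ^+ 2)))) =
     X / 4 / (S * (S ^+ 2 + X ^+ 2)) by field; rewrite !gt_eqF.
  have num : X * (S ^+ 2 + X ^+ 2) + Y * (X * Y) - X / 4 = 0 by rewrite E; field.
  by rewrite [Y * (_ / _)]mulrA -mulrDl -mulrBl num mul0r.
rewrite -[RHS]addr0 -[T in _ = _ + T]H.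
move: (X / S) (X * Y / _) (X / (2 * _)) (atan (X / S)) => p q r al; ring.
Qed.

Lemma frozen_signs X Y : X != 0 -> Y != 0 ->
  frozen X Y = (X + Y) / 2 + 1/4 +
    (X * Num.sg Y + Y * Num.sg X - 1/2 * (Num.sg X * Num.sg Y)) / 2.
Proof.
move=> X0 Y0; rewrite /frozen; have [Xp|Xn] := ltrP 0 X.
  rewrite (gtr0_sg Xp); have [Yp|Yn] := ltrP 0 Y; first by rewrite (gtr0_sg Yp); lra.
  by rewrite (ltr0_sg (_ : Y < 0)) ?lt_neqAle ?Y0 //; lra.
have Xn' : X < 0 by rewrite lt_neqAle X0.
rewrite (ltr0_sg Xn'); have [Yp|Yn] := ltrP 0 Y; first by rewrite (gtr0_sg Yp); lra.
by rewrite (ltr0_sg (_ : Y < 0)) ?lt_neqAle ?Y0 //; lra.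
Qed.

(** At the arctic circle S tends to 0, and the three arctangents tend to
    plus or minus pi/2 with an error at most S / |z|; with these limits the
    formula becomes [frozen]. *)
Lemma shape_near_frozen X Y : X != 0 -> Y != 0 -> 0 < disc X Y ->
  `|shape X Y - frozen X Y| <= Num.sqrt (disc X Y) *
     (`|X| / `|Y| + `|Y| / `|X| + 1 / (4 * (`|X| * `|Y|))).
Proof.
move=> X0 Y0 d0; rewrite /shape [disc X Y <= 0]leNgt d0 /= frozen_signs // /wedge.
set S := Num.sqrt _; have S0 : 0 < S by rewrite sqrtr_gt0.
have aX0 : 0 < `|X| by rewrite normr_gt0.
have aY0 : 0 < `|Y| by rewrite normr_gt0.
have sgV z : Num.sg (z / S) = Num.sg z by rewrite sgrM (gtr0_sg (x := S^-1)) ?invr_gt0 // mulr1.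
have near z : z != 0 -> `|atan (z / S) - Num.sg z * (pi / 2)| <= S / `|z|.
  move=> z0; have zS : z / S != 0 by rewrite mulf_neq0 // invr_neq0 // gt_eqF.
  have := atan_near_pihalf zS; rewrite sgV normrM (gtr0_norm (x := S^-1)) ?invr_gt0 //.
  by rewrite invfM invrK [_^-1 * S]mulrC.
have XY0 : 2 * X * Y != 0 by rewrite !mulf_neq0 ?pnatr_eq0.
have := near _ XY0; have := near _ X0; have := near _ Y0.
have -> : Num.sg (2 * X * Y) = Num.sg X * Num.sg Y.
  by rewrite !sgrM (gtr0_sg (x := 2)) ?mul1r.
have -> : `|2 * X * Y| = 2 * (`|X| * `|Y|) by rewrite !normrM ger0_norm // mulrA.
have pi1 : 1 <= pi :> R by have := @pi_ge2 R; lra.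
move: pi1; move: (pi : R) => P P1.
move: (atan (Y / S)) (atan (X / S)) (atan (2 * X * Y / S)) => aY aX aXY nY nX nXY.
set sX := Num.sg X in nX nXY *; set sY := Num.sg Y in nY nXY *.
have P0 : 0 < P by lra.
have -> : (X + Y) / 2 + 1/4 + (X * aY + Y * aX - 1/2 * aXY) / P -
   ((X + Y) / 2 + 1/4 + (X * sY + Y * sX - 1/2 * (sX * sY)) / 2) =
   (X * (aY - sY * (P / 2)) + Y * (aX - sX * (P / 2))
      - 1/2 * (aXY - sX * sY * (P / 2))) / P.
  by field; rewrite gt_eqF.
rewrite normrM (gtr0_norm (x := P^-1)) ?invr_gt0 // ler_pdivrMr //.
apply: (@le_trans _ _ (S * (`|X| / `|Y| + `|Y| / `|X| + 1 / (4 * (`|X| * `|Y|))))).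
  apply: le_trans (ler_normB _ _) _.
  apply: (@le_trans _ _ (`|X| * (S / `|Y|) + `|Y| * (S / `|X|)
     + 1/2 * (S / (2 * (`|X| * `|Y|))))).
    apply: lerD; last by rewrite normrM ger0_norm // ler_wpM2l.
    apply: le_trans (ler_normD _ _) _.
    by rewrite !normrM lerD // ler_wpM2l.
  rewrite le_eqVlt; apply/orP; left; apply/eqP; field.
  by rewrite !gt_eqF.
apply: ler_peMr => //; rewrite mulr_ge0 ?ltW // !addr_gt0 ?divr_gt0 ?mulr_gt0 //.
Qed.

End Shape.

(** * The vertical derivative of the limit shape *)

Section Slope.
Variable R : realType.
Local Notation cdf X Y := (arcsine_cdf (X + 1/2) (Y + 1/2) : R).

Lemma chord_centred (Y : R) : -(1/2) <= Y <= 1/2 ->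
  chord (Y + 1/2) ^+ 2 = 1/4 - Y ^+ 2.
Proof. by move=> hY; rewrite chord_sqr; [field|lra]. Qed.

Lemma cdf_inside (X Y : R) : 0 < disc X Y -> -(1/2) <= Y <= 1/2 ->
  cdf X Y = 1/2 + atan (X / Num.sqrt (disc X Y)) / pi.
Proof.
move=> d0 hY; rewrite /arcsine_cdf chord_centred // addrK.
have L0 : 0 <= chord (Y + 1/2) by exact: sqrtr_ge0.
have L2 := chord_centred hY.
rewrite /disc in d0 *; set L := chord _ in L0 L2 *.
have -> : (L <= X) = false by apply/negbTE; rewrite -ltNge; nra.
have -> : (X <= - L) = false by apply/negbTE; rewrite -ltNge; nra.
by congr (_ + atan (_ / Num.sqrt _) / _); ring.
Qed.

Lemma cdf_left (X Y : R) : disc X Y < 0 -> X <= 0 -> -(1/2) <= Y <= 1/2 ->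
  cdf X Y = 0.
Proof.
move=> d0 X0 hY; rewrite /arcsine_cdf addrK.
have L0 : 0 <= chord (Y + 1/2) by exact: sqrtr_ge0.
have L2 := chord_centred hY.
rewrite /disc in d0; set L := chord _ in L0 L2 *.
have -> : (L <= X) = false by apply/negbTE; rewrite -ltNge; nra.
by have -> : (X <= - L) by nra.
Qed.

Lemma cdf_right (X Y : R) : disc X Y <= 0 -> 0 < X -> -(1/2) <= Y <= 1/2 ->
  cdf X Y = 1.
Proof.
move=> d0 X0 hY; rewrite /arcsine_cdf addrK.
have L0 : 0 <= chord (Y + 1/2) by exact: sqrtr_ge0.
have L2 := chord_centred hY.
rewrite /disc in d0; set L := chord _ in L0 L2 *.
by have -> : (L <= X) by nra.
Qed.

Definition slope_between (f : R -> R) (a b p q : R) :=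
  a * (q - p) <= f q - f p <= b * (q - p).

Lemma slope_between_cat f (a b p q r : R) :
  slope_between f a b p q -> slope_between f a b q r -> slope_between f a b p r.
Proof. by rewrite /slope_between; lra. Qed.

Lemma slope_between_MVT (f df : R -> R) (a b p q : R) : p < q ->
    (forall y, p <= y <= q -> is_derive y 1 f (df y)) ->
    (forall y, p < y < q -> a <= df y <= b) -> slope_between f a b p q.
Proof.
move=> pq hf hdf.
have der y : y \in `]p, q[ -> is_derive y 1 f (df y).
  by rewrite in_itv /= => hy; apply: hf; lra.
have cont : {within `[p, q], continuous f}.
  apply: derivable_within_continuous => y; rewrite in_itv /= => hy.
  by have := hf y hy => ?; exact: ex_derive.
have [y yin E] := MVT pq der cont.
rewrite /slope_between E; move: yin; rewrite in_itv /= => /hdf /andP[h1 h2].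
by rewrite !ler_pM2r ?subr_gt0 // h1 h2.
Qed.

(** A one-sided version of the passage to the closed interval. The square t^2 is
    the distance to the end: the shape leaves the arctic circle with a defect of
    at most the order of the square root of the distance. *)
Lemma slope_between_limit (f : R -> R) (a b p q K s0 : R) : p < q -> 0 < s0 -> 0 <= K ->
    (forall p', p < p' < q -> slope_between f a b p' q) ->
    (forall t, 0 < t -> t ^+ 2 <= s0 -> `|f (p + t ^+ 2) - f p| <= K * t) ->
  slope_between f a b p q.
Proof.
move=> pq s00 K0 H hK.
have key e : 0 < e -> exists2 d, `|d| <= e &
    a * (q - p) <= f q - f p + d /\ f q - f p <= b * (q - p) + d.
  move=> e0.
  pose M := K + `|a| + `|b| + 1.
  have M0 : 0 < M by rewrite /M; have := normr_ge0 a; have := normr_ge0 b; lra.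
  pose t := Num.min (Num.min 1 s0) (Num.min ((q - p) / 2) (e / M)).
  have eM : 0 < e / M by rewrite divr_gt0.
  have t0 : 0 < t by rewrite /t !lt_min ltr01 s00 eM divr_gt0 // subr_gt0.
  have t1 : t <= 1 by rewrite /t !ge_min lexx.
  have ts : t <= s0 by rewrite /t !ge_min lexx !orbT.
  have tq : t <= (q - p) / 2 by rewrite /t !ge_min lexx !orbT.
  have te : t * M <= e by rewrite -ler_pdivlMr // /t !ge_min lexx !orbT.
  have tt : t ^+ 2 <= t by rewrite expr2 ler_piMl // ltW.
  have t20 : 0 < t ^+ 2 by rewrite exprn_gt0.
  have hp : p < p + t ^+ 2 < q by lra.
  have := H _ hp; have := hK t t0 (le_trans tt ts).
  rewrite ler_norml /slope_between => /andP[k1 k2] /andP[s1 s2].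
  have at2 : `|a| * t ^+ 2 <= `|a| * t by rewrite ler_wpM2l.
  have bt2 : `|b| * t ^+ 2 <= `|b| * t by rewrite ler_wpM2l.
  have a1 : a * t ^+ 2 <= `|a| * t ^+ 2 by rewrite ler_pM2r // ler_norm.
  have b1 : - (b * t ^+ 2) <= `|b| * t ^+ 2.
    by rewrite -mulNr ler_pM2r // -normrN ler_norm.
  have teM : K * t + `|a| * t + `|b| * t + t <= e by move: te; rewrite /M; lra.
  have at0 : 0 <= `|a| * t by rewrite mulr_ge0 // ltW.
  have bt0 : 0 <= `|b| * t by rewrite mulr_ge0 // ltW.
  exists e; first by rewrite gtr0_norm.
  by split; lra.
apply/andP; split; apply/ler_addgt0Pr => e e0; have [d de [h1 h2]] := key e e0.
  by apply: le_trans h1 _; rewrite lerD2l (le_trans _ de) // ler_norm.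
by apply: le_trans h2 _; rewrite lerD2l (le_trans _ de) // ler_norm.
Qed.

(** Half length of the chord of the arctic circle at abscissa X. *)
Definition half_chord (X : R) : R := Num.sqrt (1/4 - X ^+ 2).

Section FixX.
Variables (X : R) (hX : -(1/2) <= X <= 1/2).

Local Notation c := (half_chord X).

Lemma half_chord_sqr : c ^+ 2 = 1/4 - X ^+ 2.
Proof.
have /andP[h1 h2] := hX.
rewrite sqr_sqrtr //; have : 0 <= (1/2 - X) * (1/2 + X) by apply: mulr_ge0; lra.
by rewrite expr2; lra.
Qed.

Lemma half_chord_ge0 : 0 <= c. Proof. exact: sqrtr_ge0. Qed.

Lemma half_chord_le : c <= 1/2.
Proof. by have := half_chord_sqr; have := half_chord_ge0; rewrite !expr2; nra. Qed.

Lemma disc_half_chord Y : disc X Y = (c - Y) * (c + Y).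
Proof. by rewrite /disc; have := half_chord_sqr; rewrite !expr2; lra. Qed.

Lemma shape_below (p q a b : R) : -(1/2) <= p -> p < q -> q <= - c ->
    (forall Y, p < Y < q -> a <= cdf X Y <= b) ->
  slope_between (shape X) a b p q.
Proof.
move=> p0 pq qc H; have cge := half_chord_ge0; have cle := half_chord_le.
have fr Y : Y <= - c -> shape X Y = if X <= 0 then 0 else Y + 1/2.
  move=> Yc; rewrite /shape disc_half_chord /frozen.
  have -> : (c - Y) * (c + Y) <= 0 by nra.
  by have -> : Y <= 0 by lra.
have hm : p < (p + q) / 2 < q by lra.
have dm : disc X ((p + q) / 2) < 0 by rewrite disc_half_chord; nra.
have hm2 : -(1/2) <= (p + q) / 2 <= 1/2 by lra.
have := H _ hm; rewrite /slope_between !fr //; try lra.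
case: (leP X 0) => X0; first by rewrite cdf_left //; nra.
by rewrite cdf_right ?(ltW dm) //; nra.
Qed.

Lemma shape_inside (p q a b : R) : - c < p -> p < q -> q < c ->
    (forall Y, p < Y < q -> a <= cdf X Y <= b) ->
  slope_between (shape X) a b p q.
Proof.
move=> cp pq qc H; have cle := half_chord_le.
pose g Y := (X + Y) / 2 + 1/4 + wedge X Y / pi.
have d0 Y : p <= Y <= q -> 0 < disc X Y by move=> hY; rewrite disc_half_chord; nra.
have fg Y : p <= Y <= q -> shape X Y = g Y.
  by move=> /d0 dY; rewrite /shape leNgt dY.
suff : slope_between g a b p q.
  by rewrite /slope_between (fg q) ?(fg p) ?lexx ?(ltW pq).
apply: (@slope_between_MVT g (fun Y => cdf X Y) a b p q pq _ H) => Y hY.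
have dw := is_derive_wedge (d0 Y hY).
have -> : g = cst (X / 2 + 1/4) + 2^-1 \*: (@id R^o) + pi^-1 \*: (wedge X : R -> R^o).
  apply/funext => y; rewrite /g.
  rewrite -[RHS]/(X / 2 + 1/4 + 2^-1 * y + pi^-1 * wedge X y).
  by move: (wedge X y) (pi^-1) => w v; ring.
apply: is_derive_eq; rewrite cdf_inside; [|exact: d0|lra].
by rewrite /GRing.scale /= add0r mulr1 [_^-1 * atan _]mulrC; congr (_ + _); lra.
Qed.

(** At distance t^2 from the arctic circle the root S is at most t. *)
Lemma shape_left_end : X != 0 -> 0 < c -> exists2 K : R, 0 <= K &
  forall t, 0 < t -> t ^+ 2 <= c / 2 ->
    `|shape X (- c + t ^+ 2) - shape X (- c)| <= K * t.
Proof.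
move=> X0 c0; have cle := half_chord_le.
have aX : 0 < `|X| by rewrite normr_gt0.
pose K := `|X| / (c / 2) + (1/2) / `|X| + 1 / (4 * (`|X| * (c / 2))).
have K0 : 0 <= K.
  by rewrite /K !addr_ge0 // divr_ge0 ?mulr_ge0 // ltW // divr_gt0.
exists (K + 1) => [|t t0 tc]; first by rewrite addr_ge0.
set Y := - c + t ^+ 2.
have t20 : 0 < t ^+ 2 by rewrite exprn_gt0.
have t1 : t < 1.
  have : t ^+ 2 < 1 by lra.
  by rewrite expr2; nra.
have tt : t ^+ 2 <= t by rewrite expr2 ler_piMl // ltW.
have Yn : Y < 0 by rewrite /Y; lra.
have aY : `|Y| = c - t ^+ 2 by rewrite ltr0_norm // /Y opprD opprK.
have aY0 : 0 < `|Y| by rewrite aY; lra.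
have dY : disc X Y = (c + c - t ^+ 2) * t ^+ 2 by rewrite disc_half_chord /Y; ring.
have d0 : 0 < disc X Y by rewrite dY mulr_gt0 //; lra.
have St : Num.sqrt (disc X Y) <= t.
  rewrite -[leRHS]gtr0_norm // -sqrtr_sqr ler_wsqrtr // dY.
  by apply: ler_piMl; lra.
have frc : shape X (- c) = frozen X (- c).
  by rewrite /shape disc_half_chord subrr mulr0 lexx.
have Y0 : Y != 0 by rewrite lt_eqF.
have near := shape_near_frozen X0 Y0 d0.
have frt : `|frozen X Y - frozen X (- c)| <= t ^+ 2.
  rewrite /frozen (ltW Yn) (_ : - c <= 0); last by lra.
  case: (X <= 0); first by rewrite subrr normr0 ltW.
  by rewrite /Y ger0_norm; lra.
have hK : `|X| / `|Y| + `|Y| / `|X| + 1 / (4 * (`|X| * `|Y|)) <= K.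
  have c2 : c / 2 <= `|Y| by rewrite aY; lra.
  have c20 : 0 < c / 2 by lra.
  rewrite /K !lerD //.
  - by rewrite ler_wpM2l // lef_pV2 ?posrE.
  - by rewrite ler_pM2r ?invr_gt0 // aY; lra.
  - rewrite ler_wpM2l // lef_pV2 ?posrE ?mulr_gt0 // ler_pM2l // ler_pM2l //.
rewrite frc; have -> : shape X Y - frozen X (- c) =
  (shape X Y - frozen X Y) + (frozen X Y - frozen X (- c)) by ring.
apply: le_trans (ler_normD _ _) _; rewrite mulrDl mul1r lerD //; last exact: le_trans frt tt.
apply: (le_trans near); rewrite mulrC; exact: ler_pM.
Qed.

Lemma shape_lower p q a b : -(1/2) <= p -> p <= q -> q <= 0 ->
    (forall Y, p < Y < q -> a <= cdf X Y <= b) ->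
  slope_between (shape X) a b p q.
Proof.
move=> p0 pq q0 H; have c0 := half_chord_ge0; have cle := half_chord_le.
have triv r : slope_between (shape X) a b r r.
  by rewrite /slope_between !subrr !mulr0 lexx.
have inner r s : - c < r -> r <= s -> s <= 0 ->
    (forall Y, r < Y < s -> a <= cdf X Y <= b) -> slope_between (shape X) a b r s.
  move=> cr; rewrite le_eqVlt => /predU1P[<- //|rs] s0 Hrs.
  by apply: shape_inside => //; lra.
have upper r s : - c <= r -> r <= s -> s <= 0 ->
    (forall Y, r < Y < s -> a <= cdf X Y <= b) -> slope_between (shape X) a b r s.
  rewrite le_eqVlt => /predU1P[<-|cr]; last exact: inner.
  rewrite le_eqVlt => /predU1P[<- //|rs] s0 Hrs.
  have cp : 0 < c by lra.
  have [X0|X0] := eqVneq X 0.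
    have lin Y : - c <= Y <= 0 -> shape X Y = Y / 2 + 1/4.
      move=> hY; rewrite /shape; case: leP => dY.
        have YE : Y = - c by move: dY; rewrite disc_half_chord; nra.
        have cE : c = 1/2 by rewrite /half_chord X0 expr0n subr0 (_ : 1/4 = (1/2) ^+ 2) ?sqrtr_sqr ?ger0_norm //; field.
        by rewrite /frozen X0 lexx YE cE; case: ifP => [_|]; lra.
      rewrite /wedge X0 !(mul0r, mulr0, atan0, subr0, addr0, add0r); lra.
    have hm : - c < (- c + s) / 2 < s by lra.
    have := Hrs _ hm; rewrite cdf_inside; [|by rewrite disc_half_chord; nra|lra].
    rewrite [in atan _]X0 mul0r atan0 mul0r addr0 /slope_between !lin; [nra|lra|lra].
  have [K K0 HK] := shape_left_end X0 cp.
  apply: (@slope_between_limit _ _ _ _ _ K (c / 2)) => //; first lra.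
  move=> p' /andP[h1 h2]; apply: inner => //; first lra.
  by move=> Y hY; apply: Hrs; lra.
have [qc|cq] := leP q (- c).
  move: pq; rewrite le_eqVlt => /predU1P[-> //|pq].
  exact: shape_below.
have [pc|cp] := leP p (- c); last by apply: upper => //; lra.
apply: (@slope_between_cat _ _ _ _ (- c)).
  move: pc; rewrite le_eqVlt => /predU1P[-> //|pc].
  by apply: shape_below => // Y hY; apply: H; lra.
apply: upper => //; try lra.
by move=> Y hY; apply: H; lra.
Qed.

(** Reflection in the horizontal axis; it reduces the upper half of the square to
    the lower half. *)
Lemma shape_reflect Y : -(1/2) <= Y <= 1/2 -> shape X (- Y) = X + 1/2 - shape X Y.
Proof.
move=> hY; have hX' := hX; rewrite /shape.
have -> : disc X (- Y) = disc X Y by rewrite /disc sqrrN.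
case: leP => dY.
  rewrite /frozen; move: dY; rewrite /disc !expr2 => dY.
  have [Y0|Y0|Y0] := ltrgtP Y 0.
  - have -> : (- Y <= 0) = false by lra.
    by case: (X <= 0); lra.
  - have -> : (- Y <= 0) by lra.
    by case: (X <= 0); lra.
  - rewrite Y0 oppr0 lexx; case: leP => X0; last by nra.
    by nra.
rewrite /wedge; have -> : disc X (- Y) = disc X Y by rewrite /disc sqrrN.
rewrite !mulNr !mulrN !mulNr !atanN.
by move: (atan _) (atan _) (atan _) (pi^-1) => u v w z; lra.
Qed.

End FixX.

Lemma cdf_reflect (X Y : R) : cdf X (- Y) = cdf X Y.
Proof.
rewrite /arcsine_cdf.
suff -> : chord (- Y + 1/2) = chord (Y + 1/2) :> R by [].
by rewrite /chord; congr Num.sqrt; field.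
Qed.

(** Along a vertical line the derivative of the shape is the distribution
    function of the arcsine law, on the whole square. *)
Lemma shape_slope (X a b p q : R) : -(1/2) <= X <= 1/2 ->
    -(1/2) <= p -> p <= q -> q <= 1/2 ->
    (forall Y, p < Y < q -> a <= cdf X Y <= b) ->
  slope_between (shape X) a b p q.
Proof.
move=> hX p0 pq q0 H.
have upper r s : 0 <= r -> r <= s -> s <= 1/2 ->
    (forall Y, r < Y < s -> a <= cdf X Y <= b) -> slope_between (shape X) a b r s.
  move=> r0 rs s0 Hrs.
  have : slope_between (shape X) a b (- s) (- r).
    apply: shape_lower => //; try lra.
    by move=> Y hY; rewrite -cdf_reflect; apply: Hrs; lra.
  by rewrite /slope_between !shape_reflect; [lra|lra|lra|lra|lra].
have [q1|q1] := leP q 0; first exact: shape_lower.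
have [p1|p1] := leP 0 p; first exact: upper.
apply: (@slope_between_cat _ _ _ _ 0).
  by apply: shape_lower => //; [lra|move=> Y hY; apply: H; lra].
by apply: upper => //; [lra|move=> Y hY; apply: H; lra].
Qed.

End Slope.

(** * The function F as an integral of arcsine distribution functions *)

Section ShapeF.
Variable R : realType.

Lemma fstar_low_shape (x y : R) : 0 < y < 1/2 -> 0 <= x <= 1 ->
  fstar_low y x = shape (x - 1/2) (y - 1/2).
Proof.
move=> hy hx; rewrite /fstar_low -/(chord y).
have L0 : 0 < chord y by apply: chord_gt0; lra.
have L2 : chord y ^+ 2 = y * (1 - y) by apply: chord_sqr; lra.
set X := x - 1/2; set Y := y - 1/2; set L := chord y in L0 L2 *.
have dE : disc X Y = (L - X) * (L + X).
  by rewrite -subr_sqr L2 /disc /Y; field.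
have Y0 : Y < 0 by rewrite /Y; lra.
case: ifPn => [xl|xl].
  have X0 : X <= - L by rewrite /X; lra.
  have d0 : disc X Y <= 0 by rewrite dE; nra.
  rewrite /shape d0 /frozen (ltW Y0).
  by have -> : X <= 0 by lra.
rewrite -ltNge in xl; have XL : - L < X by rewrite /X; lra.
case: ifPn => [xr|xr]; last first.
  rewrite -leNgt in xr; have LX : L <= X by rewrite /X; lra.
  have d0 : disc X Y <= 0 by rewrite dE; nra.
  rewrite /shape d0 /frozen (ltW Y0).
  by case: leP => X0; rewrite /Y; lra.
have LX : X < L by rewrite /X; lra.
have d0 : 0 < disc X Y by rewrite dE mulr_gt0; lra.
rewrite /shape leNgt d0 /= /Zshape /wedge -/X -/Y -/(disc X Y).
set S := Num.sqrt _; have S0 : 0 < S by rewrite sqrtr_gt0.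
have -> : 1/2 - y = - Y by rewrite /Y; ring.
have -> : atan (S / - Y) = pi / 2 + atan (Y / S).
  have -> : S / - Y = (- (Y / S))^-1 by rewrite -mulNr invfM invrK mulrC.
  rewrite atan_inv ?atanN ?opprK // oppr_gt0 pmulr_llt0 ?invr_gt0 //.
rewrite mulrN mulNr atanN.
have yE : y = Y + 1/2 by rewrite /Y; ring.
rewrite yE; have := @pi_gt0 R.
move: (atan _) (atan _) (atan _) (pi : R) => u v w P P0.
by field; rewrite gt_eqF.
Qed.

(** The piecewise formula for the limit shape is a single symmetric formula. *)
Lemma F_shape (x y : R) : 0 <= x <= 1 -> 0 <= y <= 1 ->
  F x y = shape (x - 1/2) (y - 1/2).
Proof.
move=> hx hy; rewrite /F /fstar.
have hX : -(1/2) <= x - 1/2 <= 1/2 by lra.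
have bottom : shape (x - 1/2) (- (1/2)) = 0.
  rewrite /shape /frozen.
  have -> : disc (x - 1/2) (- (1/2)) <= 0.
    have := sqr_ge0 (x - 1/2); rewrite /disc sqrrN (_ : (1/2) ^+ 2 = 1/4); last by field.
    lra.
  have -> : - (1/2) <= 0 :> R by lra.
  by rewrite addNr; case: ifP.
case: eqP => [->|/eqP y0]; first by rewrite sub0r bottom.
have [ylt|ygt|->] := ltrgtP y (1/2).
- by rewrite fstar_low_shape //; lra.
- case: ifPn => y1; last first.
    have -> : y - 1/2 = - - (1/2) by rewrite opprK; lra.
    by rewrite shape_reflect ?bottom; lra.
  rewrite fstar_low_shape //; last lra.
  have -> : 1 - y - 1/2 = - (y - 1/2) by lra.
  by rewrite shape_reflect; lra.
- rewrite subrr /shape /wedge /frozen; case: leP => d0.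
    rewrite lexx; move: d0; rewrite /disc expr0n subr0 expr2 => d0.
    by case: leP => X0; nra.
  by rewrite !(mul0r, mulr0, atan0, subr0, addr0, add0r); lra.
Qed.

Lemma F_sym (x y : R) : 0 <= x <= 1 -> 0 <= y <= 1 -> F x y = F y x.
Proof. by move=> hx hy; rewrite !F_shape // shapeC. Qed.

Lemma F_slope (x a b p q : R) : 0 <= x <= 1 -> 0 <= p -> p <= q -> q <= 1 ->
    (forall y, p <= y <= q -> a <= arcsine_cdf x y <= b) ->
  slope_between (F x) a b p q.
Proof.
move=> hx p0 pq q1 H.
have := @shape_slope R (x - 1/2) a b (p - 1/2) (q - 1/2).
rewrite /slope_between !F_shape //; try lra.
have -> : q - 1/2 - (p - 1/2) = q - p by lra.
apply; try lra.
by move=> Y hY; rewrite subrK; apply: H; lra.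
Qed.

Lemma F_lipschitz (x x' y : R) : 0 <= x <= 1 -> 0 <= x' <= 1 -> 0 <= y <= 1 ->
  `|F x y - F x' y| <= `|x - x'|.
Proof.
move=> hx hx' hy; wlog xx : x x' hx hx' / x' <= x => [H|].
  have [|/ltW] := leP x' x; first exact: H.
  by move=> xx; rewrite distrC [leRHS]distrC; apply: H.
rewrite (F_sym hx hy) (F_sym hx' hy) (ger0_norm (x := x - x')); last lra.
have : slope_between (F y) 0 1 x' x.
  by apply: F_slope => //; try lra; move=> z _; exact: arcsine_cdf_bounds.
by rewrite /slope_between ler_norml; lra.
Qed.

Lemma F_bottom (x : R) : F x 0 = 0.
Proof. by rewrite /F /fstar eqxx. Qed.

(** The sign that makes the arcsine distribution function at x increase with the
    length of the chord. *)
Definition orient (x : R) : R := if x < 1/2 then 1 else -1.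

(** Longer chords have flatter arcsine laws, so that the distribution
    function moves towards 1/2. *)
Lemma arcsine_cdf_mono (x y y' : R) : chord y <= chord y' ->
  orient x * arcsine_cdf x y <= orient x * arcsine_cdf x y'.
Proof.
move=> LL; have L0 : 0 <= chord y by exact: sqrtr_ge0.
have L0' : 0 <= chord y' by exact: sqrtr_ge0.
have /andP[b0 b1] := arcsine_cdf_bounds x y.
have /andP[b0' b1'] := arcsine_cdf_bounds x y'.
move: b0 b1 b0' b1'; rewrite /orient /arcsine_cdf; set X := x - 1/2.
set L := chord y in LL L0 *; set L' := chord y' in LL L0' *.
have piV : 0 < (pi : R)^-1 by rewrite invr_gt0 pi_gt0.
have S2 : X ^+ 2 < L ^+ 2 -> 0 < Num.sqrt (L ^+ 2 - X ^+ 2)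
    <= Num.sqrt (L' ^+ 2 - X ^+ 2).
  move=> h; rewrite sqrtr_gt0 subr_gt0 h /= ler_wsqrtr // lerD2r.
  by rewrite lerXn2r // nnegrE.
case: ltP => hx.
  have X0 : X < 0 by rewrite /X; lra.
  have -> : (L <= X) = false by lra.
  have -> : (L' <= X) = false by lra.
  case: (leP X (- L)) => h1; case: (leP X (- L')) => h2; rewrite ?mul1r; try lra.
  move=> _ _ _ _; rewrite lerD2l ler_pM2r //; apply: le_atan.
  have /andP[s0 s1] : 0 < Num.sqrt (L ^+ 2 - X ^+ 2) <= Num.sqrt (L' ^+ 2 - X ^+ 2).
    by apply: S2; rewrite !expr2; nra.
  by rewrite ler_nM2l // lef_pV2 ?posrE //; lra.
have X0 : 0 <= X by rewrite /X; lra.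
case: (leP L' X) => h1; case: (leP L X) => h2; rewrite ?mulN1r ?lerN2; try lra.
have -> : (X <= - L) = false by lra.
have -> : (X <= - L') = false by lra.
move=> _ _ _ _; rewrite lerD2l ler_pM2r //; apply: le_atan.
have /andP[s0 s1] : 0 < Num.sqrt (L ^+ 2 - X ^+ 2) <= Num.sqrt (L' ^+ 2 - X ^+ 2).
  by apply: S2; rewrite !expr2; nra.
by apply: ler_wpM2l => //; rewrite lef_pV2 ?posrE //; lra.
Qed.

Lemma chord_incr (y y' : R) : 0 <= y -> y <= y' -> y' <= 1/2 -> chord y <= chord y'.
Proof. by move=> y0 yy y1; rewrite ler_wsqrtr //; nra. Qed.

Lemma chord_decr (y y' : R) : 1/2 <= y -> y <= y' -> y' <= 1 -> chord y' <= chord y.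
Proof. by move=> y0 yy y1; rewrite ler_wsqrtr //; nra. Qed.

Lemma F_step (x p q y v w : R) : 0 <= x <= 1 -> 0 <= p -> p <= q -> q <= 1 ->
    p <= y <= q -> (forall z, p <= z <= q -> v <= orient x * arcsine_cdf x z <= w) ->
  `|F x q - F x p - arcsine_cdf x y * (q - p)| <= (w - v) * (q - p).
Proof.
move=> hx p0 pq q1 hy H; have := H y hy; move: H; rewrite /orient.
case: ifP => _ H hvw.
  have : slope_between (F x) v w p q.
    by apply: F_slope => // z /H; rewrite mul1r.
  rewrite /slope_between ler_norml; rewrite mul1r in hvw; nra.
have : slope_between (F x) (- w) (- v) p q.
  by apply: F_slope => // z /H; rewrite mulN1r; lra.
rewrite /slope_between ler_norml; rewrite mulN1r in hvw; nra.
Qed.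

(** The arcsine distribution function is monotone in y on each half of the
    square, hence of bounded variation, and its midpoint Riemann sums converge
    with a uniform rate. *)
Lemma F_riemann (x : R) n j : 0 <= x <= 1 -> (0 < n)%N -> (j <= n)%N ->
  `|F x (j%:R / n%:R) - (\sum_(l < j) arcsine_cdf x (level R n l)) / n%:R| <= 3 / n%:R.
Proof.
move=> hx n0; have n0R : 0 < n%:R :> R by rewrite ltr0n.
pose h y := orient x * arcsine_cdf x y.
pose m : R := if x < 1/2 then 0 else -1.
have hb y : m <= h y <= m + 1.
  have := arcsine_cdf_bounds x y; rewrite /h /m /orient.
  by case: ifP => _; rewrite ?mul1r ?mulN1r; lra.
pose s (l : nat) : R := l%:R / n%:R.
(* T bounds the accumulated variation: h increases up to the middle of the
   square, one step may straddle the middle, then h decreases. *)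
pose T (k : nat) : R := if (k + k <= n)%N then h (s k) - h 0
  else 2 + (m + 1 - h (s k)).
have T3 k : T k <= 3.
  by rewrite /T; have := hb (s k); have := hb 0; case: ifP => _; lra.
suff main k : (k <= n)%N ->
    `|F x (s k) - (\sum_(l < k) arcsine_cdf x (level R n l)) / n%:R| <= T k / n%:R.
  move=> jn; apply: le_trans (main j jn) _.
  by rewrite ler_pM2r ?invr_gt0.
elim: k => [|k IHk] kn.
  by rewrite /T /s mul0r F_bottom big_ord0 mul0r subrr normr0 subrr mul0r.
have skS : s k.+1 - s k = n%:R^-1 by rewrite /s -natr1; field; rewrite gt_eqF.
have n0V : 0 < (n%:R : R)^-1 by rewrite invr_gt0.
have sk0 : 0 <= s k by rewrite divr_ge0.
have sk1 : s k.+1 <= 1 by rewrite ler_pdivrMr // mul1r ler_nat.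
have mid : s k <= level R n k <= s k.+1.
  by rewrite /s /level !ler_pM2r // -[k.+1%:R]natr1; lra.
have inc (v w : R) : (forall z, s k <= z <= s k.+1 -> v <= h z <= w) ->
    `|F x (s k.+1) - F x (s k) - arcsine_cdf x (level R n k) / n%:R| <= (w - v) / n%:R.
  move=> H; rewrite -skS; have kk1 : s k <= s k.+1 by lra.
  exact: F_step hx sk0 kk1 sk1 mid H.
rewrite big_ord_recr /= mulrDl.
set A := _ / n%:R in IHk *; set B := _ / n%:R in inc *.
have -> : F x (s k.+1) - (A + B) = (F x (s k) - A) + (F x (s k.+1) - F x (s k) - B) by ring.
apply: le_trans (ler_normD _ _) _.
have sum (v w : R) : (forall z, s k <= z <= s k.+1 -> v <= h z <= w) ->
    T k + (w - v) <= T k.+1 ->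
  `|F x (s k) - A| + `|F x (s k.+1) - F x (s k) - B| <= T k.+1 / n%:R.
  move=> H hT; apply: (@le_trans _ _ ((T k + (w - v)) / n%:R)).
    by rewrite mulrDl lerD ?inc // IHk // ltnW.
  by rewrite ler_pM2r.
have half_le (l : nat) : (l + l <= n)%N -> s l <= 1/2.
  move=> ll; rewrite /s ler_pdivrMr //; have : (l + l)%:R <= n%:R :> R by rewrite ler_nat.
  by rewrite natrD; lra.
have half_ge (l : nat) : (n <= l + l)%N -> 1/2 <= s l.
  move=> ll; rewrite /s ler_pdivlMr //; have : n%:R <= (l + l)%:R :> R by rewrite ler_nat.
  by rewrite natrD; lra.
have [c1|c1] := leqP (k.+1 + k.+1) n.
  have kk : (k + k <= n)%N by lia.
  apply: (sum (h (s k)) (h (s k.+1))); last by rewrite /T c1 kk; lra.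
  move=> z /andP[z0 z1]; have := half_le _ c1 => hl.
  by rewrite /h !arcsine_cdf_mono ?chord_incr //; lra.
have c1' : (k.+1 + k.+1 <= n)%N = false by lia.
have := hb 0; have := hb (s k); have := hb (s k.+1) => h1 h2 h3.
have [c2|c2] := leqP n (k + k).
  apply: (sum (h (s k.+1)) (h (s k))); last first.
    by rewrite /T c1'; case: ifP => _; lra.
  move=> z /andP[z0 z1]; have := half_ge _ c2 => hl.
  by rewrite /h !arcsine_cdf_mono ?chord_decr //; lra.
apply: (sum m (m + 1)) => [z _|]; first exact: hb.
by rewrite /T c1' (ltnW c2); lra.
Qed.

End ShapeF.

(** * Convergence of the mean heights *)

Section MeanLimit.
Variable R : realType.

Lemma exists_nat_ge (x : R) : exists2 m : nat, (0 < m)%N & x <= m%:R.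
Proof. by exists (Num.truncn x).+1 => //; rewrite ltW // truncnS_gt. Qed.

Lemma exists_inv_le (e c : R) : 0 < e -> 0 <= c ->
  exists2 m : nat, (0 < m)%N & forall n, (m <= n)%N -> c / n%:R <= e.
Proof.
move=> e0 c0; have [m m0 hm] := exists_nat_ge (c / e).
exists m => // n mn; have n0 : 0 < n%:R :> R by rewrite ltr0n (leq_trans m0).
rewrite ler_pdivrMr // mulrC -ler_pdivrMr //.
by rewrite (le_trans hm) // ler_nat.
Qed.

(** The shift of the argument in [cdf_compare] may leave [0, 1]. *)
Definition clip (x : R) : R := Num.min (Num.max x 0) 1.

Lemma clip_unit x : 0 <= clip x <= 1.
Proof.
by rewrite /clip; case: (leP x 0) => h1; [rewrite (min_l ler01)|case: (leP x 1) => h2]; lra.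
Qed.

Lemma clip_dist x y : 0 <= y <= 1 -> `|clip x - y| <= `|x - y|.
Proof.
move=> hy; have n1 := ler_norm (x - y); have n2 := ler_norm (y - x).
rewrite distrC in n2.
rewrite /clip; case: (leP x 0) => h1; last case: (leP x 1) => h2 //.
  by rewrite (min_l ler01) ler_norml; lra.
by rewrite ler_norml; lra.
Qed.

Lemma arcsine_cdf_clip x y : 0 <= y <= 1 -> arcsine_cdf (clip x) y = arcsine_cdf x y.
Proof.
move=> /chord_le_half /andP[L0 L1]; rewrite /clip.
case: (leP x 0) => h1; last case: (leP x 1) => h2 //.
- rewrite (min_l ler01) /arcsine_cdf.
  have -> : (0 - 1 / 2 <= - chord y) by lra.
  have -> : (x - 1/2 <= - chord y) by lra.
  by case: ifP => h3; case: ifP => h4 //; lra.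
- rewrite /arcsine_cdf; have -> : chord y <= 1 - 1 / 2 by lra.
  by have -> : chord y <= x - 1 / 2 by lra.
Qed.

Definition node_cdf Q n j (x : R) : R :=
  (\sum_(l < j) (\sum_(t < Q) (node Q (level R n l) t <= x)%R%:R) / Q%:R) / n%:R.

(** Counting nodes in each row and summing the rows as a Riemann sum. *)
Lemma node_cdf_close Q n j x : (0 < Q)%N -> (0 < n)%N -> (j <= n)%N ->
  `|node_cdf Q n j x - F (clip x) (j%:R / n%:R)| <= 1 / Q%:R + 3 / n%:R.
Proof.
move=> Q0 n0 jn; have n0R : 0 < n%:R :> R by rewrite ltr0n.
have Q0R : 0 < Q%:R :> R by rewrite ltr0n.
have := F_riemann (clip_unit x) n0 jn; set B := (\sum_(l < j) _) / n%:R; rewrite distrC => h.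
have -> : node_cdf Q n j x - F (clip x) (j%:R / n%:R) =
  (node_cdf Q n j x - B) + (B - F (clip x) (j%:R / n%:R)) by ring.
apply: le_trans (ler_normD _ _) _; apply: lerD => //.
rewrite /node_cdf /B -mulrBl -sumrB normrM (gtr0_norm (x := _^-1)) ?invr_gt0 //.
rewrite ler_pdivrMr //; apply: le_trans (ler_norm_sum _ _ _) _.
apply: (@le_trans _ _ (\sum_(l < j) (1 / Q%:R : R))).
  apply: ler_sum => l _; have hl := level_unit R (leq_trans (ltn_ord l) jn).
  by rewrite arcsine_cdf_clip; [exact: node_fraction|lra].
rewrite sumr_const card_ord -[_ *+ _]mulr_natr ler_wpM2l ?divr_ge0 ?ler_nat // ltW //.
Qed.

Definition mean_cdf n j (x : R) : R :=
  \sum_(i < n) mean_incr R n j i / n%:R * (i%:R / n%:R <= x)%R%:R.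

Lemma mean_cdfE n j i : (0 < n)%N -> (i <= n)%N ->
  mean_cdf n j ((i%:R - 1/2) / n%:R) = mean_height R n i j / n%:R.
Proof.
move=> n0 lin; have n0R : 0 < n%:R :> R by rewrite ltr0n.
have -> : mean_height R n i j = \sum_(k < i) mean_incr R n j k.
  rewrite -(big_mkord xpredT (mean_incr R n j)) /mean_incr.
  by rewrite telescope_sumr // mean_height_0l subr0.
rewrite mulr_suml (big_ord_widen n (fun k => mean_incr R n j k / n%:R) lin).
rewrite [RHS]big_mkcond /=; apply: eq_bigr => k _.
have -> : (k%:R / n%:R <= (i%:R - 1/2) / n%:R :> R) = (k < i)%N.
  rewrite ler_pM2r ?invr_gt0 //; apply/idP/idP => [h|ki].
    by rewrite -(ltr_nat R); lra.
  have : k.+1%:R <= i%:R :> R by rewrite ler_nat.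
  by rewrite -natr1; lra.
by case: ifP => _; rewrite ?mulr1 ?mulr0.
Qed.

(** The mean heights and the quadrature nodes are compared in both directions;
    the loss is the shift 2r + 1/N of the argument, which F absorbs because it is
    Lipschitz, and a few terms of size at most r. *)
Lemma mean_height_limit (e : R) : 0 < e -> exists n0 : nat, forall n i j,
  (n0 <= n)%N -> (i <= n)%N -> (j <= n)%N ->
  `|mean_height R n i j / n%:R - F (i%:R / n%:R) (j%:R / n%:R)| <= e.
Proof.
move=> e0; pose r := e / 16; have r0 : 0 < r by rewrite divr_gt0.
have r2 : 0 < r ^+ 2 by rewrite exprn_gt0.
have [N1 N10 HN1] := @exists_inv_le r 1 r0 ler01.
have [N2 N20 HN2] := @exists_inv_le r (2 / r ^+ 2) r0 (divr_ge0 (ler0n _ 2) (ltW r2)).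
pose N := maxn N1 N2; have N0 : (0 < N)%N by rewrite leq_max N10.
have N0R : 0 < N%:R :> R by rewrite ltr0n.
have N1r : 1 / N%:R <= r by apply: HN1; exact: leq_maxl.
have N2r : 2 / (N%:R * r ^+ 2) <= r.
  by have := HN2 N (leq_maxr _ _); rewrite -mulrA -invfM [r ^+ 2 * _]mulrC.
have [C C0 [Q0 HQ]] := bern_mean_close R N.
have [Q1 Q10 HQ1] := @exists_inv_le r 1 r0 ler01.
pose Q := maxn Q0 Q1; have Qp : (0 < Q)%N by rewrite leq_max Q10 orbT.
have Q0R : 0 < Q%:R :> R by rewrite ltr0n.
have Qr : 1 / Q%:R <= r by apply: HQ1; exact: leq_maxr.
have [n0 n00 Hn] := @exists_inv_le r (C + 3) r0 (addr_ge0 C0 (ler0n _ 3)).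
exists n0 => n i j nn lin jn; have np : (0 < n)%N := leq_trans n00 nn.
have npR : 0 < n%:R :> R by rewrite ltr0n.
have nV0 : 0 < (n%:R : R)^-1 by rewrite invr_gt0.
have nr : C / n%:R + 3 / n%:R <= r by rewrite -mulrDl; exact: Hn.
have C0n : 0 <= C / n%:R by rewrite divr_ge0 // ltW.
pose u (k : 'I_n) : R := mean_incr R n j k / n%:R.
pose v (_ : 'I_j * 'I_Q) : R := (Q%:R)^-1 / n%:R.
pose pu (k : 'I_n) : R := k%:R / n%:R.
pose pv (t : 'I_j * 'I_Q) : R := node Q (level R n t.1) t.2.
have u0 k : 0 <= u k by rewrite divr_ge0 //; case/andP: (mean_incr_bounds R n j k).
have v0 t : 0 <= v t by rewrite /v divr_ge0.
have u1 : \sum_k u k <= 1.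
  rewrite -mulr_suml ler_pdivrMr // mul1r.
  apply: (@le_trans _ _ (\sum_(k < n) (1 : R))); last by rewrite sumr_const card_ord.
  by apply: ler_sum => k _; case/andP: (mean_incr_bounds R n j k).
have v1 : \sum_t v t <= 1.
  rewrite sumr_const card_prod !card_ord -[_ *+ _]mulr_natr natrM /v.
  have -> : Q%:R^-1 / n%:R * (j%:R * Q%:R) = j%:R / n%:R :> R by field; rewrite !gt_eqF.
  by rewrite ler_pdivrMr // mul1r ler_nat.
have hu k : 0 <= pu k <= 1.
  by rewrite /pu divr_ge0 //= ler_pdivrMr // mul1r ler_nat ltnW.
have hv t : 0 <= pv t <= 1.
  have := level_unit R (leq_trans (ltn_ord t.1) jn) => hl.
  by apply: node_unit; lra.
have vE (g : R -> R) : \sum_t v t * g (pv t) =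
    (\sum_(l < j) (\sum_(t < Q) g (node Q (level R n l) t)) / Q%:R) / n%:R.
  rewrite -(pair_big xpredT xpredT (fun l t => v (l, t) * g (pv (l, t)))) /=.
  rewrite mulr_suml; apply: eq_bigr => l _; rewrite !mulr_suml.
  by apply: eq_bigr => t _; rewrite /v /pv /=; ring.
have uE (g : R -> R) : \sum_k u k * g (pu k) =
    (\sum_(k < n) mean_incr R n j k * g (k%:R / n%:R)) / n%:R.
  by rewrite mulr_suml; apply: eq_bigr => k _; rewrite /u /pu mulrAC.
have close l : (l <= N)%N ->
    `|\sum_k u k * bern_step N l (pu k) - \sum_t v t * bern_step N l (pv t)| <= C / n%:R.
  by move=> lN; rewrite uE vE; apply: HQ => //; exact: leq_maxl.
have Huv l : (l <= N)%N -> \sum_k u k * bern_step N l (pu k) <=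
    \sum_t v t * bern_step N l (pv t) + C / n%:R.
  by move=> /close; rewrite ler_norml; lra.
have Hvu l : (l <= N)%N -> \sum_t v t * bern_step N l (pv t) <=
    \sum_k u k * bern_step N l (pu k) + C / n%:R.
  by move=> /close; rewrite ler_norml; lra.
(* The half step makes the condition k/n <= x the same as k < i. *)
pose x : R := (i%:R - 1/2) / n%:R.
have uv := cdf_compare x u0 u1 hu v0 v1 hv N0 r0 C0n Huv.
have vu := cdf_compare (x - r - r - 1 / N%:R) v0 v1 hv u0 u1 hu N0 r0 C0n Hvu.
have mE : \sum_k u k * (pu k <= x)%R%:R = mean_height R n i j / n%:R.
  exact: mean_cdfE.
have nE y : \sum_t v t * (pv t <= y)%R%:R = node_cdf Q n j y.
  exact: (vE (fun z => (z <= y)%R%:R)).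
move: uv vu; have -> : x - r - r - 1 / N%:R + r + r + 1 / N%:R = x by ring.
rewrite mE !nE => uv vu.
have c1 := node_cdf_close (x + r + r + 1 / N%:R) Qp np jn.
have c2 := node_cdf_close (x - r - r - 1 / N%:R) Qp np jn.
have hi : 0 <= (i%:R / n%:R : R) <= 1.
  by rewrite divr_ge0 //= ler_pdivrMr // mul1r ler_nat.
have hj : 0 <= (j%:R / n%:R : R) <= 1.
  by rewrite divr_ge0 //= ler_pdivrMr // mul1r ler_nat.
have xE : x = i%:R / n%:R - 1/2 * n%:R^-1 by rewrite /x; ring.
have n3 : 0 < 3 / n%:R :> R by rewrite divr_gt0.
have L1 := F_lipschitz (clip_unit (x + r + r + 1 / N%:R)) hi hj.
have L2 := F_lipschitz (clip_unit (x - r - r - 1 / N%:R)) hi hj.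
have D1 := clip_dist (x + r + r + 1 / N%:R) hi.
have D2 := clip_dist (x - r - r - 1 / N%:R) hi.
have iN0 : 0 < 1 / N%:R :> R by rewrite divr_gt0.
have iQ0 : 0 < 1 / Q%:R :> R by rewrite divr_gt0.
have B1 : `|x + r + r + 1 / N%:R - i%:R / n%:R| <= 4 * r.
  by rewrite ler_norml xE; move: nr; lra.
have B2 : `|x - r - r - 1 / N%:R - i%:R / n%:R| <= 4 * r.
  by rewrite ler_norml xE; move: nr; lra.
have M1 := le_trans L1 (le_trans D1 B1); have M2 := le_trans L2 (le_trans D2 B2).
have eE : e = 16 * r by rewrite /r; field.
move: c1 c2 M1 M2 uv vu; rewrite !ler_norml eE; lra.
Qed.

End MeanLimit.

(** * Concentration and convergence in probability *)

Section Deviation.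
Variable R : realType.

Lemma domino_probE n (E : pred (asm n)) : domino_prob R E = Ex (fun M => (E M)%:R).
Proof.
rewrite /domino_prob /Ex big_mkcond; apply: eq_bigr => M _.
by case: (E M); rewrite ?mulr1 ?mulr0.
Qed.

Lemma domino_prob_ge0 n (E : pred (asm n)) : 0 <= domino_prob R E.
Proof. by apply: sumr_ge0 => M _; exact: domino_weight_ge0. Qed.

Lemma hgt_lipschitz n i j : lipschitz (fun M : asm n => (hgt M i j)%:~R : R).
Proof.
move=> A A' c H; rewrite -intrB -intr_norm -[c%:R]/(c%:Z%:~R) ler_int.
exact: H.
Qed.

Lemma height_chebyshev n i j (t : R) : 0 < t ->
  domino_prob R (fun M : asm n => t < `|(hgt M i j)%:~R - mean_height R n i j|)
  <= n%:R / t ^+ 2.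
Proof.
move=> t0; rewrite domino_probE ler_pdivlMr ?exprn_gt0 // -ExZr.
apply: le_trans _ (variance_le (@hgt_lipschitz n i j)); apply: le_Ex => M.
rewrite -/(mean_height R n i j); case: ltP => h; last by rewrite mul0r sqr_ge0.
by rewrite mul1r -[leRHS]real_normK ?num_real // lerXn2r ?nnegrE //; apply: ltW.
Qed.

Lemma unit_steps (f : nat -> R) a k : (forall m, f m <= f m.+1 <= f m + 1) ->
  f a <= f (a + k)%N <= f a + k%:R.
Proof.
move=> H; elim: k => [|k IHk]; first by rewrite addn0 addr0 lexx.
by rewrite addnS -natr1; have := H (a + k)%N; lra.
Qed.

Lemma centred_height_near n (M : asm n) i j a b :
  `|((hgt M (i + a) (j + b))%:~R - mean_height R n (i + a) (j + b)) -
    ((hgt M i j)%:~R - mean_height R n i j)| <= (a + b)%:R.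
Proof.
have hi k m : (hgt M m k)%:~R <= ((hgt M m.+1 k)%:~R : R) <= (hgt M m k)%:~R + 1.
  rewrite -[1]/(1%:~R) -intrD !ler_int; exact: hgt_incl.
have hj k m : (hgt M k m)%:~R <= ((hgt M k m.+1)%:~R : R) <= (hgt M k m)%:~R + 1.
  rewrite -[1]/(1%:~R) -intrD !ler_int; exact: hgt_incr.
have h1 := unit_steps i a (hi (j + b)%N).
have h2 := unit_steps j b (hj i).
have h3 := unit_steps i a (fun m => mean_height_incl R n m (j + b)).
have h4 := unit_steps j b (fun m => mean_height_incr R n i m).
by rewrite natrD ler_norml; lra.
Qed.

(** Chebyshev at the points of a grid with a bounded number of points; between
    them the heights are Lipschitz. *)
Lemma height_concentration (e dlt : R) : 0 < e -> 0 < dlt ->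
  exists n0 : nat, forall n, (n0 <= n)%N ->
  domino_prob R (fun M : asm n => [exists i : 'I_n.+1, exists j : 'I_n.+1,
    e * n%:R < `|(hgt M i j)%:~R - mean_height R n i j|]) <= dlt.
Proof.
move=> e0 d0.
have [K K0 HK] := @exists_inv_le R (e / 4) 1 (divr_gt0 e0 (ltr0n _ 4)) ler01.
have := HK K (leqnn K) => Ke.
have K0R : 0 < K%:R :> R by rewrite ltr0n.
(* The mesh is d = n %/ K, at least n / (2 K), so 2 K + 1 points per side do. *)
pose m := (K + K).+1.
have c0 : 0 <= (m * m)%:R * (4 / e ^+ 2) :> R.
  by rewrite mulr_ge0 // divr_ge0 // exprn_ge0 // ltW.
have [n1 n10 Hn1] := exists_inv_le d0 c0.
exists (maxn n1 K) => n; rewrite geq_max => /andP[nn Kn].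
have n0 : (0 < n)%N := leq_trans K0 Kn.
have n0R : 0 < n%:R :> R by rewrite ltr0n.
pose d := (n %/ K)%N.
have dp : (0 < d)%N by rewrite divn_gt0.
have dn : d%:R <= e / 4 * n%:R :> R.
  have : (d * K)%:R <= n%:R :> R by rewrite ler_nat leq_divM.
  rewrite natrM => h; have : d%:R <= n%:R * (1 / K%:R) :> R.
    by rewrite mulrA mulr1 ler_pdivlMr.
  move=> h2; apply: (le_trans h2); rewrite mulrC ler_pM2r //.
have small i : (i <= n)%N -> (i %/ d < m)%N.
  move=> lin; have h : (n < d.+1 * K)%N by rewrite -ltn_divLR.
  rewrite ltn_divLR //; apply: (leq_ltn_trans lin); apply: (leq_trans h).
  by rewrite /m; nia.
pose E (t : 'I_m * 'I_m) := fun M : asm n =>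
  e / 2 * n%:R < `|(hgt M (t.1 * d) (t.2 * d))%:~R - mean_height R n (t.1 * d) (t.2 * d)|.
apply: (@le_trans _ _ (\sum_t domino_prob R (E t))).
  rewrite domino_probE; under eq_bigr do rewrite domino_probE.
  have -> : \sum_t Ex (fun M : asm n => (E t M)%:R) = Ex (fun M => \sum_t (E t M)%:R) :> R.
    by rewrite /Ex exchange_big /=; apply: eq_bigr => M _; rewrite mulr_sumr.
  apply: le_Ex => M; case: existsP => [[i /existsP[j hij]]|_]; last first.
    by apply: sumr_ge0.
  have si := small i (ltn_ord i); have sj := small j (ltn_ord j).
  rewrite (bigD1 (Ordinal si, Ordinal sj)) //=.
  suff -> : E (Ordinal si, Ordinal sj) M by rewrite lerDl; apply: sumr_ge0.
  rewrite /E /=; have := centred_height_near M (i %/ d * d) (j %/ d * d) (i %% d) (j %% d).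
  rewrite -!divn_eq; have : (i %% d + j %% d)%:R <= e / 2 * n%:R :> R.
    apply: (@le_trans _ _ (d + d)%:R); last by rewrite natrD; lra.
    by rewrite ler_nat leq_add // ltnW // ltn_mod.
  move=> h1 h2; move: hij.
  set A : R := (hgt M i j)%:~R - mean_height R n i j in h2 *.
  set B : R := (hgt M (i %/ d * d) _)%:~R - _ in h2 *.
  move=> hA; have : `|A| <= `|A - B| + `|B|.
    by rewrite -{1}[A](subrK B) ler_normD.
  lra.
apply: (@le_trans _ _ (\sum_(t : 'I_m * 'I_m) (n%:R / (e / 2 * n%:R) ^+ 2))).
  by apply: ler_sum => t _; apply: height_chebyshev; rewrite mulr_gt0 // divr_gt0.
rewrite sumr_const card_prod !card_ord -[_ *+ _]mulr_natl.
have -> : n%:R / (e / 2 * n%:R) ^+ 2 = 4 / e ^+ 2 / n%:R.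
  by field; rewrite !gt_eqF.
by rewrite mulrA; apply: Hn1.
Qed.

End Deviation.

Theorem theorem11 (R : realType) (eps : R) (eps_gt0 : 0 < eps) :
  (fun n : nat => domino_prob R (fun M : asm n => eps < height_deviation R M))
    @ \oo --> (0 : R).
Proof.
apply/cvgrPdist_le => dlt d0.
have e2 : 0 < eps / 2 by rewrite divr_gt0.
have [n1 H1] := mean_height_limit e2.
have [n2 H2] := height_concentration e2 d0.
exists (maxn (maxn n1 n2) 1) => // n /=; rewrite !geq_max => /andP[/andP[n1n n2n] n0].
have n0R : 0 < n%:R :> R by rewrite ltr0n.
rewrite sub0r normrN ger0_norm ?domino_prob_ge0 //.
apply: le_trans _ (H2 n n2n); rewrite !domino_probE; apply: le_Ex => M.
case: (boolP [exists i, _]) => [_|none]; first by case: (_ < _).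
suff /le_gtF -> : height_deviation R M <= eps by [].
rewrite /height_deviation; apply: bigmax_le => [|i _]; first exact: ltW.
apply: bigmax_le => [|j _]; first exact: ltW.
rewrite mxE -/(hgt M i j).
have lin : (i <= n)%N by rewrite -ltnS.
have ljn : (j <= n)%N by rewrite -ltnS.
have h2 := H1 n i j n1n lin ljn.
have h1 : `|(hgt M i j)%:~R / n%:R - mean_height R n i j / n%:R| <= eps / 2.
  rewrite -mulrBl normrM (gtr0_norm (x := _^-1)) ?invr_gt0 // ler_pdivrMr // leNgt.
  apply/negP => h; move/negP: none; apply.
  by apply/existsP; exists i; apply/existsP; exists j.
set f := F _ _ in h2 *.
have -> : (hgt M i j)%:~R / n%:R - f =
  ((hgt M i j)%:~R / n%:R - mean_height R n i j / n%:R) +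
  (mean_height R n i j / n%:R - f) by ring.
apply: le_trans (ler_normD _ _) _; lra.
Qed.
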